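(* Let $f:\mathbb{R}^d\to\mathbb{R}$ be twice differentiable, $L$-smooth, $\mu$-strongly convex and $M$-strongly self-concordant, and let $\varkappa=L/\mu$. Let $1\le k<d$ and $\eta_0\ge 1$, and run the SR-$k$ method (with the randomized or the greedy strategy) from $x_0\in\mathbb{R}^d$ and a symmetric positive definite $G_0\in\mathbb{R}^{d\times d}$ such that $$M\lambda(x_0)\le \frac{\ln 2}{2}\cdot\frac{d-k}{\eta_0 d^2\varkappa}\qquad\text{and}\qquad \nabla^2 f(x_0)\preceq G_0\preceq \eta_0\nabla^2 f(x_0).$$ Then for all $t\ge 0$, $$\mathbb{E}\left[\frac{\lambda(x_{t+1})}{\lambda(x_t)}\right]\le 2d\varkappa\eta_0\left(1-\frac{k}{d}\right)^t .$$ Moreover the following two-stage convergence holds. (a) For the randomized strategy: for any given $\delta\in(0,1)$ there is $t_0=\mathcal{O}\big(d\ln(\varkappa d\eta_0/\delta)/k\big)$ such that, with probability at least $1-\delta$, for all $t\ge 0$, $$\lambda(x_{t_0+t})\le\left(1-\frac{k}{d+k}\right)^{t(t-1)/2}\left(\frac12\right)^t\left(1-\frac{1}{2\eta_0}\right)^{t_0}\lambda(x_0).$$ (b) For the greedy strategy: there is $t_0=\mathcal{O}\big(d\ln(\eta_0 d\varkappa)/k\big)$ such that for all $t\ge0$, $$\lambda(x_{t_0+t})\le\left(1-\frac{k}{d}\right)^{t(t-1)/2}\left(\frac12\right)^t\left(1-\frac{1}{2\eta_0}\right)^{t_0}\lambda(x_0).$$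
   Context: Notation: $\preceq$ is the Loewner order on symmetric matrices; $\|\cdot\|$ is the Euclidean norm; $S^\dagger$ is the Moore–Penrose inverse; $\|v\|_z=(v^\top\nabla^2 f(z)v)^{1/2}$. $\mathcal{O}$ hides absolute constants. Assumptions on $f$: $L$-smooth means $\|\nabla f(x)-\nabla f(y)\|\le L\|x-y\|$ for all $x,y$. $\mu$-strongly convex ($\mu>0$) means $f(\theta x+(1-\theta)y)\le\theta f(x)+(1-\theta)f(y)-\frac{\theta(1-\theta)\mu}{2}\|x-y\|^2$ for all $x,y$ and $\theta\in[0,1]$. $M$-strongly self-concordant ($M>0$) means $\nabla^2 f(y)-\nabla^2 f(x)\preceq M\|y-x\|_z\nabla^2 f(w)$ for all $x,y,z,w\in\mathbb{R}^d$. Local gradient norm: $\lambda(x)=\sqrt{\nabla f(x)^\top(\nabla^2 f(x))^{-1}\nabla f(x)}$. The ratio $\lambda(x_{t+1})/\lambda(x_t)$ is read as $0$ when $\lambda(x_t)=0$. SR-$k$ update: for symmetric positive definite $A\preceq G$ in $\mathbb{R}^{d\times d}$ and $U\in\mathbb{R}^{d\times k}$, $$\text{SR-}k(G,A,U)=G-(G-A)U\big(U^\top(G-A)U\big)^\dagger U^\top(G-A).$$ For $B\in\mathbb{R}^{d\times d}$, $E_k(B)\in\mathbb{R}^{d\times k}$ is the matrix with columns $e_{i_1},\dots,e_{i_k}$ (standard basis vectors), where $i_1,\dots,i_k$ are the indices of the $k$ largest diagonal entries of $B$. SR-$k$ method: given (deterministic) $x_0,G_0,k$, for $t=0,1,\dots$: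 $x_{t+1}=x_t-G_t^{-1}\nabla f(x_t)$; $r_t=\|x_{t+1}-x_t\|_{x_t}$; $\tilde G_t=(1+Mr_t)G_t$; choose $U_t\in\mathbb{R}^{d\times k}$ by either the randomized strategy (entries i.i.d. $\mathcal{N}(0,1)$, independent across iterations) or the greedy strategy ($U_t=E_k(\tilde G_t-\nabla^2 f(x_{t+1}))$); set $G_{t+1}=\text{SR-}k(\tilde G_t,\nabla^2 f(x_{t+1}),U_t)$. Under the greedy strategy everything is deterministic. *)

(* Defs.v *)
From HB Require Import structures.
From mathcomp Require Import all_boot all_order all_algebra.
From mathcomp Require Import all_classical all_reals all_analysis.

Set Implicit Arguments.
Unset Strict Implicit.
Unset Printing Implicit Defensive.

Import Order.TTheory GRing.Theory Num.Theory.
Import numFieldNormedType.Exports.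

Local Open Scope classical_set_scope.
Local Open Scope ring_scope.

Section linear_algebra.
Variable R : realType.

(* The norm `|_| that the library puts on matrices is the sup norm. *)
Definition enorm (d : nat) (v : 'cV[R]_d) : R :=
  Num.sqrt (\sum_(i < d) v i ord0 ^+ 2).

Definition quad (d : nat) (A : 'M[R]_d) (v : 'cV[R]_d) : R :=
  (v^T *m A *m v) ord0 ord0.

Definition posdef (d : nat) (A : 'M[R]_d) : Prop :=
  A^T = A /\ forall v : 'cV[R]_d, v != 0 -> 0 < quad A v.

Definition possemidef (d : nat) (A : 'M[R]_d) : Prop :=
  A^T = A /\ forall v : 'cV[R]_d, 0 <= quad A v.

Definition loewner (d : nat) (A B : 'M[R]_d) : Prop := possemidef (B - A).

Definition penrose (m n : nat) (S : 'M[R]_(m, n)) (X : 'M[R]_(n, m)) : Prop :=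
  [/\ S *m X *m S = S, X *m S *m X = X,
      (S *m X)^T = S *m X & (X *m S)^T = X *m S].

(* The Moore-Penrose inverse is the unique solution of the Penrose equations
   (penrose_mpinv, penrose_uniq); the default value 0 is never taken. The
   library's pinvmx is another, non-canonical, generalized inverse. *)
Definition mpinv (m n : nat) (S : 'M[R]_(m, n)) : 'M[R]_(n, m) :=
  xget 0 [set X | penrose S X].

Lemma penrose_uniq (m n : nat) (S : 'M[R]_(m, n)) (X Y : 'M[R]_(n, m)) :
  penrose S X -> penrose S Y -> X = Y.
Proof.
move=> [sxs xsx sxT xsT] [sys ysy syT ysT].
have e1 : X *m S = Y *m S.
  have h : X *m S = (X *m S) *m (Y *m S) by rewrite mulmxA -(mulmxA X) -mulmxA sys.
  by rewrite -[LHS]xsT h trmx_mul xsT ysT -mulmxA (mulmxA S) sxs.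
have e2 : S *m X = S *m Y.
  have h : S *m X = (S *m Y) *m (S *m X) by rewrite mulmxA sys.
  by rewrite -[LHS]sxT h trmx_mul sxT syT mulmxA sxs.
by rewrite -xsx e1 -mulmxA e2 mulmxA ysy.
Qed.

Lemma row_free_gram_unit (r n : nat) (F : 'M[R]_(r, n)) :
  row_free F -> F *m F^T \in unitmx.
Proof.
move=> Ffree; rewrite -row_free_unit -kermx_eq0; apply/eqP/row_matrixP => i.
rewrite row0; set v := row i _.
have vFF : v *m (F *m F^T) = 0.
  by rewrite /v -row_mul mulmx_ker row0.
have : (v *m F) *m (v *m F)^T = 0.
  by rewrite trmx_mul mulmxA -(mulmxA v) vFF mul0mx.
move=> /matrixP/(_ ord0 ord0); rewrite !mxE => /eqP.
rewrite psumr_eq0 => [/allP s0|j _]; last by rewrite !mxE -expr2 sqr_ge0.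
have vF0 : v *m F = 0.
  apply/matrixP => a j; rewrite (ord1 a) mxE.
  have := s0 j (mem_index_enum j); rewrite /= !mxE -expr2 sqrf_eq0 => /eqP.
  by [].
by apply: (row_free_inj Ffree); rewrite vF0 mul0mx.
Qed.

Lemma penrose_mpinv (m n : nat) (S : 'M[R]_(m, n)) : penrose S (mpinv S).
Proof.
suff [X HX] : exists X, penrose S X by rewrite /mpinv; apply: (xgetPex 0); exists X.
have fullC := col_base_full S; have freeF := row_base_free S.
move: (\rank S) (col_base S) (row_base S) (mulmx_base S) fullC freeF.
move=> r C F CF fullC freeF.
have uF : F *m F^T \in unitmx by apply: row_free_gram_unit.
have uC : C^T *m C \in unitmx.
  rewrite -[X in _ *m X]trmxK; apply: row_free_gram_unit.
  by rewrite /row_free mxrank_tr.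
pose K := invmx (F *m F^T); pose D := invmx (C^T *m C).
have KT : K^T = K by rewrite /K trmx_inv trmx_mul trmxK.
have DT : D^T = D by rewrite /D trmx_inv trmx_mul trmxK.
pose Fr := F^T *m K; pose Cl := D *m C^T.
have FFr : F *m Fr = 1%:M by rewrite /Fr mulmxA mulmxV.
have ClC : Cl *m C = 1%:M by rewrite /Cl -mulmxA mulVmx.
exists (Fr *m Cl).
have SX : S *m (Fr *m Cl) = C *m Cl.
  by rewrite -CF -mulmxA (mulmxA F) FFr mul1mx.
have XS : (Fr *m Cl) *m S = Fr *m F.
  by rewrite -CF -mulmxA (mulmxA Cl) ClC mul1mx.
split; rewrite ?SX ?XS.
- by rewrite -CF -mulmxA (mulmxA Cl) ClC mul1mx.
- by rewrite -mulmxA (mulmxA F) FFr mul1mx.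
- by rewrite /Cl !trmx_mul trmxK DT mulmxA.
- by rewrite /Fr !trmx_mul trmxK KT mulmxA.
Qed.

End linear_algebra.

Section function_classes.
Variables (R : realType) (d : nat).
Implicit Types f : 'cV[R]_d -> R.

Definition grad f (x : 'cV[R]_d) : 'cV[R]_d :=
  \col_(i < d) 'D_(delta_mx i ord0) f x.

Definition hess f (x : 'cV[R]_d) : 'M[R]_d :=
  \matrix_(i < d, j < d) ('D_(delta_mx j ord0) (grad f) x) i ord0.

Definition twice_differentiable f : Prop :=
  (forall x, differentiable f x) /\ (forall x, differentiable (grad f) x).

Definition smooth (L : R) f : Prop :=
  forall x y, enorm (grad f x - grad f y) <= L * enorm (x - y).

Definition strongly_convex (mu : R) f : Prop :=
  forall (x y : 'cV[R]_d) (theta : R), 0 <= theta <= 1 ->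
    f (theta *: x + (1 - theta) *: y) <=
      theta * f x + (1 - theta) * f y
        - theta * (1 - theta) * mu / 2 * enorm (x - y) ^+ 2.

Definition local_norm f (z v : 'cV[R]_d) : R := Num.sqrt (quad (hess f z) v).

Definition strongly_self_concordant (M : R) f : Prop :=
  forall x y z w : 'cV[R]_d,
    loewner (hess f y - hess f x) ((M * local_norm f z (y - x)) *: hess f w).

Definition local_grad_norm f (x : 'cV[R]_d) : R :=
  Num.sqrt (quad (invmx (hess f x)) (grad f x)).

End function_classes.

Section srk_method.
Variables (R : realType) (d k : nat).

Definition sr_k (G A : 'M[R]_d) (U : 'M[R]_(d, k)) : 'M[R]_d :=
  G - (G - A) *m U *m mpinv (U^T *m (G - A) *m U) *m U^T *m (G - A).

(* U is an admissible value of E_k(B). This is a relation because ties among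
   the diagonal entries of B may be broken arbitrarily, and the selected
   indices listed in any order. *)
Definition is_E (B : 'M[R]_d) (U : 'M[R]_(d, k)) : Prop :=
  exists i : 'I_k -> 'I_d,
    [/\ injective i,
        forall (j : 'I_k) (l : 'I_d),
          (forall j' : 'I_k, i j' != l) -> B l l <= B (i j) (i j)
      & U = \matrix_(a < d, j < k) (a == i j)%:R].

Variables (f : 'cV[R]_d -> R) (M : R).

(* From a state (x_t, G_t): the point x_(t+1) and the matrix ~G_t. *)
Definition next_point (s : 'cV[R]_d * 'M[R]_d) : 'cV[R]_d :=
  s.1 - invmx s.2 *m grad f s.1.

Definition scaled_mx (s : 'cV[R]_d * 'M[R]_d) : 'M[R]_d :=
  (1 + M * local_norm f s.1 (next_point s - s.1)) *: s.2.

Fixpoint srk (x0 : 'cV[R]_d) (G0 : 'M[R]_d) (U : nat -> 'M[R]_(d, k))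
    (t : nat) : 'cV[R]_d * 'M[R]_d :=
  if t is t'.+1 then
    let s := srk x0 G0 U t' in
    (next_point s, sr_k (scaled_mx s) (hess f (next_point s)) (U t'))
  else (x0, G0).

Definition greedy (x0 : 'cV[R]_d) (G0 : 'M[R]_d)
    (U : nat -> 'M[R]_(d, k)) : Prop :=
  forall t, let s := srk x0 G0 U t in
    is_E (scaled_mx s - hess f (next_point s)) (U t).

(* lambda(x_t) along the run driven by U. Division by 0 gives 0, so the ratio
   lambda(x_(t+1)) / lambda(x_t) needs no special case. *)
Definition srk_lambda (x0 : 'cV[R]_d) (G0 : 'M[R]_d)
    (U : nat -> 'M[R]_(d, k)) (t : nat) : R :=
  local_grad_norm f (srk x0 G0 U t).1.

End srk_method.

Section randomized.
Variables (R : realType) (disp : measure_display) (T : measurableType disp).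
Variable P : probability T R.

Definition mutually_independent (I : eqType) (X : I -> T -> R) : Prop :=
  forall (J : seq I) (A : I -> set R), uniq J ->
    (forall i, measurable (A i)) ->
    P (\bigcap_(i in [set` J]) (X i @^-1` A i)) =
      (\prod_(i <- J) P (X i @^-1` A i))%E.

(* The entries of all the U_t together form one i.i.d. N(0, 1) family; the
   parameters of normal_prob are the mean and the standard deviation. *)
Definition iid_gaussian (d k : nat) (U : nat -> 'I_d -> 'I_k -> {RV P >-> R}) :
    Prop :=
  mutually_independent
    (fun tij : nat * 'I_d * 'I_k => U tij.1.1 tij.1.2 tij.2 : T -> R) /\
  forall t i j, distribution P (U t i j) = normal_prob (0 : R) (1 : R).

Definition sample (d k : nat) (U : nat -> 'I_d -> 'I_k -> {RV P >-> R})
    (w : T) (t : nat) : 'M[R]_(d, k) :=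
  \matrix_(i < d, j < k) U t i j w.

End randomized.

(* Main.v *)
(* Let [a_t = M lambda(x_t)], let [H_t] be the Hessian at [x_t], [D = d L / mu] and
   [rho = 1 - k/d]. The hypothesis on [x_0] keeps [G_t] between [H_t] and
   [(1 + O(a_0 eta_0)) eta_0 H_t], so [lambda] always decreases at the linear rate
   [1 - 1/(2 eta_0)]. The gap [g_t = tr (G_t - H_t) / mu] satisfies
   [G_t <= (1 + g_t) H_t], so [lambda(x_(t+1)) / lambda(x_t)] is also at most
   [(23/20) (g_t + 2 D a_t) / (1 + g_t)].

   With [B = ~G_t - H_(t+1)], an SR-k update lowers the trace of [B] by at least
   [tr (B P)], where [P] is the orthogonal projection onto the range of [U_t].
   This is at least [(k/d) tr B] for the greedy choice. For a Gaussian [U_t] it has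
   mean [(k/d) tr B] given the past: the law of [P] is invariant under sign changes
   and permutations of the coordinates, so [P] has a scalar mean, and
   [tr P = k] almost surely. Therefore the potential [(g + 2 D a) exp (K a)]
   contracts by [rho] (in mean), for a suitable [K] of order [eta_0 + D / rho].
   This bounds the ratios; part (a) follows from Markov's inequality and a union
   bound over [t], and [t_0] is a time from which the bound on the ratios is below
   [1/2]. *)

Require Import Defs.
From HB Require Import structures.
From mathcomp Require Import all_boot all_order fingroup perm all_algebra.
From mathcomp Require Import all_classical all_reals all_analysis.
From mathcomp Require Import measurable_realfun.
From mathcomp Require Import zify ring lra.

Set Implicit Arguments.
Unset Strict Implicit.
Unset Printing Implicit Defensive.

Import Order.TTheory GRing.Theory Num.Theory.
Import numFieldNormedType.Exports.

Local Open Scope classical_set_scope.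
Local Open Scope ring_scope.

(** * Symmetric matrices and the SR-k update *)

Section bilinear_forms.
Variable R : realType.
Implicit Types d n k : nat.

(** The bound on the ratios must hold for every [t] with the exact factor [2 d kappa eta0] and the
    exact rate, so no constant may be lost per step. The term [2 D a] of the potential absorbs the
    additive part of the drift of the Hessian; what remains is the growth factor [1 + a] and the new
    term [2 D a']. Both are charged to the decrease [a - a'], which telescopes: the exponential
    weight costs at most [exp (K a_0)] over the whole run, and the hypothesis on [x_0] bounds this.
    The quotient [D / rho] in [K] explains the factor [(d - k) / d^2] there.

    All of this holds path by path. Randomness enters once, because [x_(t+1)], [~G_t] and the weight
    at time [t + 1] are fixed before [U_t] is drawn. Conditioning on the past is replaced by
    functions on path space that do not read the coordinates of time [t]. Eigenvalues never appear:
    Loewner estimates are inequalities between quadratic forms, obtained from Cauchy-Schwarz.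
    Pseudoinversion is discontinuous, so its measurability comes from a limit of regularized
    inverses. *)

Definition bil d n (A : 'M[R]_(d, n)) (u : 'cV[R]_d) (v : 'cV[R]_n) : R :=
  (u^T *m A *m v) ord0 ord0.

Lemma quadE d (A : 'M[R]_d) v : quad A v = bil A v v.
Proof. by []. Qed.

Lemma bilDl d n (A : 'M[R]_(d, n)) u u' v :
  bil A (u + u') v = bil A u v + bil A u' v.
Proof. by rewrite /bil raddfD /= !mulmxDl mxE. Qed.

Lemma bilDr d n (A : 'M[R]_(d, n)) u v v' :
  bil A u (v + v') = bil A u v + bil A u v'.
Proof. by rewrite /bil mulmxDr mxE. Qed.

Lemma bilZl d n (A : 'M[R]_(d, n)) c u v : bil A (c *: u) v = c * bil A u v.
Proof. by rewrite /bil linearZ /= -!scalemxAl mxE. Qed.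

Lemma bilZr d n (A : 'M[R]_(d, n)) c u v : bil A u (c *: v) = c * bil A u v.
Proof. by rewrite /bil -scalemxAr mxE. Qed.

Lemma bilNl d n (A : 'M[R]_(d, n)) u v : bil A (- u) v = - bil A u v.
Proof. by rewrite -scaleN1r bilZl mulN1r. Qed.

Lemma bilNr d n (A : 'M[R]_(d, n)) u v : bil A u (- v) = - bil A u v.
Proof. by rewrite -scaleN1r bilZr mulN1r. Qed.

Lemma bil0l d n (A : 'M[R]_(d, n)) v : bil A 0 v = 0.
Proof. by rewrite -(scale0r 0) bilZl mul0r. Qed.

Lemma bilDm d n (A B : 'M[R]_(d, n)) u v : bil (A + B) u v = bil A u v + bil B u v.
Proof. by rewrite /bil mulmxDr mulmxDl mxE. Qed.

Lemma bilNm d n (A : 'M[R]_(d, n)) u v : bil (- A) u v = - bil A u v.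
Proof. by rewrite /bil mulmxN mulNmx mxE. Qed.

Lemma bilZm d n (A : 'M[R]_(d, n)) c u v : bil (c *: A) u v = c * bil A u v.
Proof. by rewrite /bil -scalemxAr -scalemxAl mxE. Qed.

Lemma bilM d m n p (A : 'M[R]_(m, n)) (B : 'M[R]_(m, d)) (C : 'M[R]_(n, p)) u v :
  bil A (B *m u) (C *m v) = bil (B^T *m A *m C) u v.
Proof. by rewrite /bil trmx_mul !mulmxA. Qed.

Lemma bilMr m n p (A : 'M[R]_(m, n)) (C : 'M[R]_(n, p)) u v :
  bil A u (C *m v) = bil (A *m C) u v.
Proof. by rewrite /bil !mulmxA. Qed.

Lemma bilMl d m n (A : 'M[R]_(m, n)) (B : 'M[R]_(m, d)) u v :
  bil A (B *m u) v = bil (B^T *m A) u v.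
Proof. by rewrite /bil trmx_mul !mulmxA. Qed.

Lemma bilT d n (A : 'M[R]_(d, n)) u v : bil A u v = bil A^T v u.
Proof.
rewrite /bil -[in LHS](trmxK (u^T *m A *m v)) [LHS]mxE.
by rewrite !trmx_mul trmxK mulmxA.
Qed.

Lemma bil_sym d (A : 'M[R]_d) u v : A^T = A -> bil A u v = bil A v u.
Proof. by move=> AT; rewrite bilT AT. Qed.

Lemma bil_delta d n (A : 'M[R]_(d, n)) i j :
  bil A (delta_mx i ord0) (delta_mx j ord0) = A i j.
Proof. by rewrite /bil trmx_delta -rowE -colE !mxE. Qed.

Lemma quadDm d (A B : 'M[R]_d) v : quad (A + B) v = quad A v + quad B v.
Proof. exact: bilDm. Qed.

Lemma quadBm d (A B : 'M[R]_d) v : quad (A - B) v = quad A v - quad B v.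
Proof. by rewrite !quadE bilDm bilNm. Qed.

Lemma quadZm d c (A : 'M[R]_d) v : quad (c *: A) v = c * quad A v.
Proof. exact: bilZm. Qed.

Lemma quadZ d c (A : 'M[R]_d) v : quad A (c *: v) = c ^+ 2 * quad A v.
Proof. by rewrite !quadE bilZl bilZr mulrA expr2. Qed.

Lemma quadN d (A : 'M[R]_d) v : quad A (- v) = quad A v.
Proof. by rewrite !quadE bilNl bilNr opprK. Qed.

Lemma quad0 d (A : 'M[R]_d) : quad A 0 = 0.
Proof. by rewrite quadE bil0l. Qed.

Lemma quad1E d (v : 'cV[R]_d) : quad 1%:M v = \sum_(i < d) v i ord0 ^+ 2.
Proof.
by rewrite /quad mulmx1 mxE; apply: eq_bigr => i _; rewrite mxE expr2.
Qed.

Lemma quad1_ge0 d (v : 'cV[R]_d) : 0 <= quad 1%:M v.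
Proof. by rewrite quad1E sumr_ge0 // => i _; rewrite sqr_ge0. Qed.

Lemma quad1_eq0 d (v : 'cV[R]_d) : quad 1%:M v = 0 -> v = 0.
Proof.
rewrite quad1E => /eqP; rewrite psumr_eq0 => [/allP v0|i _]; last exact: sqr_ge0.
apply/matrixP => i j; rewrite (ord1 j) mxE; apply/eqP.
by have := v0 i (mem_index_enum i); rewrite /= sqrf_eq0.
Qed.

Lemma quad1_gt0 d (v : 'cV[R]_d) : v != 0 -> 0 < quad 1%:M v.
Proof.
move=> v0; rewrite lt_neqAle quad1_ge0 andbT eq_sym.
by apply: contra v0 => /eqP/quad1_eq0 ->.
Qed.

Lemma enorm_sqr d (v : 'cV[R]_d) : enorm v ^+ 2 = quad 1%:M v.
Proof. by rewrite /enorm -quad1E sqr_sqrtr // quad1_ge0. Qed.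

Lemma enorm_ge0 d (v : 'cV[R]_d) : 0 <= enorm v.
Proof. exact: sqrtr_ge0. Qed.

Lemma quad_entry d (A : 'M[R]_d) i : quad A (delta_mx i ord0) = A i i.
Proof. exact: bil_delta. Qed.

Lemma quad1_delta d (i : 'I_d) : quad 1%:M (delta_mx i ord0) = 1 :> R.
Proof. by rewrite quad_entry mxE eqxx. Qed.

Lemma trmxB m n (A B : 'M[R]_(m, n)) : (A - B)^T = A^T - B^T.
Proof. exact: linearB. Qed.

Lemma sym_sub n (A B : 'M[R]_n) : A^T = A -> B^T = B -> (A - B)^T = A - B.
Proof. by move=> AT BT; rewrite trmxB AT BT. Qed.

Lemma posdef_psd d (A : 'M[R]_d) : posdef A -> possemidef A.
Proof.
move=> [AT A0]; split => // v; have [->|v0] := eqVneq v 0; first by rewrite quad0.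
exact/ltW/A0.
Qed.

Lemma posdef_unit d (A : 'M[R]_d) : posdef A -> A \in unitmx.
Proof.
move=> [AT A0]; rewrite -row_free_unit -kermx_eq0; apply/eqP/row_matrixP => i.
rewrite row0; set v := row i _; apply/eqP/negPn/negP => v0.
have vA : v *m A = 0 by rewrite /v -row_mul mulmx_ker row0.
have /A0 : v^T != 0 by apply: contra v0 => /eqP v0; rewrite -(trmxK v) v0 trmx0.
by rewrite /quad trmxK vA mul0mx mxE ltxx.
Qed.

Lemma posdef_invT d (A : 'M[R]_d) : posdef A -> (invmx A)^T = invmx A.
Proof. by move=> [AT _]; rewrite trmx_inv AT. Qed.

(** The discriminant criterion, by evaluation at the minimizer [- b / c]. If [c = 0] and [b] is
    nonzero, the chosen point gives the value [-1]. *)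
Lemma nonneg_quadratic (a b c : R) : 0 <= c ->
  (forall t, 0 <= a + 2 * t * b + t ^+ 2 * c) -> b ^+ 2 <= a * c.
Proof.
move=> cge0 H; have [c0|c0] := eqVneq c 0.
  have [->|b0] := eqVneq b 0; first by rewrite expr0n c0 mulr0.
  have := H (- (a + 1) / (2 * b)); rewrite c0 mulr0 addr0.
  have -> : 2 * (- (a + 1) / (2 * b)) * b = - (a + 1) by field.
  lra.
have cp : 0 < c by rewrite lt_neqAle eq_sym c0.
have := H (- b / c).
have -> : a + 2 * (- b / c) * b + (- b / c) ^+ 2 * c = (a * c - b ^+ 2) / c by field.
by rewrite pmulr_lge0 ?invr_gt0 // subr_ge0.
Qed.

Lemma psd_cauchy d (A : 'M[R]_d) u v : possemidef A ->
  bil A u v ^+ 2 <= quad A u * quad A v.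
Proof.
move=> [AT A0]; apply: nonneg_quadratic => [|t]; first exact: A0.
have := A0 (u + t *: v); rewrite quadE bilDl !bilDr !bilZl !bilZr.
by rewrite (bil_sym v u AT) -!quadE; lra.
Qed.

Lemma psd_quad0 d (A : 'M[R]_d) v : possemidef A -> quad A v = 0 -> A *m v = 0.
Proof.
move=> psdA v0; apply/matrixP => i j; rewrite (ord1 j) [RHS]mxE.
have := psd_cauchy (delta_mx i ord0) v psdA; rewrite v0 mulr0 => H.
have /eqP : bil A (delta_mx i ord0) v ^+ 2 = 0 by apply/eqP; rewrite eq_le H sqr_ge0.
by rewrite sqrf_eq0 /bil trmx_delta -mulmxA -rowE mxE => /eqP.
Qed.

Lemma psd_mulmx0 d k (A : 'M[R]_d) (U : 'M[R]_(d, k)) :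
  possemidef A -> U^T *m A *m U = 0 -> A *m U = 0.
Proof.
move=> psdA U0; apply/matrixP => i j; rewrite [RHS]mxE.
have := @psd_quad0 _ A (U *m delta_mx j ord0) psdA.
have -> : quad A (U *m delta_mx j ord0) = 0.
  by rewrite quadE bilM U0 /bil mulmx0 mul0mx mxE.
by move=> /(_ erefl); rewrite mulmxA -colE => /matrixP/(_ i ord0); rewrite !mxE.
Qed.

Lemma psd_congr d k (A : 'M[R]_d) (U : 'M[R]_(d, k)) :
  possemidef A -> possemidef (U^T *m A *m U).
Proof.
move=> [AT A0]; split; first by rewrite !trmx_mul trmxK AT mulmxA.
by move=> v; rewrite quadE -bilM -quadE.
Qed.

Lemma psd_tr_ge0 d (A : 'M[R]_d) : possemidef A -> 0 <= \tr A.
Proof.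
by move=> [_ A0]; apply: sumr_ge0 => i _; rewrite -quad_entry.
Qed.

Lemma bil1_cauchy d (u v : 'cV[R]_d) :
  bil 1%:M u v ^+ 2 <= quad 1%:M u * quad 1%:M v.
Proof. by apply: psd_cauchy; split; [exact: trmx1|exact: quad1_ge0]. Qed.

(* Expanding the second argument in the standard basis and using
   Cauchy-Schwarz twice bounds the largest eigenvalue by the trace. *)
Lemma psd_le_tr d (A : 'M[R]_d) v : possemidef A ->
  quad A v <= \tr A * quad 1%:M v.
Proof.
move=> psdA; have [AT A0] := psdA.
have Av j : (A *m v) j ord0 ^+ 2 <= A j j * quad A v.
  have := psd_cauchy (delta_mx j ord0) v psdA.
  by rewrite quad_entry /bil trmx_delta -mulmxA -rowE mxE.
have vAv : quad A v = bil 1%:M v (A *m v) by rewrite quadE bilMr mul1mx.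
have [->|v0] := eqVneq (quad A v) 0.
  by rewrite mulr_ge0 ?psd_tr_ge0 // quad1_ge0.
have vp : 0 < quad A v by rewrite lt_neqAle eq_sym v0 A0.
have H1 : quad 1%:M (A *m v) <= \tr A * quad A v.
  by rewrite quad1E /mxtrace mulr_suml ler_sum.
rewrite -(ler_pM2r vp) -expr2 {1}vAv.
apply: le_trans (bil1_cauchy _ _) _.
by rewrite mulrC mulrAC ler_wpM2r // quad1_ge0.
Qed.

Lemma psd_entry_le_tr d (A : 'M[R]_d) i j : possemidef A -> `|A i j| <= \tr A.
Proof.
move=> psdA; have trA := psd_tr_ge0 psdA.
have dj l : 0 <= A l l <= \tr A.
  rewrite -quad_entry psdA.2 /=; apply: le_trans (psd_le_tr _ psdA) _.
  by rewrite quad_entry mxE eqxx mulr1.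
rewrite -(@ler_pXn2r _ 2) ?nnegrE // real_normK ?num_real //.
have := psd_cauchy (delta_mx i ord0) (delta_mx j ord0) psdA.
rewrite !quad_entry bil_delta => /le_trans; apply.
by rewrite expr2; have /andP[? ?] := dj i; have /andP[? ?] := dj j; rewrite ler_pM.
Qed.

(* Add the values of the nonnegative forms [c H + E] at [u - t v] and
   [c H - E] at [u + t v]. *)
Lemma bil_dominated d (E H : 'M[R]_d) c u v : E^T = E -> H^T = H ->
  (forall w, `|quad E w| <= c * quad H w) ->
  bil E u v ^+ 2 <= c ^+ 2 * (quad H u * quad H v).
Proof.
move=> ET HT Ew.
have -> : c ^+ 2 * (quad H u * quad H v) = (c * quad H u) * (c * quad H v) by ring.
rewrite -sqrrN; apply: nonneg_quadratic => [|t].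
  exact: le_trans (normr_ge0 _) (Ew v).
have := Ew (u + t *: v); have := Ew (u - t *: v).
rewrite !ler_norml => /andP[+ _] /andP[_ +].
rewrite !(quadE, bilDl, bilDr, bilNl, bilNr, bilZl, bilZr).
rewrite (bil_sym v u ET) (bil_sym v u HT); lra.
Qed.

Lemma quad_inv d (H : 'M[R]_d) g : posdef H ->
  quad (invmx H) g = quad H (invmx H *m g).
Proof.
move=> pdH; rewrite !quadE bilM posdef_invT // mulVmx ?mul1mx //.
exact: posdef_unit.
Qed.

Lemma quad_inv_ge0 d (H : 'M[R]_d) g : posdef H -> 0 <= quad (invmx H) g.
Proof. by move=> pdH; rewrite quad_inv //; have [_ ->] := posdef_psd pdH. Qed.

Lemma dual_cauchy d (H : 'M[R]_d) u g : posdef H ->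
  bil 1%:M u g ^+ 2 <= quad H u * quad (invmx H) g.
Proof.
move=> pdH; rewrite quad_inv //.
have -> : bil 1%:M u g = bil H u (invmx H *m g).
  by rewrite bilMr mulmxV // posdef_unit.
exact/psd_cauchy/posdef_psd.
Qed.

(* With [Z = quad (B H^-1 B) y], two Cauchy-Schwarz steps give
   [Z <= e B <= e^2 H] at [y], which is the eigenvalue bound
   [(1 - 1/gamma)^2 <= (1 - 1/(1 + e))^2] for [1 <= gamma <= 1 + e] without
   diagonalizing. *)
Lemma loewner_contraction d (H B : 'M[R]_d) e u y : posdef H -> possemidef B ->
  0 <= e -> loewner B (e *: H) ->
  (1 + e) ^+ 2 * bil B u y ^+ 2
    <= e ^+ 2 * (quad H u * quad (invmx H) ((H + B) *m y)).
Proof.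
move=> pdH psdB e0 [_ BleH]; have uH := posdef_unit pdH.
have [psHT psH] := posdef_psd pdH; have [BT B0] := psdB.
have BH w : quad B w <= e * quad H w by have := BleH w; rewrite quadBm quadZm; lra.
pose w := invmx H *m (B *m y); pose Z := quad H w.
have Hw : H *m w = B *m y by rewrite /w mulmxA mulmxV // mul1mx.
have Z0 : 0 <= Z by exact: psH.
have ZE : Z = bil B w y by rewrite /Z quadE -(mul1mx H) -bilMr Hw bilMr mul1mx.
have byu : bil B u y ^+ 2 <= quad H u * Z.
  by rewrite -(mul1mx B) -bilMr -Hw bilMr mul1mx psd_cauchy // posdef_psd.
have ZeB : Z <= e * quad B y.
  have [->|Zn0] := eqVneq Z 0; first by rewrite mulr_ge0.
  have Zp : 0 < Z by rewrite lt_neqAle eq_sym Zn0.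
  rewrite -(ler_pM2l Zp) -expr2 {1}ZE.
  apply: le_trans (psd_cauchy _ _ psdB) _.
  by rewrite mulrCA mulrA ler_wpM2r // BH.
have XE : quad (invmx H) ((H + B) *m y) = quad H y + 2 * quad B y + Z.
  rewrite quad_inv // mulmxDl mulmxDr !mulmxA mulVmx // mul1mx -!mulmxA -/w.
  have yw : bil H y w = quad B y by rewrite -(mul1mx H) -bilMr Hw bilMr mul1mx.
  have wy : bil H w y = quad B y by rewrite bil_sym.
  by rewrite quadE bilDl !bilDr yw wy -!quadE -/Z; ring.
rewrite XE.
apply: le_trans (ler_wpM2l (sqr_ge0 _) byu) _.
have HyB : Z <= e ^+ 2 * quad H y.
  by apply: le_trans ZeB _; rewrite expr2 -mulrA ler_wpM2l.
have Hu0 := psH u.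
rewrite [leLHS](_ : _ = quad H u * ((1 + e) ^+ 2 * Z)); last by ring.
rewrite [leRHS](_ : _ = quad H u * (e ^+ 2 * (quad H y + 2 * quad B y + Z))); last by ring.
rewrite ler_wpM2l //.
have : e * Z <= e * (e * quad B y) by rewrite ler_wpM2l.
by rewrite !mulrDr !mulrA -!expr2; nra.
Qed.

End bilinear_forms.

(** * The SR-k update and orthogonal projections *)

Section symmetric_rank_k.
Variables (R : realType) (d k : nat).
Implicit Types (A B G : 'M[R]_d) (U : 'M[R]_(d, k)).

Lemma penrose_tr m n (S : 'M[R]_(m, n)) X : penrose S X -> penrose S^T X^T.
Proof.
move=> [h1 h2 h3 h4]; split.
- by rewrite -!trmx_mul mulmxA h1.
- by rewrite -!trmx_mul mulmxA h2.
- by rewrite -!trmx_mul h4.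
- by rewrite -!trmx_mul h3.
Qed.

Lemma mpinv_sym n (S : 'M[R]_n) : S^T = S -> (mpinv S)^T = mpinv S.
Proof.
move=> ST; apply: (penrose_uniq _ (penrose_mpinv S)).
by rewrite -{1}ST; apply/penrose_tr/penrose_mpinv.
Qed.

Definition sr_term B U : 'M[R]_d :=
  B *m U *m mpinv (U^T *m B *m U) *m U^T *m B.

Lemma sr_kE G A U : sr_k G A U = G - sr_term (G - A) U.
Proof. by []. Qed.

Definition proj U : 'M[R]_d := U *m mpinv U.

(** [W] is idempotent, has its range inside that of [U], and is self-adjoint for the form [B]: the
    update removes from [B] its part along [W]. *)
Lemma sr_termE B U : possemidef B ->
  let W := U *m mpinv (U^T *m B *m U) *m U^T *m B in
  [/\ B *m W = sr_term B U, W^T *m B = sr_term B U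
    & W^T *m B *m W = sr_term B U].
Proof.
move=> [BT B0] W; set C := U^T *m B *m U in W *.
have CT : C^T = C by rewrite /C !trmx_mul trmxK BT mulmxA.
have BW : B *m W = sr_term B U by rewrite /W /sr_term !mulmxA.
have WB : W^T *m B = sr_term B U.
  by rewrite /W /sr_term !trmx_mul trmxK mpinv_sym // BT !mulmxA.
split => //; rewrite WB /sr_term /W -/C.
have [_ + _ _] := penrose_mpinv C; rewrite {2}/C => XCX.
by rewrite !mulmxA -[in RHS]XCX !mulmxA.
Qed.

Lemma sr_term_psd B U : possemidef B -> possemidef (sr_term B U).
Proof. by move=> psdB; have [_ _ <-] := sr_termE U psdB; apply: psd_congr. Qed.

(** What remains is the congruence of [B] by the complementary projection [1 - W]. *)
Lemma sr_rest_psd B U : possemidef B -> possemidef (B - sr_term B U).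
Proof.
move=> psdB; have := sr_termE U psdB; set W := (U *m _ *m _ *m _) => /= -[h1 h2 h3].
have -> : B - sr_term B U = (1%:M - W)^T *m B *m (1%:M - W).
  have -> : (1%:M - W)^T = 1%:M - W^T by rewrite linearB /= trmx1.
  by rewrite mulmxBl mul1mx mulmxBr mulmx1 mulmxBl h1 h3 h2 subrr subr0.
exact: psd_congr.
Qed.

Lemma proj_sym U : (proj U)^T = proj U.
Proof. by have [_ _ ? _] := penrose_mpinv U. Qed.

Lemma proj_idem U : proj U *m proj U = proj U.
Proof. by have [h _ _ _] := penrose_mpinv U; rewrite /proj mulmxA h. Qed.

Lemma psd_proj U : possemidef (proj U).
Proof.
have -> : proj U = (proj U)^T *m 1%:M *m proj U by rewrite mulmx1 proj_sym proj_idem.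
by apply: psd_congr; split; [exact: trmx1 | exact: quad1_ge0].
Qed.

Lemma psd_proj_compl U : possemidef (1%:M - proj U).
Proof.
have -> : 1%:M - proj U = (1%:M - proj U)^T *m 1%:M *m (1%:M - proj U).
  have -> : (1%:M - proj U)^T = 1%:M - proj U by rewrite linearB /= trmx1 proj_sym.
  rewrite mulmx1 mulmxBl mul1mx mulmxBr mulmx1 proj_idem.
  by rewrite subrr subr0.
by apply: psd_congr; split; [exact: trmx1 | exact: quad1_ge0].
Qed.

(* [B - sr_term B U] annihilates [U], hence [sr_term B U] and [B] agree on the
   range of [U]. *)
Lemma tr_sr_rest B U : possemidef B ->
  \tr (B - sr_term B U) <= \tr B - \tr (B *m proj U).
Proof.
move=> psdB; have psdR := sr_rest_psd U psdB; have psdK := sr_term_psd U psdB.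
set K := sr_term B U in psdR psdK *.
have RU : (B - K) *m U = 0.
  apply: psd_mulmx0 => //; rewrite mulmxBr mulmxBl.
  have [h _ _ _] := penrose_mpinv (U^T *m B *m U).
  by rewrite /K /sr_term !mulmxA -{1}h !mulmxA subrr.
have RP : B *m proj U = K *m proj U.
  by apply/eqP; rewrite -subr_eq0 -mulmxBl /proj mulmxA RU mul0mx.
rewrite RP linearB /= lerD2l lerN2 -subr_ge0 -linearB /=.
have -> : \tr (K - K *m proj U) = \tr ((1%:M - proj U)^T *m K *m (1%:M - proj U)).
  have Q2 : (1%:M - proj U) *m (1%:M - proj U) = 1%:M - proj U.
    by rewrite mulmxBl mul1mx mulmxBr mulmx1 proj_idem subrr subr0.
  have -> : (1%:M - proj U)^T = 1%:M - proj U by rewrite linearB /= trmx1 proj_sym.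
  by rewrite mxtrace_mulC [_ *m (_ *m K)]mulmxA Q2 mxtrace_mulC mulmxBr mulmx1.
exact/psd_tr_ge0/psd_congr.
Qed.

(** Keeps the integrands of the averaging argument bounded. The diagonal lies in [[0, 1]] because
    [P] and [1 - P] are both positive semidefinite. *)
Lemma proj_entry_bound U i j : `|proj U i j| <= 1.
Proof.
have dj l : 0 <= proj U l l <= 1.
  have := (psd_proj U).2 (delta_mx l ord0); rewrite quad_entry => -> /=.
  have := (psd_proj_compl U).2 (delta_mx l ord0).
  by rewrite quad_entry !mxE eqxx subr_ge0.
rewrite -(@ler_pXn2r _ 2) ?nnegrE // real_normK ?num_real //.
have := psd_cauchy (delta_mx i ord0) (delta_mx j ord0) (psd_proj U).
rewrite !quad_entry bil_delta => /le_trans; apply.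
by rewrite expr2; have /andP[? ?] := dj i; have /andP[? ?] := dj j; rewrite ler_pM.
Qed.

Lemma mpinv_left m n (S : 'M[R]_(m, n)) Y : Y *m S = 1%:M -> mpinv S *m S = 1%:M.
Proof.
move=> YS; have [h _ _ _] := penrose_mpinv S.
by rewrite -[LHS]mul1mx -YS -mulmxA [S *m _]mulmxA h.
Qed.

Lemma tr_proj U Y : Y *m U = 1%:M -> \tr (proj U) = k%:R.
Proof. by move=> YU; rewrite /proj mxtrace_mulC (mpinv_left YU) mxtrace1. Qed.

(** Carries symmetries of the Gaussian law over to the projection; [Q] will be a sign matrix or a
    permutation matrix. *)
Lemma proj_orthogonal (Q : 'M[R]_d) U : Q^T *m Q = 1%:M ->
  proj (Q *m U) = Q *m proj U *m Q^T.
Proof.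
move=> QQ; rewrite /proj.
have -> : mpinv (Q *m U) = mpinv U *m Q^T.
  apply: penrose_uniq (penrose_mpinv _) _; have [h1 h2 h3 h4] := penrose_mpinv U.
  have e1 : mpinv U *m Q^T *m (Q *m U) = mpinv U *m U.
    by rewrite -mulmxA (mulmxA Q^T) QQ mul1mx.
  split.
  - by rewrite -mulmxA e1 -mulmxA (mulmxA U) h1.
  - by rewrite e1 mulmxA h2.
  - by rewrite mulmxA -(mulmxA Q) !trmx_mul trmxK -trmx_mul h3 mulmxA.
  - by rewrite e1.
by rewrite !mulmxA.
Qed.

(** The columns of [U] are orthonormal, so [U^T] is its pseudoinverse and the trace on the right is
    the sum of the [k] selected diagonal entries. Their average is at least the average over the
    whole diagonal. *)
Lemma tr_proj_greedy B U : is_E B U ->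
  k%:R * \tr B <= d%:R * \tr (B *m proj U).
Proof.
case=> i [inj_i topk ->]; set U' := \matrix_(_, _) _.
have UU : U'^T *m U' = 1%:M.
  apply/matrixP => j l; rewrite !mxE (bigD1 (i j)) //= !mxE eqxx mul1r big1.
    by rewrite addr0 (inj_eq inj_i).
  by move=> a aij; rewrite !mxE (negbTE aij) mul0r.
have mpU : mpinv U' = U'^T.
  apply: penrose_uniq (penrose_mpinv _) _; split.
  - by rewrite -mulmxA UU mulmx1.
  - by rewrite UU mul1mx.
  - by rewrite trmx_mul trmxK.
  - by rewrite UU trmx1.
have -> : \tr (B *m proj U') = \sum_(j < k) B (i j) (i j).
  rewrite /proj mpU mulmxA mxtrace_mulC mulmxA; apply: eq_bigr => j _.
  rewrite mxE (bigD1 (i j)) //= big1 => [|a aij]; last by rewrite !mxE (negbTE aij) mulr0.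
  rewrite !mxE eqxx mulr1 addr0 (bigD1 (i j)) //= big1 => [|a aij].
    by rewrite !mxE eqxx mul1r addr0.
  by rewrite !mxE (negbTE aij) mul0r.
set s := \sum_(j < k) _; pose S := [set i j | j in 'I_k]%SET.
have cardS : #|S| = k by rewrite card_imset // card_ord.
have SE : \sum_(l in S) B l l = s by rewrite big_imset //= => a b _ _ /inj_i.
have kd : (k <= d)%N by rewrite -cardS -[leqRHS]card_ord max_card.
rewrite /mxtrace (bigID (mem S)) /= SE.
(* Sum over all pairs of a selected and an unselected index. *)
have rest : k%:R * (\sum_(l | l \notin S) B l l) <= (d%:R - k%:R) * s.
  have -> : (d%:R - k%:R) * s = \sum_(l | l \notin S) s.
    rewrite sumr_const -[RHS]mulr_natl -natrB //; congr (_%:R * _).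
    have := cardC (mem S); rewrite cardS card_ord => e.
    by rewrite -[in LHS]e addKn; apply: eq_card.
  rewrite mulr_sumr; apply: ler_sum => l lS.
  have -> : k%:R * B l l = \sum_(j < k) B l l by rewrite sumr_const card_ord mulr_natl.
  apply: ler_sum => j _; apply: topk => j'.
  by apply: contra lS => /eqP <-; apply: imset_f.
by rewrite mulrDr; lra.
Qed.

End symmetric_rank_k.

(** * Gradients and Hessians *)

(** The derivative is also the limit of the right difference quotients, so control on one side of 0
    suffices. *)
Lemma derive_ge (R : realType) (g : R -> R) (l c e : R) :
  is_derive (0 : R) (1 : R) g l -> 0 < e ->
  (forall s, 0 < s < e -> c * s <= g s - g 0) -> c <= l.
Proof.
move=> [dg gl] e0 H; rewrite -gl.
have dgl : (fun h => h^-1 *: (g (h *: 1 + 0) - g 0)) @ 0^' --> 'D_1 g 0 by exact: dg.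
apply: (cvgr_to_ge (cvg_dnbhs_at_right dgl)).
near=> s; rewrite addr0 [s *: 1]mulr1 [_ *: _]mulrC.
rewrite ler_pdivlMr; last by near: s; exact: nbhs_right_gt.
by apply: H; apply/andP; split; near: s; [exact: nbhs_right_gt|exact: nbhs_right_lt].
Unshelve. all: by end_near. Qed.

Lemma derive_le (R : realType) (g : R -> R) (l c e : R) :
  is_derive (0 : R) (1 : R) g l -> 0 < e ->
  (forall s, 0 < s < e -> g s - g 0 <= c * s) -> l <= c.
Proof.
move=> dg e0 H; rewrite -lerN2; apply: (@derive_ge _ (- g) _ _ e) => // s /H.
have E t : (- g) t = - g t by [].
by rewrite !E; lra.
Qed.

Section calculus.
Variables (R : realType) (d : nat).
Implicit Types (f : 'cV[R]_d -> R) (x h u v : 'cV[R]_d).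

Lemma is_derive_line (W : normedModType R) (g : 'cV[R]_d -> W) x h (s : R) :
  differentiable g (x + s *: h) ->
  is_derive s (1 : R) (fun s : R => g (x + s *: h)) ('D_h g (x + s *: h)).
Proof.
move=> dg; have gd := @diff_derivable _ _ _ g (x + s *: h) h dg.
have e : (fun t : R => t^-1 *: (g (x + (t *: 1 + s) *: h) - g (x + s *: h)))
       = (fun t => t^-1 *: (g (t *: h + (x + s *: h)) - g (x + s *: h))).
  apply/funext => t; congr (_ *: (g _ - _)).
  by rewrite [t *: 1]mulr1 scalerDl addrCA.
by split; rewrite /derivable /derive /= e.
Qed.

Lemma colvec_sum_delta v : v = \sum_(i < d) v i ord0 *: delta_mx i ord0.
Proof.
rewrite [LHS]matrix_sum_delta; apply: eq_bigr => i _.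
by rewrite big_ord1.
Qed.

Lemma derive_lin (W : normedModType R) (g : 'cV[R]_d -> W) x v :
  differentiable g x ->
  'D_v g x = \sum_(i < d) v i ord0 *: 'D_(delta_mx i ord0) g x.
Proof.
move=> dg; rewrite deriveE // {1}(colvec_sum_delta v) linear_sum.
by apply: eq_bigr => i _; rewrite linearZ /= deriveE.
Qed.

Lemma bil1E u v : bil 1%:M u v = \sum_(i < d) u i ord0 * v i ord0.
Proof. by rewrite /bil mulmx1 mxE; apply: eq_bigr => i _; rewrite mxE. Qed.

Lemma derive_grad f x v : differentiable f x -> 'D_v f x = bil 1%:M (grad f x) v.
Proof.
move=> df; rewrite derive_lin // bil1E; apply: eq_bigr => i _.
by rewrite mxE mulrC.
Qed.

Lemma derive_hess f x v : differentiable (grad f) x -> 'D_v (grad f) x = hess f x *m v.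
Proof.
move=> df; rewrite derive_lin //; apply/matrixP => i j; rewrite (ord1 j).
by rewrite summxE mxE; apply: eq_bigr => l _; rewrite !mxE mulrC.
Qed.

Lemma is_derive_coord n (g : R -> 'cV[R]_n) (s : R) l i :
  is_derive s (1 : R) g l -> is_derive s (1 : R) (fun t => g t i ord0) (l i ord0).
Proof.
move=> [dg gl]; split; first by move/derivable_mxP : dg.
by rewrite -gl derive_mx // mxE.
Qed.

(** A sequential limit, as needed to get measurability of the Hessian from that of the gradient. *)
Lemma derive_quotient_cvg n (g : 'cV[R]_d -> 'cV[R]_n) x v i : differentiable g x ->
  (fun l : nat => l.+1%:R * (g (x + l.+1%:R^-1 *: v) i ord0 - g x i ord0)) @ \oo
    --> ('D_v g x) i ord0.
Proof.
move=> dg; have dgx : differentiable g (x + (0 : R) *: v) by rewrite scale0r addr0.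
have [dl gl] := is_derive_coord i (is_derive_line dgx).
rewrite scale0r addr0 in gl.
pose q (h : R) := h^-1 *: (g (x + (h *: 1 + 0) *: v) i ord0 - g (x + (0 : R) *: v) i ord0).
have cq : q @ 0^' --> ('D_v g x) i ord0 by rewrite -gl; exact: dl.
have /cvg_at_rightP/(_ harmonic) := cvg_dnbhs_at_right cq.
have -> : (fun l => q (harmonic l)) = (fun l : nat =>
    l.+1%:R * (g (x + l.+1%:R^-1 *: v) i ord0 - g x i ord0)).
  by apply/funext => l; rewrite /q /harmonic /= invrK addr0 [_ *: 1]mulr1 scale0r addr0.
apply; split; [exact: harmonic_gt0|exact: cvg_harmonic].
Qed.

Lemma is_derive_grad_line f x h u (s : R) : differentiable (grad f) (x + s *: h) ->
  is_derive s (1 : R) (fun s : R => bil 1%:M u (grad f (x + s *: h)))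
    (bil (hess f (x + s *: h)) u h).
Proof.
move=> df; have dl := is_derive_line df; rewrite derive_hess // in dl.
have -> : (fun s : R => bil 1%:M u (grad f (x + s *: h))) =
          \sum_(i < d) (u i ord0 *: (fun s : R => grad f (x + s *: h) i ord0)).
  apply/funext => t; rewrite bil1E fct_sumE; apply: eq_bigr => i _.
  by [].
have -> : bil (hess f (x + s *: h)) u h =
          \sum_(i < d) (u i ord0 *: (hess f (x + s *: h) *m h) i ord0).
  by rewrite -[X in bil X u h]mul1mx -bilMr bil1E.
apply: is_derive_sum => i; apply: is_deriveZ.
exact: is_derive_coord.
Qed.

(** The intermediate point depends on [u], since the mean value theorem fails for vector-valued
    maps. One test vector per step will be enough. *)
Lemma grad_mvt f x h u : (forall z, differentiable (grad f) z) ->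
  exists2 s : R, 0 <= s <= 1 &
    bil 1%:M u (grad f (x + h)) = bil 1%:M u (grad f x) + bil (hess f (x + s *: h)) u h.
Proof.
move=> df; pose g (s : R) := bil 1%:M u (grad f (x + s *: h)).
have dg s : is_derive s (1 : R) g (bil (hess f (x + s *: h)) u h).
  exact: is_derive_grad_line.
have [|s] := @MVT R g _ 0 1 ltr01 (fun s _ => dg s).
  apply: continuous_subspaceT => s; apply: differentiable_continuous.
  by apply/derivable1_diffP; case: (dg s).
rewrite in_itv /= => /andP[s0 s1]; rewrite /g !(scale0r, scale1r, addr0, subr0, mulr1).
by exists s; [rewrite !ltW|lra].
Qed.

Lemma bil1_enorm u v : `|bil 1%:M u v| <= enorm u * enorm v.
Proof.
have en := @enorm_ge0 R d.
rewrite -(@ler_pXn2r _ 2) ?nnegrE //; last by rewrite mulr_ge0.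
rewrite real_normK ?num_real //.
by rewrite exprMn !enorm_sqr bil1_cauchy.
Qed.

Lemma enormZ (c : R) v : enorm (c *: v) = `|c| * enorm v.
Proof.
have en := @enorm_ge0 R d.
apply: (@pexpIrn R 2) => //; rewrite ?nnegrE //; first by rewrite mulr_ge0.
by rewrite exprMn !enorm_sqr quadZ real_normK // num_real.
Qed.

Lemma smooth_hess L f x v : (forall z, differentiable (grad f) z) -> smooth L f ->
  quad (hess f x) v <= L * quad 1%:M v.
Proof.
move=> df Lf.
have dg : is_derive (0 : R) (1 : R) (fun s : R => bil 1%:M v (grad f (x + s *: v)))
    (quad (hess f x) v).
  by have := @is_derive_grad_line f x v v 0 (df _); rewrite scale0r addr0 -quadE.
apply: (derive_le dg ltr01) => s /andP[s0 _].
rewrite scale0r addr0 -bilNr -bilDr.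
apply: le_trans (ler_norm _) _; apply: le_trans (bil1_enorm _ _) _.
have := Lf (x + s *: v) x; rewrite addrAC subrr add0r enormZ (gtr0_norm s0) => H.
apply: le_trans (ler_wpM2l (enorm_ge0 v) H) _.
by rewrite -enorm_sqr le_eqVlt; apply/orP; left; apply/eqP; ring.
Qed.

Lemma strongly_convex_grad mu f x y : (forall z, differentiable f z) ->
  strongly_convex mu f ->
  bil 1%:M (grad f y) (x - y) <= f x - f y - mu / 2 * quad 1%:M (x - y).
Proof.
move=> df scf; set N := quad _ (x - y).
have dg : is_derive (0 : R) (1 : R) (fun s : R => f (y + s *: (x - y)))
    (bil 1%:M (grad f y) (x - y)).
  have := @is_derive_line _ f y (x - y) 0 (df _).
  by rewrite scale0r addr0 derive_grad.
rewrite leNgt; apply/negP => lt.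
set b := bil _ _ _ in dg lt; set c := f x - f y - _ in lt.
(* [eps] is half of the supposed gap, and [e] keeps the second-order term [s^2 mu N / 2] below
   [eps s]. *)
pose eps := (b - c) / 2; pose e := Num.min 1 (eps / (`|mu| * N + 1)).
have N0 : 0 <= N by exact: quad1_ge0.
have eps0 : 0 < eps by rewrite /eps; lra.
have den0 : 0 < `|mu| * N + 1 by rewrite ltr_wpDl // mulr_ge0.
have e0 : 0 < e by rewrite lt_min ltr01 divr_gt0.
suff : b <= c + eps by rewrite /eps; lra.
apply: (derive_le dg e0) => s /andP[s0]; rewrite lt_min => /andP[s1].
rewrite ltr_pdivlMr // => se.
have s01 : 0 <= s <= 1 by rewrite !ltW.
have := scf x y s s01; rewrite scale0r addr0.
have -> : s *: x + (1 - s) *: y = y + s *: (x - y).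
  by rewrite scalerBl scale1r scalerBr addrCA addrA addrAC -addrA.
rewrite enorm_sqr -/N => H.
rewrite lerBlDl.
apply: le_trans H _; rewrite /c.
have h1 : mu * N * s <= `|mu| * N * s by rewrite !ler_wpM2r // ?ler_norm // ltW.
nra.
Qed.

(** Adding [strongly_convex_grad] in both directions gives strong monotonicity of the gradient,
    whose difference quotients along [v] tend to the Hessian form. *)
Lemma strongly_convex_hess mu f x v : (forall z, differentiable f z) ->
  (forall z, differentiable (grad f) z) -> strongly_convex mu f ->
  mu * quad 1%:M v <= quad (hess f x) v.
Proof.
move=> df dgf scf.
have dg : is_derive (0 : R) (1 : R) (fun s : R => bil 1%:M v (grad f (x + s *: v)))
    (quad (hess f x) v).
  by have := @is_derive_grad_line f x v v 0 (dgf _); rewrite scale0r addr0 -quadE.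
apply: (derive_ge dg ltr01) => s /andP[s0 _]; rewrite scale0r addr0.
have := strongly_convex_grad (x + s *: v) x df scf.
have := strongly_convex_grad x (x + s *: v) df scf.
have -> : x - (x + s *: v) = - (s *: v) by rewrite opprD addrA subrr add0r.
have -> : x + s *: v - x = s *: v by rewrite addrAC subrr add0r.
rewrite bilNr quadN !bilZr quadZ.
rewrite !(bil_sym _ v (trmx1 _ _)).
move: (f x) (f _) (bil _ v _) (bil _ v _) (quad 1%:M v) => fx fy a b N h1 h2.
have : s * (mu * s * N) <= s * (b - a) by nra.
by rewrite ler_pM2l //; lra.
Qed.

End calculus.

(** * One step of the method *)

(* [A] stands for the local norm at [x] of the dual vector representing the
   next gradient, and [p] for [1 - 1/eta]. *)
Lemma newton_contraction (R : realType) (lam lam' r A M p b1 b2 : R) :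
  0 <= lam -> 0 <= lam' -> 0 <= r -> 0 <= A -> 0 < M -> 0 <= p -> r <= lam ->
  lam' ^+ 2 = b1 + b2 -> b1 <= p * (A * lam) -> b2 <= M * r * (A * r) ->
  A ^+ 2 <= (1 + M * r) * lam' ^+ 2 ->
  lam' <= (1 + M * lam / 2) * (p + M * lam) * lam.
Proof.
move=> l0 l'0 r0 A0 M0 p0 rl e h1 h2 A2.
have Ml0 : 0 <= M * lam by rewrite mulr_ge0 // ltW.
have Mrl : M * r <= M * lam by rewrite ler_pM2l.
have f0 : 0 <= 1 + M * lam / 2 by rewrite addr_ge0 // divr_ge0.
(* By [sqrt (1 + x) <= 1 + x / 2]. *)
have Ale : A <= (1 + M * lam / 2) * lam'.
  rewrite -(@ler_pXn2r _ 2) ?nnegrE //; last by rewrite mulr_ge0.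
  apply: le_trans A2 _; rewrite exprMn ler_wpM2r ?sqr_ge0 //.
  by have := sqr_ge0 (M * lam); lra.
have key : lam' ^+ 2 <= (p + M * lam) * (A * lam).
  rewrite e; apply: le_trans (lerD h1 h2) _.
  have h : M * r * (A * r) <= M * lam * (A * lam).
    by apply: ler_pM => //; rewrite ?mulr_ge0 ?ler_wpM2l // ltW.
  by rewrite mulrDl lerD2l.
have c0 : 0 <= (p + M * lam) * lam by rewrite mulr_ge0 // addr_ge0.
have [->|l'n0] := eqVneq lam' 0; first by rewrite -mulrA mulr_ge0.
have l'p : 0 < lam' by rewrite lt_neqAle eq_sym l'n0.
rewrite -(ler_pM2l l'p) -expr2; apply: le_trans key _.
by have := ler_wpM2l c0 Ale; lra.
Qed.

Section hessian_bounds.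
Variables (R : realType) (d : nat) (f : 'cV[R]_d -> R) (L mu M : R).
Hypothesis mu_gt0 : 0 < mu.
Hypothesis f2 : twice_differentiable f.
Hypothesis f_smooth : smooth L f.
Hypothesis f_convex : strongly_convex mu f.
Hypothesis f_concordant : strongly_self_concordant M f.
Hypothesis hessT : forall x, (hess f x)^T = hess f x.

Local Notation H := (hess f).

Lemma hess_posdef x : posdef (H x).
Proof.
split; first exact: hessT.
move=> v v0; have [df dgf] := f2.
apply: lt_le_trans (strongly_convex_hess x v df dgf f_convex).
by rewrite mulr_gt0 ?quad1_gt0.
Qed.

Lemma hess_ge x v : mu * quad 1%:M v <= quad (H x) v.
Proof. by have [df dgf] := f2; apply: strongly_convex_hess. Qed.

Lemma hess_le x v : quad (H x) v <= L * quad 1%:M v.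
Proof. by have [df dgf] := f2; apply: smooth_hess. Qed.

Lemma tr_hess_le x : \tr (H x) <= d%:R * L.
Proof.
rewrite /mxtrace mulr_natl -[X in _ *+ X]card_ord -sumr_const; apply: ler_sum => i _.
by have := hess_le x (delta_mx i ord0); rewrite quad1_delta quad_entry mulr1.
Qed.

Lemma mu_le_L : (0 < d)%N -> mu <= L.
Proof.
move=> d0; have := hess_ge 0 (delta_mx (Ordinal d0) ord0).
by move/le_trans => /(_ _ (hess_le _ _)); rewrite quad1_delta !mulr1.
Qed.

Lemma concordant_quad x y z w v :
  quad (H y) v - quad (H x) v <= M * local_norm f z (y - x) * quad (H w) v.
Proof. by have [_ /(_ v)] := f_concordant x y z w; rewrite quadBm quadZm quadBm subr_ge0. Qed.

End hessian_bounds.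

Definition energy_norm (R : realType) d (A : 'M[R]_d) v : R := Num.sqrt (quad A v).

Definition dual_norm (R : realType) d (A : 'M[R]_d) g : R := Num.sqrt (quad (invmx A) g).

Lemma energy_norm_ge0 (R : realType) d (A : 'M[R]_d) v : 0 <= energy_norm A v.
Proof. exact: sqrtr_ge0. Qed.

Lemma dual_norm_ge0 (R : realType) d (A : 'M[R]_d) v : 0 <= dual_norm A v.
Proof. exact: sqrtr_ge0. Qed.

Lemma energy_normN (R : realType) d (A : 'M[R]_d) v : energy_norm A (- v) = energy_norm A v.
Proof. by rewrite /energy_norm quadN. Qed.

Lemma energy_normZ (R : realType) d (A : 'M[R]_d) c v : 0 <= c ->
  energy_norm A (c *: v) = c * energy_norm A v.
Proof.
by move=> c0; rewrite /energy_norm quadZ sqrtrM ?sqr_ge0 // sqrtr_sqr ger0_norm.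
Qed.

(* [H] and [g] abstract the Hessian and the gradient of [f]: unfolding the
   concrete ones makes unification diverge. *)
Section newton_model.
Variables (R : realType) (d k : nat) (L M : R).
Variables (H : 'cV[R]_d -> 'M[R]_d) (g : 'cV[R]_d -> 'cV[R]_d).
Hypothesis M_gt0 : 0 < M.
Hypothesis H_posdef : forall x, posdef (H x).
Hypothesis H_concordant : forall x y z w v,
  quad (H y) v - quad (H x) v <= M * energy_norm (H z) (y - x) * quad (H w) v.
Hypothesis g_mvt : forall x h u, exists2 s : R, 0 <= s <= 1 &
  bil 1%:M u (g (x + h)) = bil 1%:M u (g x) + bil (H (x + s *: h)) u h.
Hypothesis tr_H_le : forall x, \tr (H x) <= d%:R * L.
Variables (x x' y : 'cV[R]_d) (G : 'M[R]_d).

Let HT z : (H z)^T = H z. Proof. by case: (H_posdef z). Qed.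

Let psdH z : possemidef (H z). Proof. exact: posdef_psd. Qed.

Lemma energy_norm_sqr z v : energy_norm (H z) v ^+ 2 = quad (H z) v.
Proof. by rewrite sqr_sqrtr //; case: (psdH z). Qed.

Lemma dual_norm_sqr z v : dual_norm (H z) v ^+ 2 = quad (invmx (H z)) v.
Proof. by rewrite sqr_sqrtr // quad_inv_ge0. Qed.

Hypothesis H_le_G : loewner (H x) G.
Hypothesis Gy : G *m y = g x.
Hypothesis x'_def : x' = x - y.

Local Notation r := (energy_norm (H x) y).
Local Notation lam := (dual_norm (H x) (g x)).
Local Notation lam' := (dual_norm (H x') (g x')).

Let GE : H x + (G - H x) = G. Proof. by rewrite addrC subrK. Qed.

Let Mr_ge0 : 0 <= M * r.
Proof. by rewrite mulr_ge0 ?energy_norm_ge0 // ltW. Qed.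

Lemma state_posdef : posdef G.
Proof.
rewrite -GE; split; first by rewrite linearD /= HT; case: H_le_G => ->.
move=> v v0; rewrite quadDm; apply: ltr_pwDl; first exact: (H_posdef _).2.
exact: H_le_G.2.
Qed.

(** [r^2 <= y^T G y = y^T (g x) <= r lam], by [H x <= G] and duality; then divide by [r]. *)
Lemma step_length_le : r <= lam.
Proof.
have := dual_cauchy y (g x) (H_posdef x).
rewrite -energy_norm_sqr -dual_norm_sqr => yg.
have r2le : r ^+ 2 <= bil 1%:M y (g x).
  rewrite -Gy bilMr mul1mx -quadE energy_norm_sqr -GE quadDm lerDl.
  exact: H_le_G.2.
move: yg r2le (energy_norm_ge0 (H x) y) (dual_norm_ge0 (H x) (g x)).
move: (bil _ _ _) (energy_norm _ _) (dual_norm _ _) => b q l.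
rewrite -exprMn => bql qb q0 l0.
have bl : b <= q * l.
  rewrite -(@ler_pXn2r _ 2) ?nnegrE // ?mulr_ge0 //.
  exact: le_trans (sqr_ge0 _) qb.
have [->//|qn0] := eqVneq q 0.
rewrite -(@ler_pM2l _ q); first by rewrite -expr2 (le_trans qb).
by rewrite lt_neqAle eq_sym qn0.
Qed.

Let x'E : x' - x = - y. Proof. by rewrite x'_def addrAC subrr add0r. Qed.

Lemma hess_next_le v : quad (H x') v <= (1 + M * r) * quad (H x) v.
Proof. by have := H_concordant x x' x x v; rewrite x'E energy_normN; lra. Qed.

(** The reference point [w] of self-concordance is free: taking it at [x'] reverses the comparison
    with the same factor, without a denominator [1 - M r]. *)
Lemma hess_le_next v : quad (H x) v <= (1 + M * r) * quad (H x') v.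
Proof. by have := H_concordant x' x x x' v; rewrite -(opprB x' x) x'E opprK; lra. Qed.

(** Test the gradient at [x'] with [u], its image under the inverse Hessian. As [G y = g x], the
    mean value theorem gives [lam'^2 = u^T (G - H z) y], which splits at [H x] into the error [b1]
    of the quasi-Newton matrix and the error [b2] of the moving Hessian. *)
Lemma newton_step_bound eta : 1 <= eta -> loewner G (eta *: H x) ->
  lam' <= (1 + M * lam / 2) * (1 - eta^-1 + M * lam) * lam.
Proof.
move=> eta1 G_le; have eta0 : 0 < eta by exact: lt_le_trans eta1.
pose u := invmx (H x') *m g x'.
have u2 : quad (H x') u = lam' ^+ 2.
  by rewrite -quad_inv ?dual_norm_sqr.
have ug : bil 1%:M u (g x') = lam' ^+ 2.
  by rewrite dual_norm_sqr /u bilMl posdef_invT ?mulmx1 ?quadE.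
have [t /andP[t0 t1]] := g_mvt x (- y) u.
rewrite -x'_def bilNr; set z := (X in H X) => mvt.
have b1 : bil (G - H x) u y <= (1 - eta^-1) * (energy_norm (H x) u * lam).
  have e0 : 0 <= eta - 1 by rewrite subr_ge0.
  (* The contraction lemma with [e = eta - 1] yields the factor [(eta - 1) / eta = 1 - 1/eta]. *)
  have BleH : loewner (G - H x) ((eta - 1) *: H x).
    by move: G_le; rewrite /loewner scalerBl scale1r opprB addrA subrK.
  have := loewner_contraction u y (H_posdef x) H_le_G e0 BleH.
  rewrite GE Gy -energy_norm_sqr -dual_norm_sqr.
  move: (bil _ _ _) (energy_norm_ge0 (H x) u) (dual_norm_ge0 (H x) (g x)).
  move: (energy_norm _ _) (dual_norm _ _) => A l b A0 l0.
  rewrite [1 + _]addrC subrK -!exprMn => c2.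
  have {}c2 : eta * b <= (eta - 1) * (A * l).
    apply: le_trans (ler_norm _) _.
    rewrite -(@ler_pXn2r _ 2) ?nnegrE ?mulr_ge0 //.
    by rewrite real_normK ?num_real.
  rewrite -(ler_pM2l eta0); apply: le_trans c2 _.
  by rewrite [leRHS]mulrA mulrBr mulr1 divff // gt_eqF.
have b2 : bil (H x - H z) u y <= M * r * (energy_norm (H x) u * r).
  have zx : energy_norm (H x) (z - x) = t * r.
    by rewrite /z addrAC subrr add0r energy_normZ // energy_normN.
  have xz : energy_norm (H x) (x - z) = t * r by rewrite -opprB energy_normN.
  have dom w : `|quad (H x - H z) w| <= (M * r) * quad (H x) w.
    have Hw : 0 <= quad (H x) w := (psdH x).2 w.
    have h3 : M * (t * r) * quad (H x) w <= M * r * quad (H x) w.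
      by rewrite ler_wpM2r // ler_pM2l // ler_piMl // energy_norm_ge0.
    have := H_concordant z x x x w; have := H_concordant x z x x w.
    by move: h3; rewrite zx xz quadBm ler_norml; lra.
  have symE := sym_sub (HT x) (HT z).
  have := bil_dominated u y symE (HT x) dom.
  rewrite -!energy_norm_sqr; move: Mr_ge0 (energy_norm_ge0 (H x) u) (energy_norm_ge0 (H x) y).
  move: (bil _ _ _) (energy_norm (H x) y) (energy_norm (H x) u) => b q A Mq A0 q0.
  rewrite -!exprMn => b2; apply: le_trans (ler_norm _) _.
  have rhs0 : 0 <= M * q * (A * q) by rewrite mulr_ge0 // mulr_ge0.
  by rewrite -(@ler_pXn2r _ 2) ?nnegrE // real_normK ?num_real.
apply: (newton_contraction _ _ (energy_norm_ge0 (H x) y) _ M_gt0 _ step_length_le _ b1 b2).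
- exact: dual_norm_ge0.
- exact: dual_norm_ge0.
- exact: energy_norm_ge0.
- by rewrite subr_ge0 invf_le1.
- have uGy : bil 1%:M u (g x) = bil G u y by rewrite -Gy bilMr mul1mx.
  have e2 := bilDm G (- H x) u y; have e3 := bilNm (H x) u y.
  have e4 := bilDm (H x) (- H z) u y; have e5 := bilNm (H z) u y.
  by clear b1 b2 u2; move: ug mvt uGy e2 e3 e4 e5; lra.
- by rewrite energy_norm_sqr -u2; exact: hess_le_next.
Qed.

Local Notation G' := ((1 + M * r) *: G).

(** The purpose of the scaling by [1 + M r]: it compensates the largest possible growth of the
    Hessian along the step. *)
Lemma residual_psd : possemidef (G' - H x').
Proof.
split; first by rewrite trmxB linearZ /= HT state_posdef.1.
move=> v; rewrite quadBm subr_ge0 quadZm.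
apply: le_trans (hess_next_le v) _; rewrite ler_wpM2l ?addr_ge0 //.
by have [_ /(_ v)] := H_le_G; rewrite quadBm subr_ge0.
Qed.

Lemma next_lower (U : 'M[R]_(d, k)) : loewner (H x') (sr_k G' (H x') U).
Proof.
by rewrite /loewner sr_kE addrAC; apply: sr_rest_psd; exact: residual_psd.
Qed.

(** One factor [1 + M r] comes from the scaling of [G], the other from comparing [H x] with
    [H x']. *)
Lemma next_upper (U : 'M[R]_(d, k)) eta : loewner G (eta *: H x) -> 0 <= eta ->
  loewner (sr_k G' (H x') U) (((1 + M * r) ^+ 2 * eta) *: H x').
Proof.
move=> G_le eta0; have psdK := sr_term_psd U residual_psd.
rewrite /loewner sr_kE; split.
  by rewrite !trmxB psdK.1 !linearZ /= HT state_posdef.1.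
move=> v; rewrite !quadBm !quadZm.
have Gv : quad G v <= eta * quad (H x) v.
  by have [_ /(_ v)] := G_le; rewrite quadBm quadZm subr_ge0.
have {}Gv := le_trans Gv (ler_wpM2l eta0 (hess_le_next v)).
have Mr1 : 0 <= 1 + M * r by rewrite addr_ge0.
rewrite subr_ge0 lerBlDr; apply: le_trans (ler_wpM2l Mr1 Gv) _.
rewrite [leLHS](_ : _ = (1 + M * r) ^+ 2 * eta * quad (H x') v); last by ring.
by rewrite lerDl; exact: psdK.2.
Qed.

Lemma tr_residual_le :
  \tr (G' - H x') <= (1 + M * r) * \tr (G - H x) + 2 * (M * r) * (d%:R * L).
Proof.
have trH : \tr (H x) <= (1 + M * r) * \tr (H x').
  rewrite /mxtrace mulr_sumr; apply: ler_sum => i _.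
  by have := hess_le_next (delta_mx i ord0); rewrite !quad_entry.
rewrite !linearB linearZ /=.
move: trH (psd_tr_ge0 (psdH x)) (psd_tr_ge0 (psdH x')) (tr_H_le x) Mr_ge0.
move: (\tr (H x)) (\tr (H x')) (\tr G) (M * r) (d%:R * L) => a b c m D ab a0 b0 aD m0.
have h1 : 2 * m * a <= 2 * m * D by rewrite ler_wpM2l // mulr_ge0.
(* From [a <= (1 + m) b] and [1 - m^2 <= 1]. It leaves [(1 + m) a - b <= 2 m a], hence the factor 2
   in front of [D]. *)
have h2 : (1 - m) * a <= b.
  have [m1|m1] := leP m 1; last first.
    by apply: le_trans b0; rewrite mulr_le0_ge0 // subr_le0 ltW.
  have : (1 - m) * a <= (1 - m) * ((1 + m) * b) by rewrite ler_wpM2l // subr_ge0.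
  by move/le_trans; apply; have := mulr_ge0 (sqr_ge0 m) b0; lra.
lra.
Qed.

End newton_model.

(** * Scalar estimates of the contraction factor *)

Section rates.
Variable R : realType.
Variable eta0 : R.
Implicit Types a E g D v : R.

Definition newton_rate (a eta : R) : R := (1 + a / 2) * (1 - eta^-1 + a).

(** [3/32] is the bound on [eta0 a_0] and [169/256 = (1 - 2 * 3/32)^2] the loss allowed by [relax].
    In units of [1/eta0], the gain [169/256] minus [3/2 * 3/32] and a second-order term stays just
    above [1/2]. *)
Lemma newton_rate_linear a E : 1 <= eta0 -> 0 <= a -> eta0 * a <= 3 / 32 ->
  0 < E -> E * (169 / 256) <= eta0 -> newton_rate a E <= 1 - 1 / (2 * eta0).
Proof.
move=> e1 a0 ea E0 Ee; have e0 : 0 < eta0 by exact: lt_le_trans e1.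
have -> : 1 / (2 * eta0) = eta0^-1 / 2 by field; rewrite gt_eqF.
have iE : eta0^-1 * (169 / 256) <= E^-1.
  by rewrite [leLHS]mulrC ler_pdivrMr // [leRHS]mulrC ler_pdivlMr // mulrC.
have ai : a <= 3 / 32 * eta0^-1 by rewrite ler_pdivlMr // mulrC.
have i1 : eta0^-1 <= 1 by rewrite invf_le1.
have j0 : 0 < E^-1 by rewrite invr_gt0.
rewrite /newton_rate; move: E^-1 eta0^-1 iE ai i1 j0 => j i iE ai i1 j0.
have h1 : 0 <= a * j by rewrite mulr_ge0 // ltW.
have h2 : a * a <= 3 / 32 * a by rewrite ler_wpM2r //; lra.
lra.
Qed.

(** Use the smaller of the bounds [E] and [1 + g]. Its inverse is at least [169/256] of [1/eta0], so
    the errors in [a] cost less than a quarter of it. *)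
Lemma newton_rate_progress a E g : 1 <= eta0 -> 0 <= a -> eta0 * a <= 3 / 32 ->
  0 < E -> E * (169 / 256) <= eta0 -> 0 <= g ->
  Num.min (newton_rate a E) (newton_rate a (1 + g)) <= 1 - (3 / 4) / (1 + g).
Proof.
move=> e1 a0 ea E0 Ee g0; have e0 : 0 < eta0 by exact: lt_le_trans e1.
have g10 : 0 < 1 + g by rewrite ltr_wpDr.
have iE : eta0^-1 * (169 / 256) <= E^-1.
  by rewrite [leLHS]mulrC ler_pdivrMr // [leRHS]mulrC ler_pdivlMr // mulrC.
have ai : a <= 3 / 32 * eta0^-1 by rewrite ler_pdivlMr // mulrC.
have i1 : eta0^-1 <= 1 by rewrite invf_le1.
have j0 : 0 < E^-1 by rewrite invr_gt0.
have l0 : 0 < (1 + g)^-1 by rewrite invr_gt0.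
rewrite ge_min /newton_rate.
move: E^-1 eta0^-1 (1 + g)^-1 iE ai i1 j0 l0 => j i l iE ai i1 j0 l0.
have h1 : 0 <= a * j by rewrite mulr_ge0 // ltW.
have h3 : 0 <= a * l by rewrite mulr_ge0 // ltW.
have h2 : a * a <= 3 / 32 * a by rewrite ler_wpM2r //; lra.
have [jl|lj] := leP l j; apply/orP; [left|right]; lra.
Qed.

(** The worst coefficient is that of [g], namely [(1 + 3/64) (1 + 3/32) < 23/20]. *)
Lemma newton_rate_superlinear a g D : 0 <= a -> a <= 3 / 32 -> 0 <= g -> 2 <= D ->
  newton_rate a (1 + g) * (1 + g) <= 23 / 20 * (g + 2 * D * a).
Proof.
move=> a0 a1 g0 D2; have g10 : 0 < 1 + g by rewrite ltr_wpDr.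
have -> : newton_rate a (1 + g) * (1 + g) = (1 + a / 2) * (g + a * (1 + g)).
  by rewrite /newton_rate; field; rewrite gt_eqF.
have h1 : a * g <= 3 / 32 * g by rewrite ler_wpM2r.
have h2 : a * a <= 3 / 32 * a by rewrite ler_wpM2r.
have h3 : a * (a * g) <= 3 / 32 * (3 / 32 * g).
  by apply: ler_pM => //; rewrite mulr_ge0.
have h4 : 2 * a <= D * a by rewrite ler_wpM2r.
lra.
Qed.

(* The bound on [G] relative to [H]: it absorbs the factor [(1 + a)^2] lost when
   the Hessian moves, because [a] drops by at least [a / (2 eta0)]. *)
Definition relax a0 a : R := eta0 / (1 - 2 * eta0 * (a0 - a)) ^+ 2.

Lemma relax_den a0 a : 1 <= eta0 -> 0 <= a -> a <= a0 -> eta0 * a0 <= 3 / 32 ->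
  13 / 16 <= 1 - 2 * eta0 * (a0 - a) <= 1.
Proof.
move=> e1 a_ge0 aa ea; have e0 : 0 < eta0 by exact: lt_le_trans e1.
have h1 : 0 <= eta0 * a by rewrite mulr_ge0 // ltW.
have h2 : 0 <= eta0 * (a0 - a) by rewrite mulr_ge0 ?subr_ge0 // ltW.
lra.
Qed.

Lemma relax_bounds a0 a : 1 <= eta0 -> 0 <= a -> a <= a0 -> eta0 * a0 <= 3 / 32 ->
  1 <= relax a0 a /\ relax a0 a * (169 / 256) <= eta0.
Proof.
move=> e1 a_ge0 aa ea; have e0 : 0 < eta0 by exact: lt_le_trans e1.
have /andP[d1 d2] := relax_den e1 a_ge0 aa ea.
rewrite /relax; move: (1 - _) d1 d2 => c c1 c2.
have c0 : 0 < c ^+ 2 by rewrite exprn_gt0 //; lra.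
have c3 : 169 / 256 <= c ^+ 2 by rewrite expr2; nra.
have c4 : c ^+ 2 <= 1 by rewrite expr2; nra.
split; first by rewrite ler_pdivlMr // mul1r; lra.
by rewrite mulrAC ler_pdivrMr // ler_wpM2l // ltW.
Qed.

(** Let [c] and [c'] be the quantities squared in the two denominators. The linear decrease gives
    [c' <= c - a], and [(1 + a) (c - a) <= c] because [c <= 1]. *)
Lemma relax_step a0 a a' b : 1 <= eta0 -> 0 <= a' -> a <= a0 ->
  eta0 * a0 <= 3 / 32 -> a' <= (1 - 1 / (2 * eta0)) * a -> 0 <= b <= a ->
  (1 + b) ^+ 2 * relax a0 a <= relax a0 a'.
Proof.
move=> e1 a'0 aa ea lin /andP[b0 ba]; have e0 : 0 < eta0 by exact: lt_le_trans e1.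
have a_ge0 : 0 <= a by lra.
have i0 : 0 <= 1 / (2 * eta0) by rewrite divr_ge0 // mulr_ge0 // ltW.
have ia := mulr_ge0 i0 a_ge0.
have a'a : a' <= a by move: ia; lra.
have /andP[d1 d2] := relax_den e1 a_ge0 aa ea.
have /andP[d'1 d'2] := relax_den e1 a'0 (le_trans a'a aa) ea.
have dd : 1 - 2 * eta0 * (a0 - a') <= 1 - 2 * eta0 * (a0 - a) - a.
  have : 2 * eta0 * a' <= 2 * eta0 * ((1 - 1 / (2 * eta0)) * a).
    by rewrite ler_wpM2l // mulr_ge0 // ltW.
  have -> : 2 * eta0 * ((1 - 1 / (2 * eta0)) * a) = 2 * eta0 * a - a.
    by field; rewrite gt_eqF.
  lra.
rewrite /relax; move: (1 - _) (1 - _) d1 d2 d'1 d'2 dd => c c' c1 c2 c'1 c'2 cc.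
have c0 : 0 < c by lra.
have c'0 : 0 < c' by lra.
rewrite mulrCA ler_pM2l // -expr_div_n -exprVn ler_pXn2r ?nnegrE ?invr_ge0 ?divr_ge0 //; try lra.
rewrite ler_pdivrMr // ler_pdivlMl //.
nra.
Qed.

End rates.

(** * Invariants and potential along a run *)

Section run.
Variables (R : realType) (d k : nat) (L mu M eta0 a0 : R).
Variables (H : 'cV[R]_d -> 'M[R]_d) (g : 'cV[R]_d -> 'cV[R]_d).
Implicit Type s : 'cV[R]_d * 'M[R]_d.

Definition step_point s : 'cV[R]_d := s.1 - invmx s.2 *m g s.1.
Definition step_scaled s : 'M[R]_d :=
  (1 + M * energy_norm (H s.1) (step_point s - s.1)) *: s.2.
Definition step s (U : 'M[R]_(d, k)) : 'cV[R]_d * 'M[R]_d :=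
  (step_point s, sr_k (step_scaled s) (H (step_point s)) U).
Fixpoint run s (U : nat -> 'M[R]_(d, k)) t :=
  if t is t'.+1 then step (run s U t') (U t') else s.

Definition lam s : R := dual_norm (H s.1) (g s.1).
Definition next_lam s : R := dual_norm (H (step_point s)) (g (step_point s)).
Definition gap s : R := \tr (s.2 - H s.1) / mu.
Definition residual s : 'M[R]_d := step_scaled s - H (step_point s).

Hypothesis kd : (1 <= k < d)%N.
Hypothesis mu_gt0 : 0 < mu.
Hypothesis mu_le_L : mu <= L.
Hypothesis M_gt0 : 0 < M.
Hypothesis H_posdef : forall x, posdef (H x).
Hypothesis H_concordant : forall x y z w v,
  quad (H y) v - quad (H x) v <= M * energy_norm (H z) (y - x) * quad (H w) v.
Hypothesis g_mvt : forall x h u, exists2 s : R, 0 <= s <= 1 &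
  bil 1%:M u (g (x + h)) = bil 1%:M u (g x) + bil (H (x + s *: h)) u h.
Hypothesis tr_H_le : forall x, \tr (H x) <= d%:R * L.
Hypothesis H_ge : forall x v, mu * quad 1%:M v <= quad (H x) v.
Hypothesis eta0_ge1 : 1 <= eta0.

Local Notation kappa := (L / mu).
Local Notation D := (d%:R * kappa).
Local Notation rho := (1 - k%:R / d%:R : R).

Hypothesis a0_small : a0 <= 3 / 8 * (rho / (eta0 * D)).

Definition state_inv s : Prop :=
  [/\ loewner (H s.1) s.2, loewner s.2 (relax eta0 a0 (M * lam s) *: H s.1)
    & M * lam s <= a0].

Lemma d_gt0 : (0 < d)%N. Proof. by case/andP: kd => _; apply: leq_trans. Qed.

Lemma kappa_ge1 : 1 <= kappa.
Proof. by rewrite ler_pdivlMr // mul1r. Qed.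

Lemma D_ge2 : 2 <= D.
Proof.
have d2 : (2 <= d)%N by case/andP: kd => k1; apply: leq_trans.
have d2R : 2 <= d%:R :> R by rewrite ler_nat.
have := kappa_ge1; move: kappa => c c1; nra.
Qed.

Lemma rho_gt0 : 0 < rho.
Proof.
rewrite subr_gt0 ltr_pdivrMr ?ltr0n ?d_gt0 // mul1r ltr_nat.
by case/andP: kd.
Qed.

(** From [x (1 - x) <= 1/4] at [x = 1/d], as [k] and [kappa] are at least 1. *)
Lemma rho_le : rho / D <= 1 / 4.
Proof.
have d0 : 0 < d%:R :> R by rewrite ltr0n d_gt0.
have D0 : 0 < D by have := D_ge2; lra.
have k1 : 1 <= k%:R :> R by rewrite ler1n; case/andP: kd.
have c1 := kappa_ge1.
rewrite ler_pdivrMr //.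
have : rho <= 1 - 1 / d%:R by rewrite lerD2l lerN2 ler_wpM2r // invr_ge0 ltW.
move/le_trans; apply.
have h : 1 - 1 / d%:R <= 1 / 4 * d%:R :> R.
  rewrite -(ler_pM2r d0).
  have -> : (1 - 1 / d%:R) * d%:R = d%:R - 1 :> R by field; rewrite gt_eqF.
  by have := sqr_ge0 (d%:R - 2 : R); lra.
apply: le_trans h _.
have : d%:R * 1 <= d%:R * kappa :> R by rewrite ler_wpM2l // ltW.
lra.
Qed.

Lemma eta0_gt0 : 0 < eta0. Proof. exact: lt_le_trans eta0_ge1. Qed.

Lemma eta0_a0 : eta0 * a0 <= 3 / 32.
Proof.
have e0 := eta0_gt0; have D2 := D_ge2; have r4 := rho_le.
have := ler_wpM2l (ltW e0) a0_small.
have -> : eta0 * (3 / 8 * (rho / (eta0 * D))) = 3 / 8 * (rho / D).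
  by field; rewrite !gt_eqF // ?ltr0n ?d_gt0 // (lt_le_trans mu_gt0).
by move/le_trans; apply; lra.
Qed.

Lemma lam_ge0 s : 0 <= lam s. Proof. by rewrite /lam dual_norm_ge0. Qed.

Section state.
Variable s : 'cV[R]_d * 'M[R]_d.
Hypothesis inv_s : state_inv s.

Let HG : loewner (H s.1) s.2. Proof. by case: inv_s. Qed.

Let a := M * lam s.
Let a' := M * next_lam s.
Let r := energy_norm (H s.1) (invmx s.2 *m g s.1).

Let Gy : s.2 *m (invmx s.2 *m g s.1) = g s.1.
Proof.
rewrite mulmxA mulmxV ?mul1mx // posdef_unit //.
exact: (state_posdef H_posdef HG).
Qed.

Let step_scaledE : step_scaled s = (1 + M * r) *: s.2.
Proof. by rewrite /step_scaled /step_point addrAC subrr add0r energy_normN. Qed.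

Let r_le : r <= lam s.
Proof. exact: (step_length_le H_posdef HG Gy). Qed.

Let a_ge0 : 0 <= a. Proof. by rewrite mulr_ge0 ?lam_ge0 // ltW. Qed.

Let a_le : a <= a0. Proof. by case: inv_s. Qed.

Let ea : eta0 * a <= 3 / 32.
Proof. by apply: le_trans eta0_a0; rewrite ler_wpM2l // ltW // eta0_gt0. Qed.

Let a_small : a <= 3 / 32.
Proof. by apply: le_trans ea; rewrite ler_peMl. Qed.

Lemma gap_ge0 : 0 <= gap s.
Proof. by rewrite divr_ge0 ?psd_tr_ge0 // ltW. Qed.

(** The largest eigenvalue of [G - H] is at most its trace, and [mu I <= H] turns that multiple of
    the identity into a multiple of [H]. *)
Lemma gap_upper : loewner s.2 ((1 + gap s) *: H s.1).
Proof.
have [HGT HG0] := HG; split.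
  rewrite trmxB linearZ /= (H_posdef _).1; congr (_ - _).
  by have [] := state_posdef H_posdef HG.
move=> v; rewrite quadBm quadZm.
have := psd_le_tr v HG; rewrite quadBm.
have -> : \tr (s.2 - H s.1) = gap s * mu by rewrite /gap divfK // gt_eqF.
have := ler_wpM2l gap_ge0 (H_ge s.1 v); lra.
Qed.

Let newton eta : 1 <= eta -> loewner s.2 (eta *: H s.1) ->
  next_lam s <= newton_rate a eta * lam s.
Proof.
move=> e1 le; rewrite /newton_rate.
exact: (newton_step_bound M_gt0 H_posdef H_concordant g_mvt HG Gy erefl e1 le).
Qed.

Let relaxed : loewner s.2 (relax eta0 a0 a *: H s.1). Proof. by case: inv_s. Qed.

Let relax_le := relax_bounds eta0_ge1 a_ge0 a_le eta0_a0.

Lemma next_lam_linear : next_lam s <= (1 - 1 / (2 * eta0)) * lam s.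
Proof.
apply: le_trans (newton relax_le.1 relaxed) _; rewrite ler_wpM2r ?lam_ge0 //.
by apply: newton_rate_linear => //; [exact: lt_le_trans relax_le.1 | exact: relax_le.2].
Qed.

Let g1 : 1 <= 1 + gap s. Proof. by rewrite lerDl gap_ge0. Qed.

(** Bounds [a] by a multiple of the telescoping quantity [a - a']. The factor [1 + gap] will cancel
    against the one in [next_lam_superlinear]. *)
Lemma next_lam_progress : 3 / 4 * a <= (1 + gap s) * (a - a').
Proof.
have g0 : 0 < 1 + gap s by exact: lt_le_trans g1.
have rate : next_lam s <= (1 - (3 / 4) / (1 + gap s)) * lam s.
  have := newton_rate_progress eta0_ge1 a_ge0 ea (lt_le_trans ltr01 relax_le.1) relax_le.2 gap_ge0.
  rewrite ge_min => /orP[] h.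
    by apply: le_trans (newton relax_le.1 relaxed) _; rewrite ler_wpM2r ?lam_ge0.
  by apply: le_trans (newton g1 gap_upper) _; rewrite ler_wpM2r ?lam_ge0.
have : (1 + gap s) * next_lam s <= (1 + gap s) * lam s - 3 / 4 * lam s.
  apply: le_trans (ler_wpM2l (ltW g0) rate) _.
  by rewrite le_eqVlt; apply/orP; left; apply/eqP; field; rewrite gt_eqF.
move/(ler_wpM2l (ltW M_gt0)); rewrite /a' /a; lra.
Qed.

Lemma next_lam_superlinear :
  next_lam s * (1 + gap s) <= 23 / 20 * (gap s + 2 * D * a) * lam s.
Proof.
have g0 : 0 < 1 + gap s by exact: lt_le_trans g1.
apply: le_trans (ler_wpM2r (ltW g0) (newton g1 gap_upper)) _.
rewrite mulrAC ler_wpM2r ?lam_ge0 //.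
exact: newton_rate_superlinear a_ge0 a_small gap_ge0 D_ge2.
Qed.

Lemma tr_residual : \tr (residual s) / mu <= (1 + a) * gap s + 2 * D * a.
Proof.
have := tr_residual_le M_gt0 H_posdef H_concordant tr_H_le s.2 (erefl (step_point s)).
rewrite -/r -step_scaledE -/(residual s) ler_pdivrMr //; move/le_trans; apply.
have Mr : M * r <= a by rewrite ler_pM2l.
have dL : 0 <= d%:R * L by rewrite mulr_ge0 // (le_trans (ltW mu_gt0)).
have -> : \tr (s.2 - H s.1) = gap s * mu by rewrite /gap divfK // gt_eqF.
have -> : ((1 + a) * gap s + 2 * D * a) * mu = (1 + a) * (gap s * mu) + 2 * a * (d%:R * L).
  by field; rewrite gt_eqF.
apply: lerD; apply: ler_wpM2r => //; last by rewrite ler_pM2l.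
  by rewrite mulr_ge0 ?gap_ge0 // ltW.
by rewrite lerD2l.
Qed.

Lemma residual_possemidef : possemidef (residual s).
Proof.
rewrite /residual step_scaledE.
exact: (residual_psd M_gt0 H_posdef H_concordant HG (erefl (step_point s))).
Qed.

Lemma state_inv_step U : state_inv (step s U).
Proof.
have low : loewner (H (step_point s)) (step s U).2.
  rewrite /= step_scaledE.
  exact: (next_lower M_gt0 H_posdef H_concordant HG (erefl (step_point s))).
have lin := next_lam_linear.
have i01 : 0 <= 1 / (2 * eta0) by rewrite divr_ge0 // mulr_ge0 // ltW // eta0_gt0.
have a'a : a' <= (1 - 1 / (2 * eta0)) * a by rewrite /a' /a mulrCA ler_pM2l.
have a'a0 : a' <= a0.
  by apply: le_trans a'a (le_trans _ a_le); have := mulr_ge0 i01 a_ge0; lra.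
split; [exact: low| |exact: a'a0].
have upp := next_upper M_gt0 H_posdef H_concordant HG (erefl (step_point s)) U
  relaxed (le_trans ler01 relax_le.1).
rewrite /= step_scaledE; split.
  by rewrite trmxB linearZ /= (H_posdef _).1 -step_scaledE (state_posdef H_posdef low).1.
move=> v; rewrite quadBm quadZm.
have := upp.2 v; rewrite quadBm quadZm -/r !subr_ge0 => /le_trans; apply.
rewrite ler_wpM2r //; first exact: (posdef_psd (H_posdef _)).2.
apply: relax_step => //; first by rewrite mulr_ge0 ?lam_ge0 // ltW.
- exact: eta0_a0.
- by rewrite mulr_ge0 ?energy_norm_ge0 ?ler_pM2l // ltW.
Qed.

Lemma gap_step U : gap (step s U) <= (\tr (residual s) - \tr (residual s *m proj U)) / mu.
Proof.
rewrite /gap /= ler_pM2r ?invr_gt0 // sr_kE addrAC -/(residual s).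
exact/tr_sr_rest/residual_possemidef.
Qed.

(* [expo] is chosen such that [1 + expo (a - a')], a lower bound of the ratio of
   the exponential factors of [potential] before and after a step, pays for
   both the growth [1 + a] of the gap and the term [2 D a']. *)
Definition expo : R := 2 * eta0 + 2 * D / rho * (23 / 15).

Lemma expo_ge0 : 0 <= expo.
Proof.
have D0 : 0 <= 2 * D by have := D_ge2; lra.
rewrite /expo addr_ge0 //; first by rewrite mulr_ge0 // ltW // eta0_gt0.
by apply: mulr_ge0; rewrite ?divr_ge0 // ltW // rho_gt0.
Qed.

Definition potential (s : 'cV[R]_d * 'M[R]_d) : R :=
  (gap s + 2 * D * (M * lam s)) * expR (expo * (M * lam s)).

(** The part of the contraction that holds path by path: [U] does not occur, since the residual and
    [a'] are determined before it is chosen. *)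
Lemma potential_decrease :
  (rho * (\tr (residual s) / mu) + 2 * D * a') * expR (expo * a') <= rho * potential s.
Proof.
have D2 := D_ge2; have rp := rho_gt0; have g0 := gap_ge0; have e0 := eta0_gt0.
have g10 : 0 < 1 + gap s by rewrite ltr_wpDr.
have a'0 : 0 <= a' by rewrite mulr_ge0 ?dual_norm_ge0 // ltW.
pose th := gap s + 2 * D * a.
have th0 : 0 <= th by rewrite addr_ge0 // mulr_ge0 // mulr_ge0 //; lra.
have a'lin : a' <= (1 - 1 / (2 * eta0)) * a.
  by rewrite /a' /a mulrCA ler_pM2l //; exact: next_lam_linear.
have sup : a' * (1 + gap s) <= 23 / 20 * th * a.
  by have := ler_wpM2l (ltW M_gt0) next_lam_superlinear; rewrite /a' /th /a; lra.
have prog := next_lam_progress.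
have tr : \tr (residual s) / mu <= (1 + a) * th.
  apply: le_trans tr_residual _; rewrite /th mulrDr lerD2l ler_peMl ?lerDl //.
  by rewrite mulr_ge0 // mulr_ge0 //; lra.
(* Pays for the growth factor [1 + a] through the term [2 eta0] of [expo]. *)
have lin2 : a <= 2 * eta0 * (a - a').
  have := ler_wpM2l (ltW e0) a'lin.
  have -> : eta0 * ((1 - 1 / (2 * eta0)) * a) = eta0 * a - a / 2 by field; rewrite gt_eqF.
  lra.
(* [23/15 = 23/20 * 4/3] combines the superlinear bound with the progress bound. *)
have a'2 : a' <= 23 / 15 * th * (a - a').
  rewrite -(ler_pM2r g10); apply: le_trans sup _.
  have := ler_wpM2l th0 prog; lra.
have main : rho * (\tr (residual s) / mu) + 2 * D * a' <= rho * th * (1 + expo * (a - a')).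
  have expoE (q E : R) : 0 < q -> q * th * (1 + (2 * eta0 + 2 * E / q * (23 / 15)) * (a - a')) =
      q * ((1 + 2 * eta0 * (a - a')) * th) + 2 * E * (23 / 15 * th * (a - a')).
    by move=> q0; field; rewrite gt_eqF.
  rewrite /expo expoE //.
  apply: lerD; last by rewrite ler_wpM2l // mulr_ge0 //; lra.
  rewrite ler_pM2l //; apply: le_trans tr _; rewrite ler_wpM2r //; lra.
apply: le_trans (ler_wpM2r (expR_ge0 _) main) _.
rewrite /potential -/a -/th [leRHS]mulrA -[leLHS]mulrA ler_wpM2l //.
  by rewrite mulr_ge0 // ltW.
have -> : expR (expo * a) = expR (expo * (a - a')) * expR (expo * a').
  by rewrite -expRD -mulrDr subrK.
rewrite ler_wpM2r ?expR_ge0 //.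
exact: expR_ge1Dx.
Qed.

Lemma next_lam_potential : next_lam s <= 23 / 20 * potential s * lam s.
Proof.
have D2 := D_ge2; have l0 := lam_ge0 s.
have th0 : 0 <= gap s + 2 * D * a.
  by rewrite addr_ge0 ?gap_ge0 // mulr_ge0 // mulr_ge0 //; lra.
have n0 : 0 <= next_lam s by rewrite /next_lam dual_norm_ge0.
have h1 : next_lam s <= next_lam s * (1 + gap s) by rewrite ler_peMr.
apply: (le_trans h1); apply: le_trans next_lam_superlinear _.
rewrite ler_wpM2r // ler_wpM2l // ler_peMr //.
by rewrite -[leLHS]expR0 ler_expR mulr_ge0 // expo_ge0.
Qed.

Lemma potential_ge0 : 0 <= potential s.
Proof.
have D2 := D_ge2.
by rewrite mulr_ge0 ?expR_ge0 // addr_ge0 ?gap_ge0 // mulr_ge0 // mulr_ge0 //; lra.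
Qed.

End state.

Lemma state_inv_init s : loewner (H s.1) s.2 -> loewner s.2 (eta0 *: H s.1) ->
  a0 = M * lam s -> state_inv s.
Proof.
move=> h1 h2 e; split; rewrite -?e //.
by rewrite /relax subrr mulr0 subr0 expr1n divr1.
Qed.

Lemma gap_init s : loewner s.2 (eta0 *: H s.1) -> gap s <= (eta0 - 1) * D.
Proof.
move=> h; have e0 := eta0_ge1.
rewrite ler_pdivrMr //.
have -> : (eta0 - 1) * D * mu = (eta0 - 1) * (d%:R * L) by field; rewrite gt_eqF.
have := psd_tr_ge0 h; have := tr_H_le s.1.
rewrite !linearB linearZ /=.
move: (\tr _) (\tr _) (d%:R * L) => u v w uw.
have := ler_wpM2l (_ : 0 <= eta0 - 1) uw; rewrite subr_ge0 => /(_ e0); lra.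
Qed.

(** [expR x <= 1 / (1 - x)] at [x = 27/80 = 3/16 + 23/20 - 1], the largest exponent left in
    [potential_init]. *)
Lemma expR_third : expR (27 / 80) <= 80 / 53 :> R.
Proof.
have p : 0 < expR (27 / 80) :> R by exact: expR_gt0.
have := ler_wpM2l (ltW p) (expR_ge1Dx (- (27 / 80))).
rewrite expRN divff ?gt_eqF //; lra.
Qed.

(* With [x = 1/eta0] the bound is [1.15 e^(0.1875 + 1.15 x) (1 - x + 0.1875 x^2)],
   and [1 - x + 0.1875 x^2 <= (1 - x/2)^2 <= e^(-x)]. *)
Lemma potential_init s : state_inv s -> gap s <= (eta0 - 1) * D ->
  23 / 20 * potential s <= 2 * D * eta0.
Proof.
move=> inv_s gs; have D2 := D_ge2; have e0 := eta0_gt0; have e1 := eta0_ge1.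
have rp := rho_gt0; have r4 := rho_le; have D0 : 0 < D by lra.
have [_ _ a_le] := inv_s.
pose a := M * lam s; pose x := eta0^-1.
have a_ge0 : 0 <= a by rewrite mulr_ge0 ?lam_ge0 // ltW.
have x0 : 0 < x by rewrite invr_gt0.
have x1 : x <= 1 by rewrite invf_le1.
have ex : eta0 * x = 1 by rewrite divff // gt_eqF.
have a_small : a <= 3 / 8 * (rho / D) * x.
  apply: le_trans a_le _; apply: le_trans a0_small _.
  by rewrite invfM [eta0^-1 * _]mulrC !mulrA.
have a_small' : a <= 3 / 32 * x.
  apply: le_trans a_small _; rewrite ler_wpM2r ?(ltW x0) //; lra.
(* The two terms of [expo] contribute [2 * 3/32 = 3/16] and [2 * 23/15 * 3/8 = 23/20]. *)
have Ka : expo * a <= 3 / 16 + 23 / 20 * x.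
  have h1 : 2 * eta0 * a <= 3 / 16.
    have := ler_wpM2l (ltW e0) a_small'.
    have -> : eta0 * (3 / 32 * x) = 3 / 32 * (eta0 * x) by ring.
    rewrite ex; lra.
  have h2 : 2 * D / rho * (23 / 15) * a <= 23 / 20 * x.
    have c0 : 0 <= 2 * D / rho * (23 / 15)
      by apply: mulr_ge0 => //; apply: divr_ge0; [apply: mulr_ge0 => //|]; exact: ltW.
    apply: le_trans (ler_wpM2l c0 a_small) _.
    have gen (q E : R) : 0 < q -> 0 < E ->
        2 * E / q * (23 / 15) * (3 / 8 * (q / E) * x) = 23 / 20 * x.
      by move=> q0 E0; field; rewrite !gt_eqF.
    by rewrite gen.
  rewrite /expo mulrDl; exact: lerD.
have th : gap s + 2 * D * a <= D * eta0 * (1 - x + 3 / 16 * x ^+ 2).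
  have -> : D * eta0 * (1 - x + 3 / 16 * x ^+ 2) =
    D * eta0 - D * (eta0 * x) + 3 / 16 * D * (eta0 * x) * x by ring.
  rewrite ex; have := ler_wpM2l (ltW D0) a_small'; move: gs; lra.
have em : 1 - x + 3 / 16 * x ^+ 2 <= expR (- x).
  have -> : - x = - x / 2 + - x / 2 by field.
  have h := expR_ge1Dx (- x / 2).
  have h0 : 0 <= 1 + - x / 2 by lra.
  rewrite expRD; apply: le_trans (ler_pM h0 h0 h h); nra.
have pot : potential s <= D * eta0 * expR (27 / 80).
  rewrite /potential -/a.
  have th0 : 0 <= gap s + 2 * D * a.
    by rewrite addr_ge0 ?gap_ge0 // mulr_ge0 // mulr_ge0 //; lra.
  have De0 : 0 <= D * eta0 by rewrite mulr_ge0 // ltW.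
  have th' : gap s + 2 * D * a <= D * eta0 * expR (- x).
    by apply: le_trans th _; rewrite ler_wpM2l.
  have hK : expR (expo * a) <= expR (3 / 16 + 23 / 20 * x) by rewrite ler_expR.
  apply: le_trans (ler_pM th0 (expR_ge0 _) th' hK) _.
  rewrite -[leLHS]mulrA ler_wpM2l // -expRD ler_expR; lra.
apply: le_trans (ler_wpM2l (_ : 0 <= 23 / 20) pot) _; first lra.
have De0 : 0 <= D * eta0 by rewrite mulr_ge0 // ltW.
have := ler_wpM2l De0 expR_third; nra.
Qed.

End run.

(** * The two stages *)

Section two_stages.
Variable R : realType.

Lemma geometric_sum_le (x : R) n : x < 1 -> 0 <= x ->
  (1 - x) * (\sum_(t < n) x ^+ t) <= 1.
Proof.
move=> x1 x0; rewrite -opprB mulNr -subrX1 opprB gerDl oppr_le0.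
exact: exprn_ge0.
Qed.

Lemma triangularS t : ((t.+1 * (t.+1 - 1)) %/ 2 = (t * (t - 1)) %/ 2 + t)%N.
Proof.
rewrite !divn2 !subn1 /= -!bin2 binS bin1 addnC.
by rewrite addnC.
Qed.

(** Past [t0] the ratio at time [t0 + t] is at most [q^t / 2], and the exponents [0, ..., t - 1] add
    up to [t (t - 1) / 2]. Before [t0] only the linear rate is used. *)
Lemma two_stage (l : nat -> R) (b c q : R) (t0 : nat) :
  (forall t, 0 <= l t) -> 0 <= q -> 0 <= b ->
  (forall t, l t.+1 <= b * l t) ->
  (forall t, l t.+1 <= c * q ^+ t * l t) -> c * q ^+ t0 <= 1 / 2 ->
  forall t, l (t0 + t)%N <=
    q ^+ (t * (t - 1) %/ 2)%N * (1 / 2) ^+ t * b ^+ t0 * l 0%N.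
Proof.
move=> l0 q0 b0 lin sup ct0; elim=> [|t IH].
  rewrite addn0 mul0n div0n !expr0 !mul1r; elim: t0 {ct0} => [|t IH].
    by rewrite expr0 mul1r.
  by rewrite exprS -mulrA; apply: le_trans (lin t) _; rewrite ler_wpM2l.
rewrite addnS triangularS exprD exprSr.
apply: le_trans (sup _) _.
have h : c * q ^+ (t0 + t) <= 1 / 2 * q ^+ t.
  by rewrite exprD mulrA ler_wpM2r ?exprn_ge0.
apply: le_trans (ler_wpM2r (l0 _) h) _.
have hq : 0 <= 1 / 2 * q ^+ t by rewrite mulr_ge0 ?exprn_ge0 //; lra.
apply: le_trans (ler_wpM2l hq IH) _.
by rewrite le_eqVlt; apply/orP; left; apply/eqP; ring.
Qed.

Lemma ln2_le : ln 2 <= 3 / 4 :> R.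
Proof.
rewrite -[leRHS]expRK ler_ln ?posrE ?expR_gt0 //.
have h := expR_ge1Dx (3 / 32 : R).
have -> : 3 / 4 = 8%:R * (3 / 32 : R) by field.
rewrite expRM_natl.
(* [(1 + 3/32)^8] exceeds 2. *)
have h8 : (1 + 3 / 32 : R) ^+ 8 <= expR (3 / 32) ^+ 8.
  by rewrite ler_pXn2r ?nnegrE ?expR_ge0 //; lra.
by apply: le_trans h8; lra.
Qed.

Lemma ln2_ge : 1 / 2 <= ln 2 :> R.
Proof.
have := @le_ln1Dx R (- (1 / 2)).
have -> : 1 + - (1 / 2) = 2^-1 :> R by field.
rewrite lnV ?posrE // => /(_ _); lra.
Qed.

(* [truncn] of the real solution of [4 X^3 exp(- k t / (2 d)) = 1]; the
   constant 12 absorbs the rounding because [d / k >= 1] and [ln X >= 1/2]. *)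
Lemma exists_switch_time (d k : nat) (X q : R) : (1 <= k <= d)%N -> 2 <= X ->
  0 <= q -> q <= expR (- (k%:R / (2 * d%:R))) ->
  exists t0 : nat, t0%:R <= 12 * (d%:R * ln X / k%:R) /\ 4 * X ^+ 3 * q ^+ t0 <= 1.
Proof.
move=> /andP[k1 kd] X2 q0 qe.
have k0 : 0 < k%:R :> R by rewrite ltr0n.
have d0 : 0 < d%:R :> R by rewrite ltr0n (leq_trans k1).
have X0 : 0 < X by lra.
have lX : 1 / 2 <= ln X.
  by apply: le_trans ln2_ge _; rewrite ler_ln ?posrE.
pose Y := 4 * X ^+ 3.
have Y0 : 0 < Y by rewrite mulr_gt0 // exprn_gt0.
have lY : ln Y <= 5 * ln X.
  have -> : 5 * ln X = ln (X ^+ 5) by rewrite lnXn // mulr_natl.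
  rewrite ler_ln ?posrE ?exprn_gt0 // /Y.
  have -> : X ^+ 5 = X ^+ 2 * X ^+ 3 by rewrite -exprD.
  rewrite ler_wpM2r ?exprn_ge0 ?(ltW X0) // expr2; nra.
pose z := 2 * d%:R / k%:R * ln Y.
have lY0 : 0 <= ln Y.
  rewrite ln_ge0 // /Y; have : 1 <= X ^+ 3 by apply: exprn_ege1; lra.
  lra.
have z0 : 0 <= z by rewrite mulr_ge0 // divr_ge0 ?mulr_ge0 // ltW.
exists (Num.trunc z).+1; split.
  have dk : 1 <= d%:R / k%:R :> R by rewrite ler_pdivlMr // mul1r ler_nat.
  have h1 : (Num.trunc z)%:R <= z by rewrite truncn_le.
  rewrite -natr1.
  have h2 : z <= 10 * (d%:R / k%:R * ln X).
    have -> : 10 * (d%:R / k%:R * ln X) = 2 * d%:R / k%:R * (5 * ln X) by ring.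
    by rewrite /z ler_wpM2l // divr_ge0 ?mulr_ge0 // ltW.
  have -> : d%:R * ln X / k%:R = d%:R / k%:R * ln X by ring.
  have h3 : 1 * (1 / 2) <= d%:R / k%:R * ln X by apply: ler_pM => //; lra.
  lra.
have h1 : z < (Num.trunc z).+1%:R by exact: truncnS_gt.
have h2 : q ^+ (Num.trunc z).+1 <= expR (- (k%:R / (2 * d%:R))) ^+ (Num.trunc z).+1.
  by rewrite lerXn2r ?nnegrE // expR_ge0.
apply: le_trans (ler_wpM2l (ltW Y0) h2) _.
rewrite -expRM_natr -[X in X * _]lnK ?posrE // -expRD -[leRHS]expR0 ler_expR.
rewrite mulNr subr_le0.
have -> : ln Y = k%:R / (2 * d%:R) * z.
  by rewrite /z; field; rewrite !gt_eqF.
by rewrite ler_wpM2l ?(ltW h1) // divr_ge0 ?mulr_ge0 // ltW.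
Qed.

End two_stages.

(** * Measurability *)

Section measurable_matrices.
Variables (R : realType) (disp : measure_display) (T : measurableType disp).

Lemma measurable_invr (X : T -> R) :
  measurable_fun [set: T] X -> measurable_fun [set: T] (fun w => (X w)^-1).
Proof.
move=> mX; suff mV : measurable_fun [set: R] (@GRing.inv R) by exact: measurableT_comp.
rewrite (_ : @GRing.inv R = fun x => if x == 0 then 0 else x^-1); last first.
  by apply/funext => x; case: eqVneq => // ->; rewrite invr0.
apply: measurable_fun_if => //; first exact: measurable_fun_eqr.
rewrite setTI (_ : _ @^-1` _ = [set x : R | x != 0]).
  apply: open_continuous_measurable_fun; first exact: open_neq.
  by move=> x; rewrite inE /= => x0; exact: inv_continuous.
by apply/seteqP; split => x /=; case: eqVneq.
Qed.

Lemma measurable_sqrtr (X : T -> R) :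
  measurable_fun [set: T] X -> measurable_fun [set: T] (fun w => Num.sqrt (X w)).
Proof.
move=> mX; apply: measurableT_comp => //; apply: continuous_measurable_fun.
exact: sqrt_continuous.
Qed.

Definition mx_measurable m n (X : T -> 'M[R]_(m, n)) : Prop :=
  forall i j, measurable_fun [set: T] (fun w => X w i j).

Lemma mx_measurable_cst m n (A : 'M[R]_(m, n)) : mx_measurable (fun=> A).
Proof. by move=> i j; exact: measurable_cst. Qed.

Lemma mx_measurableD m n (X Y : T -> 'M[R]_(m, n)) :
  mx_measurable X -> mx_measurable Y -> mx_measurable (fun w => X w + Y w).
Proof.
move=> mX mY i j; under eq_fun do rewrite mxE.
exact: measurable_funD.
Qed.

Lemma mx_measurableZ m n (c : T -> R) (X : T -> 'M[R]_(m, n)) :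
  measurable_fun [set: T] c -> mx_measurable X -> mx_measurable (fun w => c w *: X w).
Proof.
move=> mc mX i j; under eq_fun do rewrite mxE.
exact: measurable_funM.
Qed.

Lemma mx_measurableN m n (X : T -> 'M[R]_(m, n)) :
  mx_measurable X -> mx_measurable (fun w => - X w).
Proof.
move=> mX i j; under eq_fun do rewrite mxE.
exact: measurable_funN.
Qed.

Lemma mx_measurableB m n (X Y : T -> 'M[R]_(m, n)) :
  mx_measurable X -> mx_measurable Y -> mx_measurable (fun w => X w - Y w).
Proof. by move=> mX mY; apply: mx_measurableD => //; exact: mx_measurableN. Qed.

Lemma mx_measurableM m n p (X : T -> 'M[R]_(m, n)) (Y : T -> 'M[R]_(n, p)) :
  mx_measurable X -> mx_measurable Y -> mx_measurable (fun w => X w *m Y w).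
Proof.
move=> mX mY i j; under eq_fun do rewrite mxE.
by apply: measurable_sum => l; exact: measurable_funM.
Qed.

Lemma mx_measurable_tr m n (X : T -> 'M[R]_(m, n)) :
  mx_measurable X -> mx_measurable (fun w => (X w)^T).
Proof. by move=> mX i j; under eq_fun do rewrite mxE; exact: mX. Qed.

Lemma measurable_trace n (X : T -> 'M[R]_n) :
  mx_measurable X -> measurable_fun [set: T] (fun w => \tr (X w)).
Proof. by move=> mX; apply: measurable_sum. Qed.

Lemma measurable_det n (X : T -> 'M[R]_n) :
  mx_measurable X -> measurable_fun [set: T] (fun w => \det (X w)).
Proof.
move=> mX; apply: measurable_sum => s; apply: measurable_funM => //.
by apply: measurable_prod.
Qed.

Lemma mx_measurable_inv n (X : T -> 'M[R]_n) :
  mx_measurable X -> mx_measurable (fun w => invmx (X w)).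
Proof.
move=> mX i j.
(* Cramer's rule; on a singular matrix [invmx] returns its argument. *)
have -> : (fun w => invmx (X w) i j) = (fun w => if \det (X w) == 0 then X w i j
    else (\det (X w))^-1 * ((-1) ^+ (j + i) * \det (row' j (col' i (X w))))).
  apply/funext => w; rewrite /invmx unitmxE unitfE; case: eqVneq => //= _.
  by rewrite mxE mxE.
apply: measurable_fun_ifT; [|exact: mX|].
  by apply: measurable_fun_eqr => //; exact: measurable_det.
apply: measurable_funM; first exact/measurable_invr/measurable_det.
apply: measurable_funM => //; apply: measurable_det => a b.
by under eq_fun do rewrite !mxE; exact: mX.
Qed.

Lemma measurable_quad n (A : T -> 'M[R]_n) (v : T -> 'cV[R]_n) :
  mx_measurable A -> mx_measurable v -> measurable_fun [set: T] (fun w => quad (A w) (v w)).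
Proof.
move=> mA mv.
suff : mx_measurable (fun w => (v w)^T *m A w *m v w) by exact.
by apply: mx_measurableM => //; apply: mx_measurableM => //; exact: mx_measurable_tr.
Qed.

Lemma mx_measurable_cvg m n (h : nat -> T -> 'M[R]_(m, n)) (X : T -> 'M[R]_(m, n)) :
  (forall l, mx_measurable (h l)) ->
  (forall w i j, (fun l => h l w i j) @ \oo --> X w i j) -> mx_measurable X.
Proof.
move=> mh hX i j.
by apply: (@measurable_fun_cvg _ _ _ setT (fun l w => h l w i j)) => [l|w _]; [exact: mh|exact: hX].
Qed.

(* A continuous function is the limit of its values at grid points, and
   a function of a countably valued random vector is measurable. *)
Lemma measurable_continuous_comp n (f : 'cV[R]_n -> R) (X : T -> 'cV[R]_n) :
  continuous f -> mx_measurable X -> measurable_fun [set: T] (fun w => f (X w)).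
Proof.
move=> cf mX.
pose Z l w : 'cV[int]_n := \col_i Num.floor (l.+1%:R * X w i ord0).
pose g l (z : 'cV[int]_n) : 'cV[R]_n := \col_i ((z i ord0)%:~R / l.+1%:R).
apply: (@measurable_fun_cvg _ _ _ setT (fun l w => f (g l (Z l w)))) => [l|w _].
  move=> _ B mB; rewrite setTI.
  have -> : (fun w => f (g l (Z l w))) @^-1` B =
      \bigcup_(z : 'cV[int]_n) ([set w | Z l w = z] `&` [set w | B (f (g l z))]).
    apply/seteqP; split => w /=; first by move=> h; exists (Z l w).
    by move=> [z _ [<-]].
  apply: countable_bigcupT_measurable; first exact: countableP.
  move=> z; apply: measurableI; last first.
    have [Bz|nBz] := pselect (B (f (g l z))).
      by rewrite (_ : [set _ | _] = setT) //; apply/seteqP; split.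
    by rewrite (_ : [set _ | _] = set0) //; apply/seteqP; split.
  rewrite (_ : [set _ | _] = \bigcap_(i : 'I_n)
     [set w | (z i ord0)%:~R <= l.+1%:R * X w i ord0 < (z i ord0 + 1)%:~R]); last first.
    apply/seteqP; split => w /=.
      by move=> <- i _ /=; rewrite mxE floor_itv.
    move=> h; apply/matrixP => i j; rewrite (ord1 j) mxE.
    by apply/floor_def; exact: h.
  apply: fin_bigcap_measurable => //= i _.
  have mXi : measurable_fun [set: T] (fun w => l.+1%:R * X w i ord0).
    by apply: measurable_funM => //; exact: mX.
  have -> : [set w | (z i ord0)%:~R <= l.+1%:R * X w i ord0 < (z i ord0 + 1)%:~R] =
     (fun w => l.+1%:R * X w i ord0) @^-1` `[(z i ord0)%:~R, (z i ord0 + 1)%:~R[.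
    by apply/seteqP; split => w /=; rewrite in_itv.
  by rewrite -[_ @^-1` _]setTI; apply: mXi.
suff gX : (fun l => g l (Z l w)) @ \oo --> X w
  by exact: (@cvg_comp _ _ _ (fun l => g l (Z l w)) f _ _ _ gX (cf (X w))).
apply/cvg_ballP => e e0; near=> l; split=> // i j.
rewrite (ord1 j) !mxE /ball /=.
have l0 : 0 < l.+1%:R :> R by rewrite ltr0n.
have := floor_itv (l.+1%:R * X w i ord0) => /andP[h1 h2].
have -> : X w i ord0 - (Num.floor (l.+1%:R * X w i ord0))%:~R / l.+1%:R =
   (l.+1%:R * X w i ord0 - (Num.floor (l.+1%:R * X w i ord0))%:~R) / l.+1%:R.
  by field; rewrite gt_eqF.
rewrite normrM ger0_norm ?subr_ge0 // gtr0_norm ?invr_gt0 // ltr_pdivrMr //.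
have h3 : 1 < e * l.+1%:R.
  rewrite -ltr_pdivrMl // mulr1 -natr1; apply: ltr_wpDr => //.
  by near: l; exact: nbhs_infty_gtr.
apply: le_lt_trans h3; move: h2; rewrite intrD; lra.
Unshelve. all: by end_near. Qed.

Lemma mx_measurable_grad n (f : 'cV[R]_n -> R) (X : T -> 'cV[R]_n) :
  (forall z, differentiable (grad f) z) -> mx_measurable X ->
  mx_measurable (fun w => grad f (X w)).
Proof.
move=> df mX i j; rewrite (ord1 j).
apply: (@measurable_continuous_comp _ (fun z => grad f z i ord0)) => //.
move=> z; apply: (@continuous_comp _ _ _ (grad f) (fun A => A i ord0)).
  exact: differentiable_continuous.
exact: coord_continuous.
Qed.

(** Differentiability of the gradient does not give a continuous Hessian, but it makes the Hessian a
    pointwise limit of difference quotients of a continuous map. *)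
Lemma mx_measurable_hess n (f : 'cV[R]_n -> R) (X : T -> 'cV[R]_n) :
  (forall z, differentiable (grad f) z) -> mx_measurable X ->
  mx_measurable (fun w => hess f (X w)).
Proof.
move=> df mX.
pose D l w : 'M[R]_n := \matrix_(i, j)
  (l.+1%:R * (grad f (X w + l.+1%:R^-1 *: delta_mx j ord0) i ord0 - grad f (X w) i ord0)).
apply: (mx_measurable_cvg (h := D)) => [l i j|w i j].
  under eq_fun do rewrite mxE.
  apply: measurable_funM => //; apply: measurable_funB; apply: mx_measurable_grad => //.
  by apply: mx_measurableD => //; exact: mx_measurable_cst.
have hE : hess f (X w) i j = ('D_(delta_mx j ord0) (grad f) (X w)) i ord0 by rewrite mxE.
rewrite hE; under eq_fun do rewrite mxE.
exact: derive_quotient_cvg.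
Qed.

(* With [S] fixed and [N = S^T S + e], [N^-1 S^T - S^+ = - e N^-1 S^+], and
   [S^+ = S^T S V] turns the right side into [e (e N^-1 - 1) V], where
   [e N^-1] is a contraction. *)
Lemma mx_measurable_mpinv m n (X : T -> 'M[R]_(m, n)) :
  mx_measurable X -> mx_measurable (fun w => mpinv (X w)).
Proof.
move=> mX.
pose N l w : 'M[R]_n := (X w)^T *m X w + l.+1%:R^-1%:M.
apply: (mx_measurable_cvg (h := fun l w => invmx (N l w) *m (X w)^T)) => [l|w i j].
  apply: mx_measurableM; last exact: mx_measurable_tr.
  apply: mx_measurable_inv; apply: mx_measurableD; last exact: mx_measurable_cst.
  by apply: mx_measurableM => //; exact: mx_measurable_tr.
set S := X w; have [h1 h2 h3 h4] := penrose_mpinv S; set S' := mpinv S in h1 h2 h3 h4 *.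
pose V := S' *m S'^T *m S'.
have SV : S^T *m S *m V = S'.
  have e1 : S *m S' *m S'^T = S'^T by rewrite -h3 -trmx_mul mulmxA h2.
  have e2 : S^T *m S'^T *m S' = S' by rewrite -trmx_mul h4 h2.
  by rewrite /V !mulmxA -(mulmxA S^T S) -(mulmxA S^T _ S'^T) e1 e2.
have SS : S^T *m S *m S' = S^T by rewrite -mulmxA -h3 -trmx_mul h1.
have STS : possemidef (S^T *m S).
  split; first by rewrite trmx_mul trmxK.
  move=> v; have := quad1_ge0 (S *m v); rewrite !quadE bilM mulmx1 //.
have N_pd l : posdef (N l w).
  split; first by rewrite linearD /= tr_scalar_mx STS.1.
  move=> v v0; rewrite quadDm ltr_wpDl //; first exact: STS.2.
  by rewrite -scalemx1 quadZm mulr_gt0 ?quad1_gt0 // invr_gt0.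
pose e l : R := l.+1%:R^-1.
have e_gt0 l : 0 < e l by rewrite invr_gt0.
have diff l : invmx (N l w) *m S^T = S' - e l *: V + e l *: (e l *: (invmx (N l w) *m V)).
  have uN := posdef_unit (N_pd l).
  apply: (can_inj (mulKmx uN)); rewrite mulKVmx // !(mulmxDr, mulmxN) -!scalemxAr.
  rewrite mulKVmx // /N -/(e l) !mulmxDl !mul_scalar_mx SS SV.
  rewrite scalerDr; set a := S^T; set b := e l *: S'; set c := _ *: (_ *: V).
  by rewrite opprD addrA addrK subrK.
have bnd l (u : 'cV[R]_n) a : `|(e l *: (invmx (N l w) *m u)) a ord0| <= enorm u.
  have [NT Np] := N_pd l; have uN := posdef_unit (N_pd l).
  set y := e l *: _.
  have Ny : N l w *m y = e l *: u by rewrite /y -scalemxAr mulKVmx.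
  have yl : enorm y <= enorm u.
    have : e l * quad 1%:M y <= e l * (enorm y * enorm u).
      apply: (@le_trans _ _ (bil 1%:M y (N l w *m y))).
        rewrite bilMr mul1mx -quadE.
        rewrite (_ : quad (N l w) y = quad (S^T *m S) y + e l * quad 1%:M y).
          by rewrite lerDr; exact: STS.2.
        by rewrite /N -[l.+1%:R^-1%:M]scalemx1 quadDm quadZm.
      rewrite Ny bilZr ler_wpM2l ?(ltW (e_gt0 l)) //.
      by apply: (le_trans (ler_norm _)); exact: bil1_enorm.
    rewrite ler_pM2l // -enorm_sqr expr2.
    have [->|y0] := eqVneq (enorm y) 0; first by rewrite enorm_ge0.
    by rewrite ler_pM2l // lt_neqAle eq_sym y0 enorm_ge0.
  apply: le_trans yl; rewrite -(@ler_pXn2r _ 2) ?nnegrE ?enorm_ge0 //.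
  rewrite real_normK ?num_real // enorm_sqr quad1E (bigD1 a) //= lerDl.
  by apply: sumr_ge0 => b _; rewrite sqr_ge0.
apply/cvgrPdist_le => eps eps0.
pose B := `|V i j| + enorm (col j V).
have B0 : 0 <= B by rewrite addr_ge0 ?enorm_ge0.
near=> l.
have colE : (invmx (N l w) *m V) i j = (invmx (N l w) *m col j V) i ord0.
  by rewrite [col j V]colE [_ *m (V *m _)]mulmxA -colE [RHS]mxE.
have entry : S' i j - (invmx (N l w) *m S^T) i j =
    e l * (V i j - (e l *: (invmx (N l w) *m col j V)) i ord0).
  have gen (A1 A2 A3 : 'M[R]_(n, m)) (y : 'cV[R]_n) c : A3 i j = y i ord0 ->
      A1 i j - (A1 - c *: A2 + c *: (c *: A3)) i j = c * (A2 i j - (c *: y) i ord0).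
    by move=> e3; rewrite !mxE e3; ring.
  by rewrite diff; exact: gen.
rewrite entry normrM gtr0_norm //.
apply: (@le_trans _ _ (e l * B)).
  rewrite ler_wpM2l ?(ltW (e_gt0 l)) //; apply: le_trans (ler_normB _ _) _.
  by rewrite lerD2l.
rewrite /e mulrC ler_pdivrMr ?ltr0n // -ler_pdivrMl // mulrC -natr1.
apply: ler_wpDr => //; apply: ltW.
by near: l; exact: nbhs_infty_gtr.
Unshelve. all: by end_near. Qed.

End measurable_matrices.

(** * Independent Gaussian families *)

Section cylinders.
Variables (R : realType) (I : choiceType).

Definition cylinder : set (set (I -> R)) :=
  [set C | exists J : seq I, exists A : I -> set R,
    (forall i, measurable (A i)) /\ C = [set x | forall i, i \in J -> A i (x i)]].

(** The product sigma-algebra on real families indexed by [I]. Its generators form a pi-system, so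
    finite-dimensional laws determine a finite measure. *)
Definition path_space := g_sigma_algebraType cylinder.

Lemma measurable_coord i : measurable_fun [set: path_space] (fun x : path_space => x i).
Proof.
move=> _ A mA; rewrite setTI; apply: sub_sigma_algebra.
exists [:: i], (fun=> A); split => //; apply/seteqP; split => x /=.
  by move=> Ax j; rewrite inE => /eqP ->.
by move=> /(_ i); apply; rewrite inE.
Qed.

Lemma measurable_path d (T : measurableType d) (X : I -> T -> R) :
  (forall i, measurable_fun [set: T] (X i)) ->
  measurable_fun [set: T] (fun w => (fun i => X i w) : path_space).
Proof.
move=> mX; apply: (@measurability _ _ _ path_space _ _ cylinder) => //.
move=> _ [_ [J [A [mA ->]]] <-].
rewrite setTI; suff : measurable (\bigcap_(i in [set` J]) (X i @^-1` A i)) by [].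
rewrite bigcap_seq; apply: bigsetI_measurable => i _.
by rewrite -[_ @^-1` _]setTI; exact: mX.
Qed.

Lemma cylinder_setI : setI_closed cylinder.
Proof.
move=> _ _ [J [A [mA ->]]] [K [B [mB ->]]].
pose AB i := (if i \in J then A i else setT) `&` (if i \in K then B i else setT).
exists (J ++ K), AB; split.
  by move=> i; apply: measurableI; case: ifP.
apply/seteqP; split => x /=.
  move=> [Ax Bx] i _; split; case: ifP => // h; [exact: Ax|exact: Bx].
move=> h; split => i iJ.
  by have := h i; rewrite mem_cat iJ => /(_ erefl) [+ _]; rewrite iJ.
by have := h i; rewrite mem_cat iJ orbT => /(_ erefl) [_ +]; rewrite iJ.
Qed.

Lemma path_measure_unique (m1 m2 : {measure set path_space -> \bar R}) :
  (m1 setT < +oo)%E -> (forall C, cylinder C -> m1 C = m2 C) ->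
  forall B, measurable B -> m1 B = m2 B.
Proof.
move=> m1oo m12 B mB.
apply: (@measure_unique _ _ path_space cylinder (fun=> setT) _ _ _ _ m1 m2 _ _ B) => //.
- exact: cylinder_setI.
- move=> _; exists [::], (fun=> setT); split => //.
  by apply/seteqP; split.
- by apply/seteqP; split => // x _; exists 0%N.
Qed.

End cylinders.

Section independence.
Variables (R : realType) (disp : measure_display) (T : measurableType disp).
Variable P : probability T R.

Lemma independent_cylinder (I : choiceType) (X : I -> T -> R) (J : seq I) (A : I -> set R) :
  mutually_independent P X -> (forall i, measurable (A i)) ->
  P [set w | forall i, i \in J -> A i (X i w)]
    = (\prod_(i <- undup J) P (X i @^-1` A i))%E.
Proof.
move=> indX mA; rewrite -indX ?undup_uniq //; congr (P _).
by apply/seteqP; split => w h i /=; [rewrite mem_undup|]; move=> iJ; apply: h;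
  rewrite /= ?mem_undup.
Qed.

Lemma independent_reindex (I I' : choiceType) (X : I -> T -> R) (phi : I' -> I) :
  injective phi -> mutually_independent P X ->
  mutually_independent P (X \o phi).
Proof.
move=> phi_inj indX J A uJ mA.
(* The sets [A] transported along [phi], with the default [setT] off the image of [J]. *)
pose B i := nth setT [seq A j | j <- J] (index i [seq phi j | j <- J]).
have BE j : j \in J -> B (phi j) = A j.
  by move=> jJ; rewrite /B index_map // (nth_map j) ?index_mem // nth_index.
have mB i : measurable (B i).
  rewrite /B; have [h|h] := leqP (size [seq A j | j <- J]) (index i [seq phi j | j <- J]).
    by rewrite nth_default.
  by have /mapP[j _ ->] := mem_nth setT h.
have uphiJ : uniq [seq phi j | j <- J] by rewrite map_inj_uniq.
transitivity (P (\bigcap_(i in [set` [seq phi j | j <- J]]) (X i @^-1` B i))).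
  congr (P _); apply/seteqP; split => w h.
    by move=> _ /= /mapP[j jJ ->] /=; rewrite BE //; exact: h.
  by move=> j /= jJ; have := h (phi j); rewrite /= BE //; apply; exact: map_f.
rewrite indX // big_map big_seq [RHS]big_seq; apply: eq_bigr => j jJ.
by rewrite /= BE.
Qed.

Lemma independent_comp (I : choiceType) (X : I -> T -> R) (h : I -> R -> R) :
  (forall i, measurable_fun [set: R] (h i)) -> mutually_independent P X ->
  mutually_independent P (fun i => h i \o X i).
Proof.
move=> mh indX J A uJ mA.
have mB i : measurable (h i @^-1` A i) by rewrite -[_ @^-1` _]setTI; exact: mh.
exact: indX J (fun i => h i @^-1` A i) uJ mB.
Qed.

Lemma law_unique (I : choiceType) (X Y : I -> T -> R) :
  (forall i, measurable_fun [set: T] (X i)) ->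
  (forall i, measurable_fun [set: T] (Y i)) ->
  mutually_independent P X -> mutually_independent P Y ->
  (forall i A, measurable A -> P (X i @^-1` A) = P (Y i @^-1` A)) ->
  forall B : set (path_space R I), measurable B ->
    P [set w | B (fun i => X i w)] = P [set w | B (fun i => Y i w)].
Proof.
move=> mX mY indX indY XY.
have mX' := measurable_path mX; have mY' := measurable_path mY.
apply: (@path_measure_unique _ _ (pushforward P (fun w => (fun i => X i w) : path_space R I))
   (pushforward P (fun w => (fun i => Y i w) : path_space R I))).
  suff : (P setT < +oo)%E by [].
  by rewrite probability_setT ltry.
move=> _ [J [A [mA ->]]]; rewrite /pushforward.
transitivity (\prod_(i <- undup J) P (X i @^-1` A i))%E.
  exact: independent_cylinder.
transitivity (\prod_(i <- undup J) P (Y i @^-1` A i))%E.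
  by apply: eq_bigr => i _; exact: XY.
by symmetry; exact: independent_cylinder.
Qed.

(* A random variable whose distribution has no atom almost surely differs from
   any function of variables independent of it. *)
Lemma independent_neq (I : choiceType) (X : T -> R) (Y : I -> T -> R)
    (h : path_space R I -> R) :
  measurable_fun [set: T] X -> (forall i, measurable_fun [set: T] (Y i)) ->
  measurable_fun [set: path_space R I] h ->
  mutually_independent P (fun o => if o is Some i then Y i else X) ->
  (forall r, P (X @^-1` [set r]) = 0%E) ->
  P [set w | X w = h (fun i => Y i w)] = 0%E.
Proof.
move=> mX mY mh ind X0.
have mY' := measurable_path mY.
have mpair : measurable_fun [set: T] (fun w => (h (fun i => Y i w), X w)).
  by apply: measurable_fun_pair => //; exact: (measurableT_comp mh mY').
pose hY : {RV P >-> R} := MeasurableFun.Pack (MeasurableFun.Class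
  (isMeasurableFun.Build _ _ _ _ _ (measurableT_comp mh mY'))).
pose X' : {RV P >-> R} := MeasurableFun.Pack (MeasurableFun.Class
  (isMeasurableFun.Build _ _ _ _ _ mX)).
(* Compare the measures [P (. & X in A)] and [P (X in A) * P (.)] on path space; they agree on
   cylinders. *)
have indep A (B : set (path_space R I)) : measurable A -> measurable B ->
    P ([set w | B (fun i => Y i w)] `&` X @^-1` A) =
    (P (X @^-1` A) * P [set w | B (fun i => Y i w)])%E.
  move=> mA mB.
  have mXA : measurable (X @^-1` A).
    by rewrite -[_ @^-1` _]setTI; exact: (mX measurableT _ mA).
  have PXA : P (X @^-1` A) = (fine (P (X @^-1` A)))%:E.
    by rewrite fineK // fin_num_measure.
  pose r : {nonneg R} := NngNum (fine_ge0 (measure_ge0 P (X @^-1` A))).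
  rewrite PXA.
  apply: (@path_measure_unique _ _
    (pushforward (mrestr P mXA) (fun w => (fun i => Y i w) : path_space R I))
    (mscale r (pushforward P (fun w => (fun i => Y i w) : path_space R I)))) => //.
    suff : (P (setT `&` X @^-1` A) < +oo)%E by [].
    by rewrite setTI -ge0_fin_numE // fin_num_measure.
  move=> _ [J [A' [mA' ->]]].
  transitivity (P (X @^-1` A) * P [set w | forall i, i \in J -> A' i (Y i w)])%E;
    last by rewrite PXA.
  transitivity (P ([set w | forall i, i \in J -> A' i (Y i w)] `&` X @^-1` A)) => //.
  pose A2 o := if o is Some i then A' i else A.
  have mA2 o : measurable (A2 o) by case: o.
  have -> : [set w | forall i, i \in J -> A' i (Y i w)] `&` X @^-1` A =
      [set w | forall o, o \in None :: map Some J ->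
                 A2 o ((if o is Some i then Y i else X) w)].
    apply/seteqP; split => w /=.
      move=> [Yw Xw] [i|]; rewrite inE //= => /mapP[j jJ [->]]; exact: Yw.
    move=> hw; split; last by have := hw None; apply; rewrite inE.
    by move=> i iJ; have := hw (Some i); apply; rewrite inE /= map_f.
  rewrite [LHS]independent_cylinder // (_ : undup _ = None :: map Some (undup J)); last first.
    rewrite /= undup_map_inj; last by move=> ? ? [].
    by case: ifP => // /mapP[].
  rewrite big_cons; congr (_ * _)%E.
  rewrite big_map; symmetry; apply: independent_cylinder => //.
  exact: (@independent_reindex _ _ (fun o => if o is Some i then Y i else X) Some Some_inj ind).
have dE (A : set (R * R)) : measurable A ->
    (distribution P hY \x distribution P X')%E A =
    P ((fun w => (h (fun i => Y i w), X w)) @^-1` A).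
  move=> mA; apply: (@product_measure_unique _ _ _ _ _ (distribution P hY)
    (distribution P X') (pushforward P (fun w => (h (fun i => Y i w), X w)))) => //.
  move=> B A' mB mA'.
  transitivity (P ([set w | (h @^-1` B) (fun i => Y i w)] `&` X @^-1` A')) => //.
  rewrite indep // 1?muleC //.
  by rewrite -[_ @^-1` _]setTI; exact: (mh measurableT _ mB).
pose diag : set (R * R) := [set z | z.1 = z.2].
have mdiag : measurable diag.
  rewrite (_ : diag = (fun z : R * R => z.1 - z.2) @^-1` [set 0]).
    rewrite -[_ @^-1` _]setTI; apply: (measurable_funB measurable_fst measurable_snd) => //.
  by apply/seteqP; split => z /=; [move=> ->; rewrite subrr|move/eqP; rewrite subr_eq0 => /eqP].
transitivity (P ((fun w => (h (fun i => Y i w), X w)) @^-1` diag)).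
  by congr (P _); apply/seteqP; split => w /=.
(* The joint law is a product, and the sections of the diagonal are single points, null for the law
   of [X]. *)
rewrite -dE //; apply: integral0_eq => x _ /=.
rewrite (_ : xsection diag x = [set x]); first exact: X0.
by apply/seteqP; split => y; rewrite xsectionE /=.
Qed.

End independence.

Section bounded_functions.
Variables (R : realType) (disp : measure_display) (T : measurableType disp).

Definition bounded_measurable (F : T -> R) : Prop :=
  measurable_fun [set: T] F /\ exists C, forall w, `|F w| <= C.

Lemma bounded_measurableM (F G : T -> R) :
  bounded_measurable F -> bounded_measurable G -> bounded_measurable (fun w => F w * G w).
Proof.
move=> [mF [C FC]] [mG [C' GC]]; split; first exact: measurable_funM.
by exists (C * C') => w; rewrite normrM ler_pM.
Qed.

Lemma bounded_measurableD (F G : T -> R) :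
  bounded_measurable F -> bounded_measurable G -> bounded_measurable (fun w => F w + G w).
Proof.
move=> [mF [C FC]] [mG [C' GC]]; split; first exact: measurable_funD.
by exists (C + C') => w; apply: le_trans (ler_normD _ _) _; rewrite lerD.
Qed.

Lemma bounded_measurable_cst (c : R) : bounded_measurable (fun=> c).
Proof. by split; [exact: measurable_cst|exists `|c|]. Qed.

Lemma bounded_measurable_sum (I : Type) (s : seq I) (F : I -> T -> R) :
  (forall i, bounded_measurable (F i)) ->
  bounded_measurable (fun w => \sum_(i <- s) F i w).
Proof.
move=> bF; elim: s => [|i s IH].
  by under eq_fun do rewrite big_nil; exact: bounded_measurable_cst.
by under eq_fun do rewrite big_cons; exact: bounded_measurableD.
Qed.

Variable P : probability T R.

Lemma bounded_integrable (F : T -> R) :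
  bounded_measurable F -> P.-integrable [set: T] (EFin \o F).
Proof.
move=> [mF [C FC]]; apply: measurable_bounded_integrable => //.
  by rewrite -ge0_fin_numE // fin_num_measure.
exists C; split; first exact: num_real.
by move=> x Cx w _ /=; apply: le_trans (FC w) _; exact: ltW.
Qed.

Lemma mean_sum (I : Type) (s : seq I) (F : I -> T -> R) :
  (forall i, bounded_measurable (F i)) ->
  (\int[P]_w (\sum_(i <- s) F i w) = \sum_(i <- s) \int[P]_w F i w)%R.
Proof.
move=> bF; elim: s => [|i s IH].
  rewrite big_nil; under eq_Rintegral do rewrite big_nil.
  by rewrite Rintegral_cst // mul0r.
rewrite big_cons -IH; under eq_Rintegral do rewrite big_cons.
rewrite RintegralD //; apply: bounded_integrable => //.
exact: bounded_measurable_sum.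
Qed.

Lemma mean_ae (F G : T -> R) : bounded_measurable F -> bounded_measurable G ->
  {ae P, forall w, F w = G w} -> (\int[P]_w F w = \int[P]_w G w)%R.
Proof.
move=> [mF _] [mG _] FG; rewrite /Rintegral; congr fine.
apply: ae_eq_integral => //; [exact/measurable_EFinP|exact/measurable_EFinP|].
by apply: filterS FG => w /= e _; rewrite e.
Qed.

End bounded_functions.

(** * Leading minors as affine functions of their corner entry *)

Section leading_minors.
Variable R : realType.
Implicit Type x : nat -> nat -> R.

(** Entries are indexed by [nat] so that minors of all sizes read the same array. *)
Definition minor (n : nat) x : R := \det (\matrix_(a < n, b < n) x a b).

Definition zero_entry (n : nat) x : nat -> nat -> R :=
  fun a b => if (a == n) && (b == n) then 0 else x a b.

(** Laplace expansion along the last row: only one term contains the corner entry, and its cofactor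
    is the previous minor. *)
Lemma minorS n x : minor n.+1 x = x n n * minor n x + minor n.+1 (zero_entry n x).
Proof.
rewrite /minor !(expand_det_row _ ord_max) !big_ord_recr /= !mxE /zero_entry /= !eqxx /=.
rewrite mul0r addr0 addrC; congr (_ * _ + _).
  rewrite /cofactor addnn -mul2n exprM sqrrN !expr1n mul1r; congr (\det _).
  by apply/matrixP => a b; rewrite !mxE !lift_max.
apply: eq_bigr => b _; rewrite !mxE /= eqxx ltn_eqF //=; congr (_ * (_ * \det _)).
by apply/matrixP => a c; rewrite !mxE lift_max ltn_eqF.
Qed.

Lemma eq_minor n x y : (forall a b, (a < n)%N -> (b < n)%N -> x a b = y a b) ->
  minor n x = minor n y.
Proof.
by move=> xy; congr (\det _); apply/matrixP => a b; rewrite !mxE xy.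
Qed.

End leading_minors.

(** * Invariances of the Gaussian law *)

Section gaussian.
Variables (R : realType) (disp : measure_display) (T : measurableType disp).
Variable P : probability T R.

Definition gaussian_family (I : choiceType) (X : I -> T -> R) : Prop :=
  [/\ forall i, measurable_fun [set: T] (X i), mutually_independent P X
    & forall i A, measurable A -> P (X i @^-1` A) = normal_prob (0 : R) (1 : R) A].

(** Both families have the same law on path space. Applied with [X] a sign-changed or permuted copy
    of [Y], it expresses the symmetry of the sample. *)
Lemma gaussian_mean (I : choiceType) (X Y : I -> T -> R) (F : path_space R I -> R) :
  gaussian_family X -> gaussian_family Y -> measurable_fun [set: path_space R I] F ->
  (exists C, forall x, `|F x| <= C) ->
  (\int[P]_w F (fun i => X i w) = \int[P]_w F (fun i => Y i w))%R.
Proof.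
move=> [mX iX gX] [mY iY gY] mF [C FC].
have pf (Z : I -> T -> R) : (forall i, measurable_fun [set: T] (Z i)) ->
    (\int[P]_w (F (fun i => Z i w))%:E =
     \int[pushforward P (fun w => (fun i => Z i w) : path_space R I)]_x (F x)%:E)%E.
  move=> mZ; have mZ' := measurable_path mZ.
  rewrite (@integral_pushforward _ _ _ _ _ _ mZ' P setT (EFin \o F)) //.
  - exact/measurable_EFinP.
  - apply: bounded_integrable; split; last by exists C => w; exact: FC.
    exact: (measurableT_comp mF mZ').
rewrite /Rintegral !pf //; congr fine; apply: eq_measure_integral.
- exact: measurable_path.
- exact: measurable_path.
move=> mY' mX' B mB _.
apply: (@law_unique _ _ _ P I X Y) => //.
by move=> i A mA; rewrite gX // gY.
Qed.

Lemma gaussian_reindex (I I' : choiceType) (X : I -> T -> R) (phi : I' -> I) :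
  injective phi -> gaussian_family X -> gaussian_family (X \o phi).
Proof.
move=> phi_inj [mX iX gX]; split => [i||i A mA]; [exact: mX| |exact: gX].
exact: independent_reindex.
Qed.

Lemma normal_probN (A : set R) : measurable A ->
  normal_prob (0 : R) (1 : R) (-%R @^-1` A) = normal_prob (0 : R) (1 : R) A.
Proof.
move=> mA; rewrite /normal_prob.
pose f (x : R) : \bar R := (normal_pdf 0 1 x)%:E.
have fN x : f (- x) = f x.
  by rewrite /f /normal_pdf oner_eq0 /normal_fun !subr0 sqrrN.
have mf : measurable_fun [set: R] f by apply/measurable_EFinP; exact: measurable_normal_pdf.
have -> : (\int[lebesgue_measure]_(x in -%R @^-1` A) f x =
    \int[lebesgue_measure]_(x in -%R @^-1` A) (f \o -%R) x)%E.
  by apply: eq_integral => x _; rewrite /= fN.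
transitivity (\int[pushforward lebesgue_measure (-%R : R -> measurableTypeR R)]_(x in A) f x)%E.
  symmetry; apply: ge0_integral_pushforward => //; first exact: measurable_funTS.
  by move=> x _; rewrite lee_fin normal_pdf_ge0.
by apply: eq_measure_integral => // B mB _; exact: lebesgue_measureN.
Qed.

Lemma gaussian_sign (I : choiceType) (X : I -> T -> R) (s : pred I) :
  gaussian_family X ->
  gaussian_family (fun i w => if s i then - X i w else X i w).
Proof.
move=> [mX iX gX]; split => [i||i A mA].
- by case: (s i) => //; exact: measurable_funN.
- have -> : (fun i w => if s i then - X i w else X i w) =
      (fun i => (fun r : R => if s i then - r else r) \o X i) by [].
  apply: independent_comp => // i; case: (s i); [exact: oppr_measurable|exact: measurable_id].
case: (s i); last exact: gX.
rewrite -normal_probN // -(gX i) //.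
by rewrite -[_ @^-1` _]setTI; exact: (@oppr_measurable R setT measurableT _ mA).
Qed.

Lemma gaussian_no_atom (I : choiceType) (X : I -> T -> R) i r :
  gaussian_family X -> P (X i @^-1` [set r]) = 0%E.
Proof.
move=> [_ _ gX]; rewrite gX //.
have /null_content_dominatesP := @normal_prob_dominates R 0 1.
by apply => //; exact: (lebesgue_measure_set1 r).
Qed.

End gaussian.

(** * The mean projection onto the range of a Gaussian matrix *)

Section gaussian_projection.
Variables (R : realType) (disp : measure_display) (T : measurableType disp).
Variable P : probability T R.
Variables d k : nat.
Hypothesis k_gt0 : (0 < k)%N.
Hypothesis kd : (k <= d)%N.

Let I : choiceType := (nat * 'I_d * 'I_k)%type.
Local Notation Omega := (path_space R I).

Definition sample_mx (x : nat * 'I_d * 'I_k -> R) (t : nat) : 'M[R]_(d, k) :=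
  \matrix_(i, j) x (t, i, j).

Definition sample_entry (x : nat * 'I_d * 'I_k -> R) (t a b : nat) : R :=
  match insub a, insub b with
  | Some i, Some j => x (t, i, j)
  | _, _ => 0
  end.

Lemma sample_entryE x t (i : 'I_d) (j : 'I_k) : sample_entry x t i j = x (t, i, j).
Proof. by rewrite /sample_entry !valK. Qed.

Lemma mx_measurable_sample t : mx_measurable (fun x : Omega => sample_mx x t).
Proof.
move=> i j.
have -> : (fun x : Omega => sample_mx x t i j) = (fun x : Omega => x (t, i, j)).
  by apply/funext => x; rewrite mxE.
exact: (@measurable_coord R I (t, i, j)).
Qed.

Lemma mx_measurable_proj t : mx_measurable (fun x : Omega => proj (sample_mx x t)).
Proof.
have mU := mx_measurable_sample t.
by apply: mx_measurableM => //; exact: mx_measurable_mpinv.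
Qed.

Lemma measurable_sample_entry t a b :
  measurable_fun [set: Omega] (fun x : Omega => sample_entry x t a b).
Proof.
rewrite /sample_entry; case: insubP => [i _ _|_]; last exact: measurable_cst.
by case: insubP => [j _ _|_]; [exact: (@measurable_coord R I (t, i, j))|exact: measurable_cst].
Qed.

Section fixed_time.
Variable t : nat.

(* An injection of the index set that avoids [i0] and fixes all the other
   indices of time [t]. *)
Definition avoid (i0 p : nat * 'I_d * 'I_k) : nat * 'I_d * 'I_k :=
  if (p.1.1 == t) && (p != i0) then p else ((p.1.1 + t).+1, p.1.2, p.2).

(** Moved indices land at times after [t] and kept ones stay at [t], so images do not collide and
    miss [i0]. Reindexing along this map makes [X i0] independent of [X \o avoid i0]. *)
Lemma avoid_option_inj i0 : i0.1.1 = t ->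
  injective (fun o : option (nat * 'I_d * 'I_k) => if o is Some p then avoid i0 p else i0).
Proof.
move=> i0t.
have av p : avoid i0 p <> i0.
  rewrite /avoid; case: ifP => [/andP[_ /eqP]//|_ e].
  by have := congr1 (fun q => q.1.1) e; rewrite /= i0t; lia.
have avj p q : avoid i0 p = avoid i0 q -> p = q.
  rewrite /avoid; case: ifP => hp; case: ifP => hq //.
  - by case/andP: hp => /eqP hp _ e; have := congr1 (fun q => q.1.1) e; rewrite /= hp; lia.
  - by case/andP: hq => /eqP hq _ e; have := congr1 (fun q => q.1.1) e; rewrite /= hq; lia.
  move: p q {hp hq} => [[s i] j] [[s' i'] j'] /= [e -> ->].
  by congr (_, _, _); lia.
move=> [p|] [q|] //= e; first by rewrite (avj _ _ e).
- by have := av p; rewrite e.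
- by have := av q; rewrite -e.
Qed.

Variable X : nat * 'I_d * 'I_k -> T -> R.
Hypothesis gX : gaussian_family P (X : I -> T -> R).

(* The minor is affine in its last diagonal entry, with slope the previous
   minor and with coefficients independent of that entry. *)
Lemma minor_neq0 n : (n <= k)%N ->
  {ae P, forall w, minor n (sample_entry (X^~ w) t) != 0}.
Proof.
elim: n => [_|n IH nk]; first by apply: aeW => w; rewrite /minor det_mx00 oner_neq0.
pose i0 : I := (t, Ordinal (leq_trans nk kd), Ordinal nk).
(* [Y] agrees with [X] on the entries of time [t] other than [i0]. The function [h] gives the value
   of entry [i0] at which the next minor vanishes, and it does not read that entry. *)
pose Y := X \o avoid i0.
pose h (x : Omega) : R :=
  - minor n.+1 (zero_entry n (sample_entry x t)) / minor n (sample_entry x t).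
have mm m : measurable_fun [set: Omega] (fun x : Omega => minor m (sample_entry x t)).
  apply: measurable_det => a b.
  rewrite (_ : (fun x : Omega => _) = (fun x : Omega => sample_entry x t a b)).
    exact: measurable_sample_entry.
  by apply/funext => x; rewrite mxE.
have mz m : measurable_fun [set: Omega]
    (fun x : Omega => minor m (zero_entry n (sample_entry x t))).
  apply: measurable_det => a b.
  rewrite (_ : (fun x : Omega => _) =
      (fun x : Omega => zero_entry n (sample_entry x t) a b)); last first.
    by apply/funext => x; rewrite mxE.
  by rewrite /zero_entry; case: (_ && _); [exact: measurable_cst|exact: measurable_sample_entry].
have mh : measurable_fun [set: Omega] h.
  by apply: measurable_funM; [exact: measurable_funN|exact: measurable_invr].
have entryY w a b : ~~ ((a == n) && (b == n)) ->
    sample_entry (Y^~ w) t a b = sample_entry (X^~ w) t a b.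
  move=> ab; rewrite /sample_entry; case: insubP => [i _ ia|//]; case: insubP => [j _ jb|//].
  rewrite /Y /avoid /= eqxx /= ifT //; apply: contra ab => /eqP[ei ej].
  by rewrite -ia -jb ei ej !eqxx.
have hY w : h (Y^~ w) = h (X^~ w).
  rewrite /h; congr (- _ / _); last first.
    apply: eq_minor => a b an bn; apply: entryY.
    by rewrite (ltn_eqF an).
  apply: eq_minor => a b _ _; rewrite /zero_entry; case: ifP => // /negbT.
  exact: entryY.
have [mX iX _] := gX.
have mY p : measurable_fun [set: T] (Y p) by exact: mX.
have Xh0 : P [set w | X i0 w = h (Y^~ w)] = 0%E.
  apply: independent_neq => //; last by move=> r; exact: gaussian_no_atom gX.
  have := independent_reindex (avoid_option_inj (erefl : i0.1.1 = t)) iX.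
  by congr (mutually_independent P _); apply/funext => -[p|].
have Xh : {ae P, forall w, X i0 w != h (X^~ w)}.
  exists [set w | X i0 w = h (Y^~ w)]; split => //.
    have mhY : measurable_fun [set: T] (fun w => h (Y^~ w)).
      exact: (measurableT_comp mh (measurable_path mY)).
    rewrite (_ : [set w | _] = (fun w => X i0 w == h (Y^~ w)) @^-1` [set true]).
      rewrite -[_ @^-1` _]setTI.
      exact: (measurable_fun_eqr (mX i0) mhY measurableT).
    by apply/seteqP; split => w /= /eqP.
  by move=> w /= /negP; rewrite negbK => /eqP e; rewrite hY.
apply: filterS2 (IH (ltnW nk)) Xh => w m0 Xw.
rewrite minorS; apply: contra Xw => /eqP e.
have -> : X i0 w = sample_entry (X^~ w) t n n.
  by rewrite -(sample_entryE (X^~ w) t (Ordinal (leq_trans nk kd)) (Ordinal nk)).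
rewrite /h -(subr_eq0 _ (_ / _)) mulNr opprK.
apply/eqP; rewrite -[X in X + _](mulfK m0) -mulrDl e mul0r.
by [].
Qed.

(** Almost surely the top [k] by [k] block [W] is invertible. As [S] selects the first [k] rows,
    [invmx W *m S] is a left inverse of the sample, which thus has full column rank. *)
Lemma tr_proj_sample : {ae P, forall w, \tr (proj (sample_mx (X^~ w) t)) = k%:R}.
Proof.
apply: filterS (minor_neq0 (leqnn k)) => w m0.
pose S : 'M[R]_(k, d) := \matrix_(a, l) (l == widen_ord kd a)%:R.
pose W : 'M[R]_k := \matrix_(a, b) sample_entry (X^~ w) t a b.
have uW : W \in unitmx by rewrite unitmxE unitfE.
apply: (@tr_proj R d k _ (invmx W *m S)).
suff SU : S *m sample_mx (X^~ w) t = W by rewrite -mulmxA SU mulVmx.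
apply/matrixP => a b; rewrite !mxE (bigD1 (widen_ord kd a)) //= big1 => [|l la].
  rewrite !mxE eqxx mul1r addr0.
  exact/esym/(sample_entryE (X^~ w) t (widen_ord kd a) b).
by rewrite !mxE (negbTE la) mul0r.
Qed.

Variable F : Omega -> R.
Hypothesis mF : measurable_fun [set: Omega] F.
Hypothesis bF : exists C, forall x, `|F x| <= C.
Hypothesis F_past : forall x y : Omega,
  (forall s i j, s != t -> x (s, i, j) = y (s, i, j)) -> F x = F y.

(** [F] does not read the sample of time [t], so symmetries acting on that sample alone leave it
    unchanged. This stands in for conditioning on the past. *)
Let FP i j (x : Omega) : R := F x * proj (sample_mx x t) i j.

Let mFP i j : measurable_fun [set: Omega] (FP i j).
Proof. by apply: measurable_funM => //; exact: mx_measurable_proj. Qed.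

Let bFP i j : exists C, forall x, `|FP i j x| <= C.
Proof.
have [C FC] := bF; exists C => x; rewrite normrM -[leRHS]mulr1.
by rewrite ler_pM // proj_entry_bound.
Qed.

(* Changing the sign of row [i] of the sample preserves its law, and changes
   the sign of the entry [(i, j)] of the projection. *)
Lemma mean_proj_offdiag i j : i != j -> (\int[P]_w FP i j (X^~ w) = 0)%R.
Proof.
move=> ij; pose s (p : I) := (p.1.1 == t) && (p.1.2 == i).
pose X' (p : I) w := if s p then - X p w else X p w.
have gX' : gaussian_family P X' by exact: gaussian_sign.
pose Q : 'M[R]_d := \matrix_(a, b) ((a == b)%:R * (-1) ^+ (a == i)).
have QE a b : Q a b = (a == b)%:R * (-1) ^+ (a == i) by rewrite mxE.
have QQ : Q^T *m Q = 1%:M.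
  apply/matrixP => a b; rewrite !mxE (bigD1 a) //= big1 => [|c ca].
    rewrite !mxE eqxx mul1r addr0 mulrCA -expr2 sqrr_sign mulr1.
    by [].
  by rewrite !mxE (negbTE ca) !mul0r.
have QU w : sample_mx (X'^~ w) t = Q *m sample_mx (X^~ w) t.
  apply/matrixP => a b; rewrite !mxE (bigD1 a) //= big1 => [|c ca].
    rewrite !mxE eqxx mul1r addr0 /X' /s /= eqxx /=.
    by case: (a == i); rewrite ?expr1 ?mulN1r // expr0 mul1r.
  by rewrite !mxE eq_sym (negbTE ca) !mul0r.
have FPN w : FP i j (X'^~ w) = - FP i j (X^~ w).
  rewrite /FP QU proj_orthogonal // -mulrN.
  rewrite (@F_past (X'^~ w) (X^~ w)); last first.
    by move=> s' a b st; rewrite /X' /s /= (negbTE st).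
  congr (_ * _); rewrite mxE (bigD1 j) //= big1 => [|c cj]; last first.
    by rewrite !mxE eq_sym (negbTE cj) !mul0r mulr0.
  rewrite addr0 mxE (bigD1 i) //= big1 => [|c ci]; last first.
    by rewrite !mxE eq_sym (negbTE ci) !mul0r.
  by rewrite !mxE !eqxx (negbTE (_ : j != i)) 1?eq_sym //= expr0 expr1 addr0; ring.
have := gaussian_mean gX' gX (mFP i j) (bFP i j).
under eq_Rintegral do rewrite FPN -mulN1r.
rewrite RintegralZl //; first by lra.
apply: bounded_integrable; split; last by have [C h] := bFP i j; exists C => w; exact: h.
by apply: (measurableT_comp (mFP i j)); apply: measurable_path; case: gX.
Qed.

(* By invariance of the law under the exchange of rows [i] and [j]. *)
Lemma mean_proj_diag_eq i j :
  (\int[P]_w FP i i (X^~ w) = \int[P]_w FP j j (X^~ w))%R.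
Proof.
pose phi (p : nat * 'I_d * 'I_k) : nat * 'I_d * 'I_k :=
  (p.1.1, if p.1.1 == t then tperm i j p.1.2 else p.1.2, p.2).
have phi_inj : injective (phi : I -> I).
  move=> [[s a] b] [[s' a'] b'] [-> + ->]; case: ifP => _ => [/perm_inj -> //|-> //].
have gX' := gaussian_reindex phi_inj gX.
rewrite -(gaussian_mean gX' gX (mFP i i) (bFP i i)).
apply: eq_Rintegral => w _; rewrite /FP.
have -> : F ((X \o phi)^~ w) = F (X^~ w).
  by apply: F_past => s a b st; rewrite /phi /= (negbTE st).
congr (_ * _).
have -> : sample_mx ((X \o phi)^~ w) t = perm_mx (tperm i j) *m sample_mx (X^~ w) t.
  by rewrite -row_permE; apply/matrixP => a b; rewrite !mxE /phi /= eqxx.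
rewrite proj_orthogonal; last by rewrite tr_perm_mx -perm_mxM mulVg perm_mx1.
rewrite tr_perm_mx -row_permE -col_permE.
by rewrite !mxE tpermL.
Qed.

Lemma mean_proj_diag i :
  (\int[P]_w FP i i (X^~ w) = k%:R / d%:R * \int[P]_w F (X^~ w))%R.
Proof.
have d0 : d%:R != 0 :> R by rewrite pnatr_eq0 -lt0n (leq_trans k_gt0).
have mX : measurable_fun [set: T] (fun w => (fun p => X p w) : Omega).
  by apply: measurable_path; case: gX.
have bFX : bounded_measurable (fun w => F (X^~ w)).
  split; first exact: (measurableT_comp mF mX).
  by have [C h] := bF; exists C => w; exact: h.
have bPX l : bounded_measurable (fun w => FP l l (X^~ w)).
  split; first exact: (measurableT_comp (mFP l l) mX).
  by have [C h] := bFP l l; exists C => w; exact: h.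
have : (\int[P]_w (\sum_(l < d) FP l l (X^~ w)) = k%:R * \int[P]_w F (X^~ w))%R.
  rewrite -RintegralZl //; last exact: bounded_integrable.
  apply: mean_ae.
  - exact: bounded_measurable_sum.
  - by apply: bounded_measurableM => //; exact: bounded_measurable_cst.
  apply: filterS tr_proj_sample => w e.
  by rewrite /FP -mulr_sumr -/(mxtrace _) e mulrC.
rewrite mean_sum // (eq_bigr (fun=> \int[P]_w FP i i (X^~ w))%R); last first.
  by move=> l _; exact: mean_proj_diag_eq.
rewrite sumr_const card_ord => e.
by rewrite mulrAC -e -[X in _ = X / _]mulr_natr mulfK.
Qed.

End fixed_time.
End gaussian_projection.

(** * Runs of the method *)

Section random_run.
Variables (R : realType) (d k : nat) (L mu M eta0 a0 : R).
Variables (H : 'cV[R]_d -> 'M[R]_d) (g : 'cV[R]_d -> 'cV[R]_d).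
Hypothesis kd : (1 <= k < d)%N.
Hypothesis mu_gt0 : 0 < mu.
Hypothesis mu_le_L : mu <= L.
Hypothesis M_gt0 : 0 < M.
Hypothesis H_posdef : forall x, posdef (H x).
Hypothesis H_concordant : forall x y z w v,
  quad (H y) v - quad (H x) v <= M * energy_norm (H z) (y - x) * quad (H w) v.
Hypothesis g_mvt : forall x h u, exists2 s : R, 0 <= s <= 1 &
  bil 1%:M u (g (x + h)) = bil 1%:M u (g x) + bil (H (x + s *: h)) u h.
Hypothesis tr_H_le : forall x, \tr (H x) <= d%:R * L.
Hypothesis H_ge : forall x v, mu * quad 1%:M v <= quad (H x) v.
Hypothesis eta0_ge1 : 1 <= eta0.

Local Notation kappa := (L / mu).
Local Notation D := (d%:R * kappa).
Local Notation rho := (1 - k%:R / d%:R : R).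

Hypothesis a0_small : a0 <= 3 / 8 * (rho / (eta0 * D)).

Variable s0 : 'cV[R]_d * 'M[R]_d.
Hypothesis low0 : loewner (H s0.1) s0.2.
Hypothesis upp0 : loewner s0.2 (eta0 *: H s0.1).
Hypothesis a0E : a0 = M * lam H g s0.

Local Notation inv := (state_inv M eta0 a0 H g).
Local Notation runU := (run M H g s0).
Local Notation pot := (potential k L mu M eta0 H g).

Lemma run_inv (U : nat -> 'M[R]_(d, k)) t : inv (runU U t).
Proof.
elim: t => [|t IH]; first exact: state_inv_init.
exact: (state_inv_step kd mu_gt0 mu_le_L M_gt0 H_posdef H_concordant g_mvt eta0_ge1 a0_small IH).
Qed.

Lemma lam_run_linear (U : nat -> 'M[R]_(d, k)) t :
  lam H g (runU U t.+1) <= (1 - 1 / (2 * eta0)) * lam H g (runU U t).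
Proof.
exact: (next_lam_linear kd mu_gt0 mu_le_L M_gt0 H_posdef H_concordant g_mvt eta0_ge1
  a0_small (run_inv U t)).
Qed.

Lemma ratio_le_potential (U : nat -> 'M[R]_(d, k)) t :
  lam H g (runU U t.+1) / lam H g (runU U t) <= 23 / 20 * pot (runU U t).
Proof.
have pot0 : 0 <= 23 / 20 * pot (runU U t).
  apply: mulr_ge0 => //.
  exact: (potential_ge0 kd mu_gt0 mu_le_L M_gt0 (run_inv U t)).
have [->|l0] := eqVneq (lam H g (runU U t)) 0; first by rewrite invr0 mulr0.
rewrite ler_pdivrMr; last by rewrite lt_neqAle eq_sym l0 lam_ge0.
exact: (next_lam_potential kd mu_gt0 mu_le_L M_gt0 H_posdef H_concordant g_mvt H_ge
  eta0_ge1 a0_small (run_inv U t)).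
Qed.

Lemma potential_start : 23 / 20 * pot s0 <= 2 * D * eta0.
Proof.
apply: (potential_init kd mu_gt0 mu_le_L M_gt0 eta0_ge1 a0_small (run_inv (fun=> 0) 0)).
exact: gap_init.
Qed.

Lemma greedy_ratio (U : nat -> 'M[R]_(d, k)) :
  (forall t, is_E (residual M H g (runU U t)) (U t)) ->
  forall t, lam H g (runU U t.+1) / lam H g (runU U t) <= 2 * D * eta0 * rho ^+ t.
Proof.
move=> gr t; apply: le_trans (ratio_le_potential U t) _.
have rp := rho_gt0 R kd.
have d0 : 0 < d%:R :> R by rewrite ltr0n (d_gt0 kd).
suff : pot (runU U t) <= rho ^+ t * pot s0.
  move/(ler_wpM2l (_ : 0 <= 23 / 20)) => /(_ (ltac:(lra))) /le_trans; apply.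
  rewrite mulrCA [leRHS]mulrC ler_wpM2l ?exprn_ge0 ?(ltW rp) //.
  exact: potential_start.
elim: t => [|t IH]; first by rewrite expr0 mul1r.
rewrite exprS -mulrA; apply: le_trans (ler_wpM2l (ltW rp) IH).
have inv_t := run_inv U t; set s := runU U t in inv_t *.
apply: le_trans (potential_decrease kd mu_gt0 mu_le_L M_gt0 H_posdef H_concordant g_mvt
  tr_H_le H_ge eta0_ge1 a0_small inv_t).
rewrite /potential /= ler_wpM2r ?expR_ge0 // lerD2r.
apply: le_trans (gap_step mu_gt0 M_gt0 H_posdef H_concordant inv_t (U t)) _.
rewrite mulrA ler_wpM2r ?invr_ge0 ?(ltW mu_gt0) //.
have := tr_proj_greedy (gr t); rewrite -/s; set B := residual _ _ _ _ => h.
have : k%:R / d%:R * \tr B <= \tr (B *m proj (U t)) by rewrite mulrAC ler_pdivrMr // [leRHS]mulrC.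
lra.
Qed.

Let I : choiceType := (nat * 'I_d * 'I_k)%type.
Local Notation Omega := (path_space R I).

Hypothesis measurable_H : forall X : Omega -> 'cV[R]_d,
  mx_measurable X -> mx_measurable (fun w => H (X w)).
Hypothesis measurable_g : forall X : Omega -> 'cV[R]_d,
  mx_measurable X -> mx_measurable (fun w => g (X w)).

(** The state as a function on path space, where the measurability and invariance arguments take
    place. *)
Definition random_state (t : nat) (x : nat * 'I_d * 'I_k -> R) := runU (sample_mx x) t.

Lemma random_state_past t (x y : nat * 'I_d * 'I_k -> R) :
  (forall s i j, (s < t)%N -> x (s, i, j) = y (s, i, j)) ->
  random_state t x = random_state t y.
Proof.
elim: t => [//|t IH] xy; rewrite /random_state /=.
have -> : runU (sample_mx x) t = runU (sample_mx y) t.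
  by apply: IH => s i j st; apply: xy; exact: ltnW.
congr step; apply/matrixP => i j; rewrite !mxE; exact: xy.
Qed.

Lemma measurable_random_state t :
  mx_measurable (fun x : Omega => (random_state t x).1) /\
  mx_measurable (fun x : Omega => (random_state t x).2).
Proof.
elim: t => [|t [m1 m2]]; first by split; exact: mx_measurable_cst.
have mp : mx_measurable (fun x : Omega => step_point g (random_state t x)).
  apply: mx_measurableB => //; apply: mx_measurableM; first exact: mx_measurable_inv.
  exact: measurable_g.
have ms : mx_measurable (fun x : Omega => step_scaled M H g (random_state t x)).
  apply: mx_measurableZ => //; apply: measurable_funD => //.
  apply: measurable_funM => //; apply: measurable_sqrtr; apply: measurable_quad.
    exact: measurable_H.
  exact: mx_measurableB.
have mU := @mx_measurable_sample R d k t.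
split => //.
have mB : mx_measurable (fun x : Omega => step_scaled M H g (random_state t x)
    - H (step_point g (random_state t x))).
  by apply: mx_measurableB => //; exact: measurable_H.
apply: (mx_measurableB ms).
apply: mx_measurableM => //; apply: mx_measurableM; last exact: mx_measurable_tr.
apply: mx_measurableM; first exact: mx_measurableM.
apply: mx_measurable_mpinv; apply: mx_measurableM => //; apply: mx_measurableM => //.
exact: mx_measurable_tr.
Qed.

Lemma measurable_lam_state t :
  measurable_fun [set: Omega] (fun x : Omega => lam H g (random_state t x)).
Proof.
have [m1 m2] := measurable_random_state t.
apply: measurable_sqrtr; apply: measurable_quad; last exact: measurable_g.
by apply: mx_measurable_inv; exact: measurable_H.
Qed.

Lemma mx_measurable_residual t :
  mx_measurable (fun x : Omega => residual M H g (random_state t x)).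
Proof.
have [m1 m2] := measurable_random_state t.
have [p1 _] := measurable_random_state t.+1.
apply: mx_measurableB; last exact: measurable_H.
apply: mx_measurableZ => //; apply: measurable_funD => //.
apply: measurable_funM => //; apply: measurable_sqrtr; apply: measurable_quad.
  exact: measurable_H.
exact: mx_measurableB.
Qed.

Lemma measurable_potential t :
  measurable_fun [set: Omega] (fun x : Omega => pot (random_state t x)).
Proof.
have [m1 m2] := measurable_random_state t.
have ml := measurable_lam_state t.
apply: measurable_funM.
  apply: measurable_funD; last by do 2 apply: measurable_funM => //.
  apply: measurable_funM => //; apply: measurable_trace; apply: mx_measurableB => //.
  exact: measurable_H.
apply: measurableT_comp => //; apply: measurable_funM => //.
exact: measurable_funM.
Qed.

(** [gap_init] with [relax], which is at most [256/169 eta0], in the role of [eta0]. These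
    deterministic bounds supply integrability. *)
Lemma gap_bounded s : inv s -> gap mu H s <= 2 * eta0 * D.
Proof.
move=> [low upp a_le].
have D2 := D_ge2 kd mu_gt0 mu_le_L.
have a_ge0 : 0 <= M * lam H g s by rewrite mulr_ge0 ?lam_ge0 // ltW.
have [r1 r2] := relax_bounds eta0_ge1 a_ge0 a_le (eta0_a0 kd mu_gt0 mu_le_L eta0_ge1 a0_small).
have D0 : 0 <= D by lra.
apply: le_trans (gap_init mu_gt0 tr_H_le r1 upp) _.
by rewrite ler_wpM2r //; lra.
Qed.

Lemma lam_bounded s : inv s -> M * lam H g s <= a0.
Proof. by case. Qed.

Lemma next_lam_bounded s : inv s -> M * next_lam H g s <= a0.
Proof.
move=> inv_s.
(* Any matrix will do in place of 0, as the next point does not depend on [U]. *)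
have [_ _ h] := state_inv_step kd mu_gt0 mu_le_L M_gt0 H_posdef H_concordant g_mvt
  eta0_ge1 a0_small inv_s (0 : 'M[R]_(d, k)).
exact: h.
Qed.

Lemma residual_bounded : exists C, forall s, inv s ->
  forall i j, `|residual M H g s i j| <= C.
Proof.
have D2 := D_ge2 kd mu_gt0 mu_le_L.
exists (mu * ((1 + a0) * (2 * eta0 * D) + 2 * D * a0)) => s inv_s i j.
have a_le := lam_bounded inv_s; have g_le := gap_bounded inv_s.
have g0 := gap_ge0 mu_gt0 inv_s.
have a_ge0 : 0 <= M * lam H g s by rewrite mulr_ge0 ?lam_ge0 // ltW.
have psdR := residual_possemidef M_gt0 H_posdef H_concordant inv_s.
apply: le_trans (psd_entry_le_tr i j psdR) _.
rewrite -ler_pdivrMl // mulrC.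
apply: le_trans (tr_residual mu_gt0 mu_le_L M_gt0 H_posdef H_concordant tr_H_le inv_s) _.
apply: lerD; last by rewrite ler_wpM2l // mulr_ge0 //; lra.
by apply: ler_pM => //; lra.
Qed.

Section expectation.
Variables (disp : measure_display) (T : measurableType disp) (P : probability T R).
Variable X : nat * 'I_d * 'I_k -> T -> R.
Hypothesis gX : gaussian_family P (X : I -> T -> R).

Lemma bounded_path (F : Omega -> R) : measurable_fun [set: Omega] F ->
  (exists C, forall x, `|F x| <= C) -> bounded_measurable (fun w => F (X^~ w)).
Proof.
move=> mF [C FC]; split; last by exists C => w; exact: FC.
by apply: (measurableT_comp mF); apply: measurable_path; case: gX.
Qed.

Lemma potential_bounded : exists C, forall s, inv s -> `|pot s| <= C.
Proof.
have D2 := D_ge2 kd mu_gt0 mu_le_L.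
exists ((2 * eta0 * D + 2 * D * a0) * expR (expo d k L mu eta0 * a0)) => s inv_s.
have p0 := potential_ge0 kd mu_gt0 mu_le_L M_gt0 inv_s.
have K0 := expo_ge0 kd mu_gt0 mu_le_L eta0_ge1.
have a_le := lam_bounded inv_s.
rewrite ger0_norm // /potential ler_pM ?expR_ge0 //.
- rewrite addr_ge0 ?(gap_ge0 mu_gt0 inv_s) // mulr_ge0 //; first lra.
  by rewrite mulr_ge0 ?lam_ge0 // ltW.
- apply: lerD; first exact: gap_bounded.
  by rewrite ler_wpM2l //; lra.
- by rewrite ler_expR ler_wpM2l.
Qed.

Lemma bounded_potential t :
  bounded_measurable (fun w => pot (random_state t (X^~ w))).
Proof.
apply: (@bounded_path (fun x => pot (random_state t x))); first exact: measurable_potential.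
by have [C h] := potential_bounded; exists C => x; apply: h; exact: run_inv.
Qed.

Section step.
Variable t : nat.

Let S (x : Omega) := random_state t x.
(** The exponential factor of the potential at time [t + 1], a function of the draws before time
    [t]. *)
Let e (x : Omega) : R := expR (expo d k L mu eta0 * (M * next_lam H g (S x))).
Let eR i j (x : Omega) : R := e x * residual M H g (S x) i j.

Let invS x : inv (S x). Proof. exact: run_inv. Qed.

Let me : measurable_fun [set: Omega] e.
Proof.
apply: measurableT_comp => //; do 2 apply: measurable_funM => //.
exact: measurable_lam_state t.+1.
Qed.

Let e_bounded x : `|e x| <= expR (expo d k L mu eta0 * a0).
Proof.
rewrite ger0_norm ?expR_ge0 // ler_expR ler_wpM2l //; last exact: next_lam_bounded.
exact: (expo_ge0 kd mu_gt0 mu_le_L eta0_ge1).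
Qed.

Let meR i j : measurable_fun [set: Omega] (eR i j).
Proof. by apply: measurable_funM => //; exact: mx_measurable_residual. Qed.

Let beR i j : exists C, forall x, `|eR i j x| <= C.
Proof.
have [C h] := residual_bounded.
exists (expR (expo d k L mu eta0 * a0) * C) => x.
by rewrite normrM ler_pM // h.
Qed.

Let past i j (x y : Omega) : (forall s a b, s != t -> x (s, a, b) = y (s, a, b)) ->
  eR i j x = eR i j y.
Proof.
move=> xy; rewrite /eR /e /S (@random_state_past t x y) // => s a b st.
by apply: xy; rewrite ltn_eqF.
Qed.

Let bfP i j : bounded_measurable
  (fun w => eR i j (X^~ w) * proj (sample_mx (X^~ w) t) j i).
Proof.
apply: (@bounded_path (fun x => eR i j x * proj (sample_mx x t) j i)).
  by apply: measurable_funM => //; exact: mx_measurable_proj.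
have [C h] := beR i j; exists C => x; rewrite normrM -[leRHS]mulr1.
by rewrite ler_pM // proj_entry_bound.
Qed.

Let bR i j : bounded_measurable (fun w => eR i j (X^~ w)).
Proof. exact: bounded_path. Qed.

(** Each entry of the weighted residual depends on the past only, so it can serve as the factor [F]
    against the entries of the projection: off-diagonal means vanish and diagonal ones give
    [k / d]. *)
Lemma mean_residual_proj :
  (\int[P]_w (e (X^~ w) * \tr (residual M H g (S (X^~ w)) *m proj (sample_mx (X^~ w) t)))
   = k%:R / d%:R * \int[P]_w (e (X^~ w) * \tr (residual M H g (S (X^~ w)))))%R.
Proof.
have /andP[k0 /ltnW kd'] := kd.
transitivity (\int[P]_w (\sum_(i < d) \sum_(j < d)
    eR i j (X^~ w) * proj (sample_mx (X^~ w) t) j i))%R.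
  apply: eq_Rintegral => w _; rewrite /mxtrace mulr_sumr; apply: eq_bigr => i _.
  by rewrite mxE mulr_sumr; apply: eq_bigr => j _; rewrite mulrA.
rewrite mean_sum; last by move=> i; exact: bounded_measurable_sum.
transitivity (\sum_(i < d) (k%:R / d%:R * \int[P]_w eR i i (X^~ w)))%R.
  apply: eq_bigr => i _; rewrite mean_sum // (bigD1 i) //= big1 ?addr0 => [|j ji].
    exact: (mean_proj_diag k0 kd' gX (meR i i) (beR i i) (@past i i) i).
  exact: (mean_proj_offdiag gX (meR i j) (beR i j) (@past i j) ji).
rewrite -mulr_sumr -mean_sum //; congr (_ * _).
by apply: eq_Rintegral => w _; rewrite /mxtrace mulr_sumr.
Qed.

Lemma mean_potential_step :
  (\int[P]_w pot (random_state t.+1 (X^~ w)) <=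
   rho * \int[P]_w pot (random_state t (X^~ w)))%R.
Proof.
pose a' (x : Omega) : R := M * next_lam H g (S x).
pose trR (x : Omega) : R := \tr (residual M H g (S x)).
pose trP (x : Omega) : R := \tr (residual M H g (S x) *m proj (sample_mx x t)).
have bA' : bounded_measurable (fun w => e (X^~ w) * (2 * D * a' (X^~ w))).
  apply: (@bounded_path (fun x => e x * (2 * D * a' x))).
    apply: measurable_funM => //; do 2 apply: measurable_funM => //.
    exact: measurable_lam_state t.+1.
  exists (expR (expo d k L mu eta0 * a0) * (2 * D * a0)) => x.
  have D2 := D_ge2 kd mu_gt0 mu_le_L.
  have a'0 : 0 <= a' x by rewrite mulr_ge0 ?dual_norm_ge0 // ltW.
  have ca0 : 0 <= 2 * D * a' x by rewrite mulr_ge0 //; lra.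
  rewrite normrM ler_pM // ger0_norm // ler_wpM2l //; first lra.
  exact: next_lam_bounded.
have bT : bounded_measurable (fun w => e (X^~ w) * trR (X^~ w)).
  have -> : (fun w => e (X^~ w) * trR (X^~ w)) = (fun w => \sum_(i < d) eR i i (X^~ w)).
    by apply/funext => w; rewrite /trR /mxtrace mulr_sumr.
  exact: bounded_measurable_sum.
have bP : bounded_measurable (fun w => e (X^~ w) * trP (X^~ w)).
  have -> : (fun w => e (X^~ w) * trP (X^~ w)) = (fun w => \sum_(i < d) \sum_(j < d)
    eR i j (X^~ w) * proj (sample_mx (X^~ w) t) j i).
    apply/funext => w; rewrite /trP /mxtrace mulr_sumr; apply: eq_bigr => i _.
    by rewrite mxE mulr_sumr; apply: eq_bigr => j _; rewrite mulrA.
  by apply: bounded_measurable_sum => i; exact: bounded_measurable_sum.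
have bc (c : R) F : bounded_measurable F -> bounded_measurable (fun w : T => c * F w).
  by move=> bF; apply: bounded_measurableM => //; exact: bounded_measurable_cst.
have i_ := bounded_integrable.
(* Used twice: with [(1/mu, -1/mu)] after [gap_step], and with [(rho/mu, 0)] before
   [potential_decrease]. The two means coincide, which replaces the random projection by its
   mean. *)
have lin (c1 c2 : R) : (\int[P]_w (c1 * (e (X^~ w) * trR (X^~ w)) +
     (e (X^~ w) * (2 * D * a' (X^~ w)) + c2 * (e (X^~ w) * trP (X^~ w)))) =
   (c1 + c2 * (k%:R / d%:R)) * \int[P]_w (e (X^~ w) * trR (X^~ w))
     + \int[P]_w (e (X^~ w) * (2 * D * a' (X^~ w))))%R.
  rewrite RintegralD //; last 2 first.
  - by apply: i_; exact: bc.
  - by apply: i_; apply: bounded_measurableD => //; exact: bc.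
  rewrite RintegralD //; last 2 first.
  - exact: i_.
  - by apply: i_; exact: bc.
  rewrite !RintegralZl //; try exact: i_.
  by rewrite mean_residual_proj; ring.
have i0 : 0 <= mu^-1 by rewrite invr_ge0 ltW.
apply: (@le_trans _ _ (\int[P]_w (mu^-1 * (e (X^~ w) * trR (X^~ w)) +
     (e (X^~ w) * (2 * D * a' (X^~ w)) + (- mu^-1) * (e (X^~ w) * trP (X^~ w)))))%R).
  apply: le_Rintegral => //.
  - by apply: i_; exact: bounded_potential.
  - apply: i_; apply: bounded_measurableD; first exact: bc.
    by apply: bounded_measurableD => //; exact: bc.
  move=> w _; set x := X^~ w.
  have gs := gap_step mu_gt0 M_gt0 H_posdef H_concordant (invS x) (sample_mx x t).
  have ex : 0 <= e x by exact: expR_ge0.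
  have := ler_wpM2r ex gs; rewrite -/(trR x) -/(trP x).
  have -> : pot (random_state t.+1 x) =
    (gap mu H (step M H g (S x) (sample_mx x t)) + 2 * D * a' x) * e x by [].
  move=> h; rewrite [leLHS]mulrDl; apply: le_trans (lerD h (lexx _)) _.
  by rewrite le_eqVlt; apply/orP; left; apply/eqP; ring.
rewrite lin.
have -> : mu^-1 + - mu^-1 * (k%:R / d%:R) = rho / mu + 0 * (k%:R / d%:R) by ring.
rewrite -lin -RintegralZl //; last by apply: i_; exact: bounded_potential.
apply: le_Rintegral => //.
- apply: i_; apply: bounded_measurableD; first exact: bc.
  by apply: bounded_measurableD => //; exact: bc.
- by apply: i_; apply: bc; exact: bounded_potential.
move=> w _; set x := X^~ w.
have := potential_decrease kd mu_gt0 mu_le_L M_gt0 H_posdef H_concordant g_mvt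
  tr_H_le H_ge eta0_ge1 a0_small (invS x).
apply: le_trans; rewrite -/(trR x) -/(a' x) -/(e x).
by rewrite le_eqVlt; apply/orP; left; apply/eqP; ring.
Qed.

End step.

Lemma mean_potential t :
  (\int[P]_w pot (random_state t (X^~ w)) <= rho ^+ t * pot s0)%R.
Proof.
have rp := rho_gt0 R kd.
elim: t => [|t IH].
  rewrite expr0 mul1r [leLHS](_ : _ = \int[P]_w cst (pot s0) w)%R //.
  by rewrite Rintegral_cst //= probability_setT mulr1.
apply: le_trans (mean_potential_step t) _.
by rewrite exprS -mulrA ler_wpM2l ?(ltW rp).
Qed.

Definition ratio t (x : Omega) : R :=
  lam H g (random_state t.+1 x) / lam H g (random_state t x).

Lemma measurable_ratio t : measurable_fun [set: Omega] (ratio t).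
Proof.
apply: measurable_funM; first exact: measurable_lam_state t.+1.
by apply: measurable_invr; exact: measurable_lam_state.
Qed.

Lemma ratio_ge0 t x : 0 <= ratio t x.
Proof. by rewrite /ratio divr_ge0 ?lam_ge0. Qed.

Lemma bounded_ratio t : bounded_measurable (fun w => ratio t (X^~ w)).
Proof.
apply: bounded_path; first exact: measurable_ratio.
have [C h] := potential_bounded; exists (23 / 20 * C) => x.
rewrite ger0_norm ?ratio_ge0 //; apply: le_trans (ratio_le_potential _ _) _.
by rewrite ler_wpM2l //; apply: le_trans (ler_norm _) (h _ _); exact: run_inv.
Qed.

Lemma mean_ratio t : (\int[P]_w ratio t (X^~ w) <= 2 * D * eta0 * rho ^+ t)%R.
Proof.
have rp := rho_gt0 R kd.
apply: (@le_trans _ _ (\int[P]_w (23 / 20 * pot (random_state t (X^~ w))))%R).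
  apply: le_Rintegral => //.
  - exact/bounded_integrable/bounded_ratio.
  - apply: bounded_integrable; apply: bounded_measurableM (bounded_potential t).
    exact: bounded_measurable_cst.
  - by move=> w _; exact: ratio_le_potential.
rewrite RintegralZl //; last exact/bounded_integrable/bounded_potential.
apply: le_trans (ler_wpM2l _ (mean_potential t)) _; first lra.
rewrite mulrCA [leRHS]mulrC ler_wpM2l ?exprn_ge0 ?(ltW rp) //.
exact: potential_start.
Qed.

Lemma expectation_ratio t :
  ('E_P[fun w => (ratio t (X^~ w))%R] <= (2 * D * eta0 * rho ^+ t)%:E)%E.
Proof.
rewrite unlock.
have fin := integrable_fin_num measurableT (bounded_integrable P (bounded_ratio t)).
by rewrite -(fineK fin) lee_fin; exact: mean_ratio.
Qed.

Lemma ratio_markov t a : 0 < a ->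
  (P [set w | (a < ratio t (X^~ w))%R] <= (2 * D * eta0 * rho ^+ t / a)%:E)%E.
Proof.
move=> a0'; set B := [set w | _].
have mB : measurable B.
  rewrite (_ : B = (fun w => ratio t (X^~ w)) @^-1` `]a, +oo[); last first.
    by apply/seteqP; split => w /=; rewrite in_itv /= andbT.
  by rewrite -[_ @^-1` _]setTI; apply: (bounded_ratio t).1.
rewrite -(fineK (fin_num_measure P _ mB)) lee_fin ler_pdivlMr // mulrC.
apply: le_trans (mean_ratio t).
have b1 : bounded_measurable (\1_B : T -> R).
  split; first exact: measurable_indic.
  by exists 1 => w; rewrite indicE; case: (_ \in _); rewrite ?normr1 ?normr0.
have -> : fine (P B) = (\int[P]_w (\1_B w : R))%R.
  by rewrite /Rintegral integral_indic // setIT.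
rewrite -RintegralZl //; last exact: bounded_integrable.
apply: le_Rintegral => //.
- apply: bounded_integrable; apply: bounded_measurableM => //.
  exact: bounded_measurable_cst.
- exact/bounded_integrable/bounded_ratio.
move=> w _; rewrite indicE; case: (asboolP (B w)) => [Bw|nBw].
  by rewrite mem_set // mulr1 ltW.
by rewrite memNset // mulr0 ratio_ge0.
Qed.

Local Notation q := (1 - k%:R / (d%:R + k%:R) : R).

Lemma rate_quotient : rho = (1 - k%:R ^+ 2 / d%:R ^+ 2) * q.
Proof.
have d0 : 0 < d%:R :> R by rewrite ltr0n (d_gt0 kd).
by field; rewrite !gt_eqF // ltr_wpDr.
Qed.

Lemma q_gt0 : 0 < q.
Proof.
have d0 : 0 < d%:R :> R by rewrite ltr0n (d_gt0 kd).
have k0 : 0 <= k%:R :> R by [].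
by rewrite subr_gt0 ltr_pdivrMr ?ltr_wpDr // mul1r ltrDr.
Qed.

(* Since [rho = (1 - k^2/d^2) q], Markov's inequality bounds the probability of
   failure at time [t] by a term of a geometric series of sum [delta]. *)
Lemma ratio_with_high_probability delta : 0 < delta ->
  ((1 - delta)%:E <= P [set w | forall t,
     (ratio t (X^~ w) <= 2 * D * eta0 * (d%:R ^+ 2 / (k%:R ^+ 2 * delta)) * q ^+ t)%R])%E.
Proof.
move=> delta0; have /andP[k0 kltd] := kd.
have d0 : 0 < d%:R :> R by rewrite ltr0n (d_gt0 kd).
have k0' : 0 < k%:R :> R by rewrite ltr0n.
have D2 := D_ge2 kd mu_gt0 mu_le_L.
have q0 := q_gt0.
pose c : R := 2 * D * eta0 * (d%:R ^+ 2 / (k%:R ^+ 2 * delta)).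
have D0 : 0 < 2 * D * eta0.
  apply: mulr_gt0; [apply: mulr_gt0 => //; exact: lt_le_trans D2|exact: lt_le_trans eta0_ge1].
have c0 : 0 < c by rewrite mulr_gt0 // divr_gt0 ?mulr_gt0 ?exprn_gt0.
pose B t := [set w | c * q ^+ t < ratio t (X^~ w)].
have mB t : measurable (B t).
  rewrite (_ : B t = (fun w => ratio t (X^~ w)) @^-1` `]c * q ^+ t, +oo[); last first.
    by apply/seteqP; split => w /=; rewrite in_itv /= andbT.
  by rewrite -[_ @^-1` _]setTI; apply: (bounded_ratio t).1.
have mUB : measurable (\bigcup_t B t) by exact: bigcup_measurable.
have -> : [set w | forall t, ratio t (X^~ w) <= c * q ^+ t] = ~` \bigcup_t B t.
  apply/seteqP; split => w /=.
    by move=> h [t _]; rewrite /B /= ltNge h.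
  by move=> h t; rewrite leNgt; apply/negP => ?; apply: h; exists t.
rewrite probability_setC // EFinB; apply: leeB => //.
pose s : R := 1 - k%:R ^+ 2 / d%:R ^+ 2.
have kd2 : k%:R ^+ 2 / d%:R ^+ 2 <= 1 :> R.
  rewrite ler_pdivrMr ?exprn_gt0 // mul1r ler_pXn2r ?nnegrE //.
  by rewrite ler_nat ltnW.
have kd0 : 0 < k%:R ^+ 2 / d%:R ^+ 2 :> R by rewrite divr_gt0 ?exprn_gt0.
apply: (le_trans (generalized_Boole_inequality P mB mUB)).
apply: lime_le; first exact: is_cvg_nneseries.
near=> n.
apply: (@le_trans _ _ (\sum_(0 <= t < n) (delta * (1 - s) * s ^+ t)%:E)%E).
  apply: lee_sum => t _; apply: le_trans (ratio_markov t _) _.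
    by rewrite mulr_gt0 // exprn_gt0.
  rewrite lee_fin rate_quotient -/s exprMn /c le_eqVlt; apply/orP; left; apply/eqP.
  rewrite /s; field.
  have L0 : 0 < L by exact: lt_le_trans mu_le_L.
  have e0 : 0 < eta0 by exact: lt_le_trans eta0_ge1.
  have qt0 : 0 < q ^+ t by exact: exprn_gt0.
  by rewrite !gt_eqF.
rewrite sumEFin lee_fin -mulr_sumr -mulrA ger_pMr // big_mkord.
by apply: geometric_sum_le; rewrite /s; lra.
Unshelve. all: by end_near.
Qed.

Lemma rate_bound : q <= expR (- (k%:R / (2 * d%:R))).
Proof.
have /andP[k0 /ltnW kltd] := kd.
have d0 : 0 < d%:R :> R by rewrite ltr0n (d_gt0 kd).
have k0' : 0 < k%:R :> R by rewrite ltr0n.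
have kd' : k%:R <= d%:R :> R by rewrite ler_nat.
apply: le_trans (expR_ge1Dx _); rewrite lerD2l lerN2.
rewrite ler_wpM2l ?(ltW k0') // lef_pV2 ?posrE; lra.
Qed.

(** When the denominator is 0 the quotient carries no information; the linear bound then forces the
    next value to vanish as well. *)
Lemma lam_run_ratio (U : nat -> 'M[R]_(d, k)) t c :
  lam H g (runU U t.+1) / lam H g (runU U t) <= c ->
  lam H g (runU U t.+1) <= c * lam H g (runU U t).
Proof.
have [l0 _|l0] := eqVneq (lam H g (runU U t)) 0.
  by have := lam_run_linear U t; rewrite l0 !mulr0.
by rewrite ler_pdivrMr // lt_neqAle eq_sym l0 lam_ge0.
Qed.

Lemma two_stage_run (U : nat -> 'M[R]_(d, k)) (c r : R) t0 :
  0 <= r -> c * r ^+ t0 <= 1 / 2 ->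
  (forall t, lam H g (runU U t.+1) / lam H g (runU U t) <= c * r ^+ t) ->
  forall t, lam H g (runU U (t0 + t)) <=
    r ^+ (t * (t - 1) %/ 2)%N * (1 / 2) ^+ t * (1 - 1 / (2 * eta0)) ^+ t0 * lam H g s0.
Proof.
move=> r0 cr h; apply: (@two_stage R (fun t => lam H g (runU U t)) _ c) => //.
- by move=> t; exact: lam_ge0.
- have e1 := eta0_ge1; rewrite subr_ge0 ler_pdivrMr; lra.
- exact: lam_run_linear.
- by move=> t; exact: lam_run_ratio.
Qed.

Lemma two_stage_greedy (U : nat -> 'M[R]_(d, k)) :
  (forall t, is_E (residual M H g (runU U t)) (U t)) ->
  exists t0 : nat, t0%:R <= 12 * (d%:R * ln (eta0 * d%:R * kappa) / k%:R) /\
    forall t, lam H g (runU U (t0 + t)) <=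
      rho ^+ (t * (t - 1) %/ 2)%N * (1 / 2) ^+ t * (1 - 1 / (2 * eta0)) ^+ t0 * lam H g s0.
Proof.
move=> gr; have /andP[k0 kltd] := kd.
have d0 : 0 < d%:R :> R by rewrite ltr0n (d_gt0 kd).
have k0' : 0 < k%:R :> R by rewrite ltr0n.
have D2 := D_ge2 kd mu_gt0 mu_le_L.
have rp := rho_gt0 R kd.
pose Z := eta0 * d%:R * kappa.
have ZE : Z = D * eta0 by rewrite /Z; ring.
have e1 := eta0_ge1.
have Z2 : 2 <= Z by rewrite ZE; nra.
have rq : rho <= q.
  by rewrite lerD2l lerN2 ler_wpM2l ?(ltW k0') // lef_pV2 ?posrE; lra.
have [|t0 [t0_le h]] := exists_switch_time _ Z2 (ltW rp) (le_trans rq rate_bound).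
  by rewrite k0 ltnW.
exists t0; split => // t.
apply: (@two_stage_run _ (2 * D * eta0) rho); [exact: ltW | | exact: greedy_ratio].
have rt : 0 <= rho ^+ t0 by rewrite exprn_ge0 // ltW.
(* Weakens the factor to the cubic one of [exists_switch_time], whose form is dictated by the
   randomized case. *)
have Z3 : 4 * Z <= 4 * Z ^+ 3.
  by rewrite ler_wpM2l // ler_eXnr //; lra.
have -> : 2 * D * eta0 = 2 * Z by rewrite ZE; ring.
have := ler_wpM2r rt Z3; lra.
Qed.

Lemma two_stage_random delta : 0 < delta < 1 ->
  exists t0 : nat, t0%:R <= 12 * (d%:R * ln (kappa * d%:R * eta0 / delta) / k%:R) /\
    let E := [set w | forall t, lam H g (random_state (t0 + t) (X^~ w)) <=
      q ^+ (t * (t - 1) %/ 2)%N * (1 / 2) ^+ t * (1 - 1 / (2 * eta0)) ^+ t0 * lam H g s0] in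
    measurable E /\ ((1 - delta)%:E <= P E)%E.
Proof.
move=> /andP[delta0 delta1]; have /andP[k0 kltd] := kd.
have d0 : 0 < d%:R :> R by rewrite ltr0n (d_gt0 kd).
have k0' : 1 <= k%:R :> R by rewrite ler1n.
have D2 := D_ge2 kd mu_gt0 mu_le_L.
have e1 := eta0_ge1; have q0 := q_gt0.
pose Z := kappa * d%:R * eta0 / delta.
have ZE : Z = D * eta0 / delta by rewrite /Z; ring.
have De0 : 0 < D * eta0 by rewrite mulr_gt0 //; lra.
have DZ : D * eta0 <= Z by rewrite ZE ler_pdivlMr // ger_pMr // ltW.
have dZ : d%:R <= Z.
  apply: le_trans DZ; rewrite -mulrA ler_peMr ?(ltW d0) // -[leLHS]mulr1.
  by apply: ler_pM => //; exact: kappa_ge1.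
have Z2 : 2 <= Z by apply: le_trans DZ; nra.
have [|t0 [t0_le h]] := exists_switch_time _ Z2 (ltW q0) rate_bound.
  by rewrite k0 ltnW.
exists t0; split => // E.
have mlam t : measurable_fun [set: T] (fun w => lam H g (random_state t (X^~ w))).
  apply: (measurableT_comp (measurable_lam_state t)).
  by apply: measurable_path; case: gX.
have mE : measurable E.
  rewrite (_ : E = \bigcap_t (fun w => lam H g (random_state (t0 + t) (X^~ w))) @^-1`
      `]-oo, q ^+ (t * (t - 1) %/ 2)%N * (1 / 2) ^+ t * (1 - 1 / (2 * eta0)) ^+ t0
        * lam H g s0]); last first.
    by apply/seteqP; split => w /= h' t; [move=> _|]; have := h' t; rewrite /= in_itv //=; exact.
  apply: bigcap_measurable => // t _.
  by rewrite -[_ @^-1` _]setTI; apply: mlam.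
split => //.
apply: le_trans (ratio_with_high_probability delta0) _.
set c := 2 * D * eta0 * _.
apply: le_measure; rewrite ?inE //.
  rewrite (_ : [set w | _] = \bigcap_t (fun w => ratio t (X^~ w)) @^-1`
      `]-oo, c * q ^+ t]); last first.
    by apply/seteqP; split => w /= h' t; [move=> _|]; have := h' t; rewrite /= in_itv //=; exact.
  apply: bigcap_measurable => // t _.
  by rewrite -[_ @^-1` _]setTI; apply: (bounded_ratio t).1.
move=> w /= hw; apply: (@two_stage_run _ c q) => //; first exact: ltW.
have qt : 0 <= q ^+ t0 by rewrite exprn_ge0 // ltW.
(* [2 c = 4 Z (d/k)^2] and [d/k <= Z]: the origin of the cube in [exists_switch_time]. *)
have cZ : 2 * c <= 4 * Z ^+ 3.
  have -> : 2 * c = 4 * (Z * (d%:R / k%:R) ^+ 2).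
    rewrite /c ZE; field.
    by rewrite !gt_eqF // (lt_le_trans _ k0').
  rewrite ler_wpM2l // (exprS Z) ler_wpM2l //; first lra.
  have Z0 : 0 <= Z by lra.
  rewrite ler_pXn2r ?nnegrE // ?divr_ge0 //.
  by apply: le_trans dZ; rewrite ler_pdivrMr ?ler_peMr ?(ltW d0) // (lt_le_trans _ k0').
have := ler_wpM2r qt cZ; lra.
Qed.

End expectation.
End random_run.

Lemma loewner_symr (R : realType) d (A B : 'M[R]_d) : loewner A B -> B^T = B -> A^T = A.
Proof. by move=> [h _] BT; move: h; rewrite trmxB BT => /addrI/oppr_inj. Qed.

(** [loewner] includes symmetry of the difference. Comparison with [G0] makes the Hessian at [x0]
    symmetric, and self-concordance with reference point [x0] carries this to every [x]. *)
Lemma hess_sym (R : realType) d (f : 'cV[R]_d -> R) M x0 (G0 : 'M[R]_d) :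
  strongly_self_concordant M f -> G0^T = G0 -> loewner (hess f x0) G0 ->
  forall x, (hess f x)^T = hess f x.
Proof.
move=> sc GT /loewner_symr /(_ GT); move: (sc x0) => {sc}.
move: (hess f) (local_norm f) => h n sc hT x.
have : (h x - h x0)^T = h x - h x0.
  by apply: loewner_symr (sc x x0 x0) _; rewrite linearZ /= hT.
by rewrite trmxB hT => /addIr.
Qed.

Lemma srk_run (R : realType) d k (f : 'cV[R]_d -> R) M x0 G0 (U : nat -> 'M[R]_(d, k)) t :
  srk f M x0 G0 U t = run M (hess f) (grad f) (x0, G0) U t.
Proof.
elim: t => [|t IH]; first reflexivity.
transitivity (step M (hess f) (grad f) (srk f M x0 G0 U t) (U t)); first reflexivity.
by rewrite IH.
Qed.

Lemma srk_lambdaE (R : realType) d k (f : 'cV[R]_d -> R) M x0 G0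
    (U : nat -> 'M[R]_(d, k)) t :
  srk_lambda f M x0 G0 U t = lam (hess f) (grad f) (run M (hess f) (grad f) (x0, G0) U t).
Proof. by rewrite /srk_lambda srk_run. Qed.

(** [ln 2 <= 3/4] replaces the constant of the hypothesis by the rational [3/8] from which all other
    constants are derived. *)
Lemma initial_bound (R : realType) (d k : nat) (kappa eta0 : R) :
  (1 <= k < d)%N -> 1 <= kappa -> 1 <= eta0 ->
  ln 2 / 2 * ((d%:R - k%:R) / (eta0 * d%:R ^+ 2 * kappa)) <=
    3 / 8 * ((1 - k%:R / d%:R) / (eta0 * (d%:R * kappa))).
Proof.
move=> /andP[k0 kltd] kappa1 e1.
have d0 : 0 < d%:R :> R by rewrite ltr0n (leq_trans _ kltd).
have kappa0 : 0 < kappa by exact: lt_le_trans kappa1.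
have e0 : 0 < eta0 by exact: lt_le_trans e1.
have -> : (1 - k%:R / d%:R) / (eta0 * (d%:R * kappa)) =
    (d%:R - k%:R) / (eta0 * d%:R ^+ 2 * kappa).
  by field; rewrite !gt_eqF.
apply: ler_wpM2r; last by have := ln2_le R; lra.
by rewrite divr_ge0 ?subr_ge0 ?ler_nat ?(ltnW kltd) // !mulr_ge0 ?exprn_ge0 // ltW.
Qed.

Lemma iid_gaussian_family (R : realType) disp (T : measurableType disp) (P : probability T R)
    d k (U : nat -> 'I_d -> 'I_k -> {RV P >-> R}) :
  iid_gaussian U ->
  gaussian_family P (fun p : (nat * 'I_d * 'I_k)%type => U p.1.1 p.1.2 p.2 : T -> R).
Proof.
move=> [indU lawU]; split => // p A mA.
by rewrite -(lawU p.1.1 p.1.2 p.2).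
Qed.

Theorem theorem4p3 (R : realType) :
  exists C : R, 0 < C /\
  forall (d k : nat) (f : 'cV[R]_d -> R) (L mu M eta0 : R)
    (x0 : 'cV[R]_d) (G0 : 'M[R]_d),
  (1 <= k < d)%N ->
  0 < mu -> 0 < M -> 1 <= eta0 ->
  twice_differentiable f ->
  smooth L f ->
  strongly_convex mu f ->
  strongly_self_concordant M f ->
  posdef G0 ->
  let kappa := L / mu in
  M * local_grad_norm f x0
    <= ln 2 / 2 * ((d%:R - k%:R) / (eta0 * d%:R ^+ 2 * kappa)) ->
  loewner (hess f x0) G0 ->
  loewner G0 (eta0 *: hess f x0) ->
  (* randomized strategy *)
  (forall (disp : measure_display) (T : measurableType disp)
     (P : probability T R) (U : nat -> 'I_d -> 'I_k -> {RV P >-> R}),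
   iid_gaussian U ->
   let lambda (t : nat) (w : T) := srk_lambda f M x0 G0 (sample U w) t in
   (forall t : nat,
      measurable_fun [set: T] (fun w => lambda t.+1 w / lambda t w) /\
      ('E_P[fun w => (lambda t.+1 w / lambda t w)%R]
         <= (2 * d%:R * kappa * eta0 * (1 - k%:R / d%:R) ^+ t)%:E)%E) /\
   (forall delta : R, 0 < delta < 1 ->
      exists t0 : nat,
        t0%:R <= C * (d%:R * ln (kappa * d%:R * eta0 / delta) / k%:R) /\
        let E := [set w : T | forall t : nat,
          lambda (t0 + t)%N w
            <= (1 - k%:R / (d%:R + k%:R)) ^+ (t * (t - 1) %/ 2)%N
               * (1 / 2) ^+ t * (1 - 1 / (2 * eta0)) ^+ t0 * local_grad_norm f x0] in
        measurable E /\ ((1 - delta)%:E <= P E)%E)) /\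
  (* greedy strategy *)
  (forall U : nat -> 'M[R]_(d, k),
   greedy f M x0 G0 U ->
   let lambda (t : nat) := srk_lambda f M x0 G0 U t in
   (forall t : nat,
      lambda t.+1 / lambda t
        <= 2 * d%:R * kappa * eta0 * (1 - k%:R / d%:R) ^+ t) /\
   exists t0 : nat,
     t0%:R <= C * (d%:R * ln (eta0 * d%:R * kappa) / k%:R) /\
     forall t : nat,
       lambda (t0 + t)%N
         <= (1 - k%:R / d%:R) ^+ (t * (t - 1) %/ 2)%N
            * (1 / 2) ^+ t * (1 - 1 / (2 * eta0)) ^+ t0 * local_grad_norm f x0).
Proof.
(* The constant of [exists_switch_time], common to both strategies. *)
exists 12; split=> // d k f L mu M eta0 x0 G0 kd mu0 M0 e1 f2 sm sc con G0pd kappa small low upp.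
have dgf := f2.2.
have hT := hess_sym con G0pd.1 low.
have d0 : (0 < d)%N by case/andP: kd => _; apply: leq_trans.
have mL : mu <= L by exact: (mu_le_L f2 sm sc d0).
have pd := hess_posdef mu0 f2 sc hT.
have cq : forall x y z w v, quad (hess f y) v - quad (hess f x) v
    <= M * energy_norm (hess f z) (y - x) * quad (hess f w) v.
  exact: concordant_quad con.
have mv := fun x h u : 'cV[R]_d => grad_mvt x h u dgf.
have tr_le := tr_hess_le f2 sm.
have ge := hess_ge f2 sc.
have k1 : 1 <= kappa by rewrite ler_pdivlMr // mul1r.
have a0s : M * lam (hess f) (grad f) (x0, G0)
    <= 3 / 8 * ((1 - k%:R / d%:R) / (eta0 * (d%:R * kappa))).
  exact: le_trans small (initial_bound kd k1 e1).
have mH : forall X : path_space R (nat * 'I_d * 'I_k)%type -> 'cV[R]_d,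
  mx_measurable X -> mx_measurable (fun w => hess f (X w)).
  by move=> X; exact: mx_measurable_hess.
have mg : forall X : path_space R (nat * 'I_d * 'I_k)%type -> 'cV[R]_d,
  mx_measurable X -> mx_measurable (fun w => grad f (X w)).
  by move=> X; exact: mx_measurable_grad.
have a0E : M * lam (hess f) (grad f) (x0, G0) = M * lam (hess f) (grad f) (x0, G0) by exact: erefl.
have low0 : loewner (hess f (x0, G0).1) (x0, G0).2 by exact: low.
have upp0 : loewner (x0, G0).2 (eta0 *: hess f (x0, G0).1) by exact: upp.
have lamE := srk_lambdaE f M x0 G0.
split.
  move=> disp T P U iidU lambda.
  have gU := iid_gaussian_family iidU.
  pose X (p : nat * 'I_d * 'I_k) : T -> R := U p.1.1 p.1.2 p.2.
  have lE t w : lambda t w =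
      lam (hess f) (grad f) (random_state M (hess f) (grad f) (x0, G0) t (X^~ w)).
    exact: lamE.
  split.
    move=> t.
    have -> : (fun w => lambda t.+1 w / lambda t w) =
        (fun w => ratio M (hess f) (grad f) (x0, G0) t (X^~ w)).
      by apply/funext => w; rewrite !lE.
    split.
      have br := bounded_ratio kd mu0 mL M0 pd cq mv tr_le ge e1 a0s low0 upp0 a0E mH mg gU t.
      exact: br.1.
    have -> : 2 * d%:R * kappa = 2 * (d%:R * kappa) by rewrite mulrA.
    exact: (expectation_ratio kd mu0 mL M0 pd cq mv tr_le ge e1 a0s low0 upp0 a0E mH mg gU t).
  move=> delta delta01.
  have [t0 [t0_le h]] := two_stage_random kd mu0 mL M0 pd cq mv tr_le ge e1 a0s low0
    upp0 a0E mH mg gU delta01.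
  exists t0; split => // E.
  have -> : E = [set w | forall t,
      lam (hess f) (grad f) (random_state M (hess f) (grad f) (x0, G0) (t0 + t) (X^~ w)) <=
      (1 - k%:R / (d%:R + k%:R)) ^+ (t * (t - 1) %/ 2)%N * (1 / 2) ^+ t *
      (1 - 1 / (2 * eta0)) ^+ t0 * lam (hess f) (grad f) (x0, G0)].
    by apply/seteqP; split => w /= hw t; have := hw t; rewrite lE.
  exact: h.
move=> U gr lambda.
have gr' t : is_E (residual M (hess f) (grad f) (run M (hess f) (grad f) (x0, G0) U t)) (U t).
  by have := gr t; rewrite /= srk_run.
split.
  move=> t; rewrite /lambda !lamE.
  have -> : 2 * d%:R * kappa = 2 * (d%:R * kappa) by rewrite mulrA.
  exact: (greedy_ratio kd mu0 mL M0 pd cq mv tr_le ge e1 a0s low0 upp0 a0E gr').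
have [t0 [t0_le h]] := two_stage_greedy kd mu0 mL M0 pd cq mv tr_le ge e1 a0s low0 upp0 a0E gr'.
exists t0; split => // t; rewrite /lambda lamE.
exact: h.
Qed.
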